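(* Let $\Gamma=\Gamma(N,\{A^i\},\{J^i\})$ be a game with $N$ players, action sets $A^i\subseteq\mathbb{R}^d$, joint action set $\boldsymbol{A}=A^1\times\cdots\times A^N\subseteq\mathbb{R}^{Nd}$, cost functions $J^i$ and pseudo-gradient $\boldsymbol{M}$. Assume: 1. (Convexity) For every $i\in[N]$ the set $A^i$ is convex and closed, and $J^i(\boldsymbol{a}^i,\boldsymbol{a}^{-i})$ is defined on $\mathbb{R}^{Nd}$, continuously differentiable in $\boldsymbol{a}$, and convex in $\boldsymbol{a}^i$ for fixed $\boldsymbol{a}^{-i}$. 2. (Compactness) The sets $A^i$, $i\in[N]$, are compact. 3. (Strong variational stability) The Nash equilibrium $\boldsymbol{a}^*$ of $\Gamma$ is globally $\nu$-strongly variationally stable for a constant $\nu>0$, i.e. $\langle\boldsymbol{M}(\boldsymbol{a}),\boldsymbol{a}-\boldsymbol{a}^*\rangle\ge\nu\|\boldsymbol{a}-\boldsymbol{a}^*\|^2$ for all $\boldsymbol{a}\in\boldsymbol{A}$. 4. (Growth) For each $i\in[N]$, $J^i(\boldsymbol{x})=O(\exp\{\|\boldsymbol{x}\|^{\alpha}\})$ as $\|\boldsymbol{x}\|\to\infty$, where $\alpha<2$. 5. (Smoothness) The pseudo-gradient $\boldsymbol{M}:\mathbb{R}^{Nd}\to\mathbb{R}^{Nd}$ is twice differentiable over $\mathbb{R}^{Nd}$. Let $j\in\{1,2\}$ and let the states $\boldsymbol{\mu}^i(t)$, $i\in[N]$, evolve according to the zeroth-order algorithm described in the context with gradient estimators $\boldsymbol{m}^i_j(t)$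 (one-point if $j=1$, two-point if $j=2$). Let the step size be $\gamma_t=\frac{c}{t}$ with $c\ge\frac{1}{\nu}$, and let $$\sigma_t=\begin{cases}\dfrac{a}{t^{1/4}},&\text{if } j=1,\\[2mm] \dfrac{a}{t^{s}},&\text{if } j=2,\end{cases}$$ where $a>0$ and $s\ge1$. Then the joint state $\boldsymbol{\mu}(t)=(\boldsymbol{\mu}^1(t),\ldots,\boldsymbol{\mu}^N(t))$ converges almost surely to the unique Nash equilibrium $\boldsymbol{\mu}^*=\boldsymbol{a}^*$ of $\Gamma$ as $t\to\infty$, and the joint query point $\boldsymbol{\xi}(t)=(\boldsymbol{\xi}^1(t),\ldots,\boldsymbol{\xi}^N(t))$ converges in probability to $\boldsymbol{a}^*$. Moreover, as $t\to\infty$, $$\mathrm{E}\,\|\boldsymbol{\mu}(t)-\boldsymbol{a}^*\|^2=\begin{cases}O\!\left(\dfrac{Nd}{t^{1/2}}\right),&\text{if } j=1,\\[2mm] O\!\left(\dfrac{N^2d^2}{t}\right),&\text{if } j=2.\end{cases}$$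
   Context: Notation: $[N]=\{1,\ldots,N\}$; $\|\cdot\|$ and $\langle\cdot,\cdot\rangle$ are the Euclidean norm and inner product; $\mathrm{Proj}_{\Omega}$ is the Euclidean projection onto $\Omega$. A joint action is $\boldsymbol{a}=(\boldsymbol{a}^1,\ldots,\boldsymbol{a}^N)=(\boldsymbol{a}^i,\boldsymbol{a}^{-i})$ with $\boldsymbol{a}^i\in\mathbb{R}^d$, where $\boldsymbol{a}^{-i}$ collects the actions of all players other than $i$. Nash equilibrium: $\boldsymbol{a}^*\in\boldsymbol{A}$ such that for every $i\in[N]$ and every $\boldsymbol{a}^i\in A^i$, $J^i(\boldsymbol{a}^{*i},\boldsymbol{a}^{*-i})\le J^i(\boldsymbol{a}^i,\boldsymbol{a}^{*-i})$. Pseudo-gradient: $\boldsymbol{M}:\mathbb{R}^{Nd}\to\mathbb{R}^{Nd}$, $\boldsymbol{M}(\boldsymbol{a})=(\nabla_{\boldsymbol{a}^i}J^i(\boldsymbol{a}^i,\boldsymbol{a}^{-i}))_{i=1}^N$. Algorithm: fix $j\in\{1,2\}$ and deterministic sequences $\gamma_t>0$, $\sigma_t>0$. Each player $i$ starts from an arbitrary finite initial state in $\mathbb{R}^d$. At each iteration $t=1,2,\ldots$: - Conditionally on the past (in particular on the current states), the players independently sample query points $\boldsymbol{\xi}^i(t)\in\mathbb{R}^d$, $i\in[N]$, from the Gaussian distribution with mean $\boldsymbol{\mu}^i(t)$ and covariance $\sigma_t^2 I_d$, i.e. with density $\frac{1}{(\sqrt{2\pi}\sigma_t)^d}\exp\{-\sum_{k=1}^d\frac{(x^{i,k}-\mu^{i,k}(t))^2}{2\sigma_t^2}\}$.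 - Each player $i$ forms the estimate $$\boldsymbol{m}^i_1(t)=J^i(\boldsymbol{\xi}(t))\,\frac{\boldsymbol{\xi}^i(t)-\boldsymbol{\mu}^i(t)}{\sigma_t^2}\quad(\text{one-point, } j=1),$$ $$\boldsymbol{m}^i_2(t)=\bigl(J^i(\boldsymbol{\xi}(t))-J^i(\boldsymbol{\mu}(t))\bigr)\frac{\boldsymbol{\xi}^i(t)-\boldsymbol{\mu}^i(t)}{\sigma_t^2}\quad(\text{two-point, } j=2).$$ - Each player updates $\boldsymbol{\mu}^i(t+1)=\mathrm{Proj}_{A^i}[\boldsymbol{\mu}^i(t)-\gamma_t\boldsymbol{m}^i_j(t)]$. The $O(\cdot)$ in the conclusion is for a given game and given algorithm parameters as $t\to\infty$, with the constant not depending on $t$; the factors of $N$ and $d$ are displayed explicitly. *)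

(* Defs.v *)
From mathcomp Require Import all_boot all_order all_algebra.
From mathcomp Require Import all_classical all_reals all_analysis.

Set Implicit Arguments.
Unset Strict Implicit.
Unset Printing Implicit Defensive.

Import Order.TTheory GRing.Theory Num.Theory.
Import numFieldNormedType.Exports.

Local Open Scope classical_set_scope.
Local Open Scope ring_scope.

(* A joint action is an N x d matrix whose i-th row is the action of player i.
   The library norm on matrices is the sup norm: it induces the usual topology
   and differentiability, but all metric notions below use the Euclidean norm. *)
Definition edot (R : realType) (m n : nat) (x y : 'M[R]_(m, n)) : R :=
  \sum_(i < m) \sum_(k < n) x i k * y i k.

Definition enorm (R : realType) (m n : nat) (x : 'M[R]_(m, n)) : R :=
  Num.sqrt (edot x x).

(* Meaningful for nonempty closed convex C, where the minimiser exists and is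
   unique; otherwise [get] may return an arbitrary vector. *)
Definition proj (R : realType) (d : nat) (C : set 'rV[R]_d) (x : 'rV[R]_d) :
    'rV[R]_d :=
  get [set y | C y /\ forall z, C z -> enorm (x - y) <= enorm (x - z)].

Section games.
Variables (R : realType) (N d : nat).
Implicit Types (A : 'I_N -> set 'rV[R]_d) (J : 'I_N -> 'M[R]_(N, d) -> R).

Definition joint_action_set A : set 'M[R]_(N, d) :=
  [set a | forall i, A i (row i a)].

(* (b, a^{-i}) *)
Definition deviate (a : 'M[R]_(N, d)) (i : 'I_N) (b : 'rV[R]_d) :
    'M[R]_(N, d) :=
  \matrix_(l, k) (if l == i then b ord0 k else a l k).

Definition nash_equilibrium A J (a : 'M[R]_(N, d)) : Prop :=
  joint_action_set A a /\
  forall i b, A i b -> J i a <= J i (deviate a i b).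

Definition pseudo_gradient J (a : 'M[R]_(N, d)) : 'M[R]_(N, d) :=
  \matrix_(i, k) 'D_(delta_mx i k) (J i) a.

Definition strongly_variationally_stable A J (nu : R) (astar : 'M[R]_(N, d)) :
    Prop :=
  forall a, joint_action_set A a ->
    nu * enorm (a - astar) ^+ 2 <= edot (pseudo_gradient J a) (a - astar).

End games.

(* On a finite-dimensional domain, continuity (resp. differentiability) of
   x |-> 'd f x amounts to that of x |-> 'd f x v = 'D_v f x for every v; the
   library has no normed space of linear maps in which to state it directly. *)
Definition continuously_differentiable (R : realType) (U V : normedModType R)
    (f : U -> V) : Prop :=
  (forall x, differentiable f x) /\ forall v, continuous ('D_v f).

Definition twice_differentiable (R : realType) (U V : normedModType R)
    (f : U -> V) : Prop :=
  (forall x, differentiable f x) /\ forall v x, differentiable ('D_v f) x.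

Definition exp_power_growth (R : realType) (m n : nat) (alpha : R)
    (f : 'M[R]_(m, n) -> R) : Prop :=
  exists C r : R, forall x, r <= enorm x ->
    `|f x| <= C * expR (enorm x `^ alpha).

Variant oracle := OnePoint | TwoPoint.

Definition query_stddev (R : realType) (j : oracle) (a s : R) (t : nat) : R :=
  match j with
  | OnePoint => a / t%:R `^ 4^-1
  | TwoPoint => a / t%:R `^ s
  end.

Definition mse_rate (R : realType) (j : oracle) (N d t : nat) : R :=
  match j with
  | OnePoint => (N * d)%:R / t%:R `^ 2^-1
  | TwoPoint => (N ^ 2 * d ^ 2)%:R / t%:R
  end.

Section algorithm.
Context {R : realType} {N d : nat}.

Definition grad_estimate (j : oracle) (J : 'I_N -> 'M[R]_(N, d) -> R)
    (sigma : R) (mu xi : 'M[R]_(N, d)) : 'M[R]_(N, d) :=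
  match j with
  | OnePoint => \matrix_(i, k) (J i xi * ((xi i k - mu i k) / sigma ^+ 2))
  | TwoPoint =>
      \matrix_(i, k) ((J i xi - J i mu) * ((xi i k - mu i k) / sigma ^+ 2))
  end.

(* Mass given to the rectangle B_1 x ... x B_d by the normal distribution with
   mean m and covariance sigma^2 I_d: its density is the product of the
   densities of the coordinates. *)
Definition gaussian_rectangle (m : 'rV[R]_d) (sigma : R) (B : 'I_d -> set R) :
    R :=
  \prod_(k < d) fine (normal_prob (m ord0 k) sigma (B k)).

Context {dT : measure_display} {T : measurableType dT}.

Definition random_matrix (X : T -> 'M[R]_(N, d)) : Prop :=
  forall i k, measurable_fun [set: T] (fun w => X w i k).

Definition coordinate_events (X : T -> 'M[R]_(N, d)) : set_system T :=
  \bigcup_(ik in [set: 'I_N * 'I_d])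
    preimage_set_system [set: T] (fun w => X w ik.1 ik.2) measurable.

(* The sigma-algebra generated by mu(1), ..., mu(t), xi(1), ..., xi(t-1). *)
Definition past (mu xi : nat -> T -> 'M[R]_(N, d)) (t : nat) : set_system T :=
  <<s (\bigcup_(u in [set u | (0 < u <= t)%N]) coordinate_events (mu u)) `|`
      (\bigcup_(u in [set u | (0 < u < t)%N]) coordinate_events (xi u)) >>.

(* Given the past at time t, the rows of xi(t) are independent, the i-th one
   being normal with mean mu^i(t) and covariance sigma_t^2 I_d. The conditional
   law is specified on Borel rectangles, which determine it. *)
Definition gaussian_queries (P : probability T R) (sigma : nat -> R)
    (mu xi : nat -> T -> 'M[R]_(N, d)) : Prop :=
  forall t : nat, (0 < t)%N -> forall E : set T, past mu xi t E ->
  forall B : 'I_N -> 'I_d -> set R, (forall i k, measurable (B i k)) ->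
    P (E `&` [set w | forall i k, B i k (xi t w i k)]) =
    (\int[P]_(w in E)
       (\prod_(i < N) gaussian_rectangle (row i (mu t w)) (sigma t) (B i))%:E)%E.

(* Time starts at 1: the values of all sequences at index 0 are irrelevant.
   The initial state mu(1) may be random. *)
Definition zeroth_order_algorithm (j : oracle) (A : 'I_N -> set 'rV[R]_d)
    (J : 'I_N -> 'M[R]_(N, d) -> R) (gamma sigma : nat -> R)
    (P : probability T R) (mu xi : nat -> T -> 'M[R]_(N, d)) : Prop :=
  [/\ forall t, (0 < t)%N -> random_matrix (mu t) /\ random_matrix (xi t),
      gaussian_queries P sigma mu xi &
      forall t, (0 < t)%N -> forall w i,
        row i (mu t.+1 w) =
        proj (A i) (row i (mu t w) - gamma t *:
          row i (grad_estimate j J (sigma t) (mu t w) (xi t w)))].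

Definition cvg_in_probability (P : probability T R)
    (X : nat -> T -> 'M[R]_(N, d)) (x : 'M[R]_(N, d)) : Prop :=
  forall eps : R, 0 < eps ->
    P [set w | eps <= enorm (X t w - x)] @[t --> \oo] --> 0%E.

End algorithm.

(* Main.v *)
(** The compact action sets make the initial distance irrelevant after one step,
    and the noise z = (xi - mu) / sigma_t is, given the past, standard Gaussian
    with independent coordinates. Splitting the cost in the estimator of
    coordinate p as its value with z_p frozen to 0, plus the first-order term in
    z_p, plus a remainder of order sigma_t, the first two parts have conditional
    mean 0 and the partial derivative respectively. With Young's inequality for
    the bias, v_t = E |mu(t) - a*|^2 satisfies
      v_{t+1} <= (1 - (3/2) nu gamma_t) v_t + O(gamma_t sigma_t^2 + gamma_t^2 q_t^2)
    with q_t = 1 / sigma_t (one point) or 1 (two points), whence the rates since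
    nu c >= 1.
    For almost sure convergence no supermartingale theorem is needed: the rate
    t^(-1/2) is summable along t = k^3, hence |mu(k^3) - a*| -> 0 almost surely,
    and between consecutive cubes the pathwise increments add up to o(1) because
    exponential moments of z give gamma_t |m(t)| = o(t^(-2/3)) almost surely. *)

From HB Require Import structures.
Require Import Defs.
From mathcomp Require Import all_boot all_order all_algebra.
From mathcomp Require Import all_classical all_reals all_analysis.
From mathcomp Require Import measurable_realfun.
From mathcomp Require Import ring lra zify.

Set Implicit Arguments.
Unset Strict Implicit.
Unset Printing Implicit Defensive.

Import Order.TTheory GRing.Theory Num.Theory.
Import numFieldNormedType.Exports.

Local Open Scope classical_set_scope.
Local Open Scope ring_scope.

(** * Euclidean geometry of joint actions *)

(** The obstacle is the form of the hypothesis on the queries: a conditional law on rectangles whose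
    mean is itself random. Rounding the means to a mesh freezes them on countably many past events;
    refining the mesh shows that the standardized coordinates are independent of the past and of one
    another. Freezing [z_p] then makes the remaining cost measurable for the past and the other
    coordinates, so that only one-dimensional Gaussian integrals, of [z_p] and [z_p ^+ 2 - 1], have
    to be computed. The growth condition with [alpha < 2] bounds the costs by [expR (e * |z| ^+ 2)]
    with [e] as small as desired. The power 24 of the weight comes from the cubes: steps must be
    [o(t^(-2/3))] while [gamma_t q_t] is only [O(t^(-3/4))], so the noise may cost [o(t^(1/12))],
    which follows from the summability of [h^24 / t^2]. The factor 3/2 in the contraction is what
    remains of the 2 supplied by stability after Young's inequality takes 1/2; being above 1, it
    avoids a logarithmic loss in the rate [1 / t]. *)

Section euclidean.
Context {R : realType} {m n : nat}.
Implicit Types x y z : 'M[R]_(m, n).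

Lemma edot_ge0 x : 0 <= edot x x.
Proof. by apply: sumr_ge0 => i _; apply: sumr_ge0 => k _; rewrite -expr2 sqr_ge0. Qed.

Lemma sqr_enorm x : enorm x ^+ 2 = edot x x.
Proof. by rewrite sqr_sqrtr// edot_ge0. Qed.

Lemma edotDl x y z : edot (x + y) z = edot x z + edot y z.
Proof.
rewrite -big_split; apply: eq_bigr => i _; rewrite -big_split/=.
by apply: eq_bigr => k _; rewrite mxE mulrDl.
Qed.

Lemma edotC x y : edot x y = edot y x.
Proof. by apply: eq_bigr => i _; apply: eq_bigr => k _; rewrite mulrC. Qed.

Lemma edotZl (a : R) x y : edot (a *: x) y = a * edot x y.
Proof.
rewrite mulr_sumr; apply: eq_bigr => i _; rewrite mulr_sumr.
by apply: eq_bigr => k _; rewrite mxE mulrA.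
Qed.

Lemma edotDr x y z : edot z (x + y) = edot z x + edot z y.
Proof. by rewrite edotC edotDl ![edot _ z]edotC. Qed.

Lemma edotZr (a : R) x y : edot x (a *: y) = a * edot x y.
Proof. by rewrite edotC edotZl edotC. Qed.

Lemma edot_line (l : R) x y : edot (x + l *: y) (x + l *: y) =
  edot x x + 2 * l * edot x y + l ^+ 2 * edot y y.
Proof. by rewrite edotDl !edotDr !edotZl !edotZr (edotC y x); ring. Qed.

Lemma edot_coord_le x i k : x i k ^+ 2 <= edot x x.
Proof.
rewrite /edot (bigD1 i)//= (bigD1 k)//= -expr2 -addrA lerDl addr_ge0//.
  by apply: sumr_ge0 => l _; rewrite -expr2 sqr_ge0.
by apply: sumr_ge0 => l _; apply: sumr_ge0 => h _; rewrite -expr2 sqr_ge0.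
Qed.

Lemma edot_eq0 x : edot x x = 0 -> x = 0.
Proof.
move=> x0; apply/matrixP => i k; rewrite mxE; apply/eqP.
by rewrite -sqrf_eq0 eq_le sqr_ge0 -x0 edot_coord_le.
Qed.

Lemma coord_le_norm x i k : `|x i k| <= `|x|.
Proof. by rewrite [leRHS]/Num.Def.normr/= mx_normrE; exact: (le_bigmax _ _ (i, k)). Qed.

Lemma norm_le_coord x e : 0 <= e -> (forall i k, `|x i k| <= e) -> `|x| <= e.
Proof.
by move=> e0 h; rewrite [leLHS]/Num.Def.normr/= mx_normrE; apply: bigmax_le.
Qed.

Lemma edot_le_norm x : edot x x <= (m * n)%:R * `|x| ^+ 2.
Proof.
apply: (@le_trans _ _ (\sum_(i < m) \sum_(k < n) `|x| ^+ 2)).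
  apply: ler_sum => i _; apply: ler_sum => k _.
  by rewrite -expr2 -real_normK ?num_real// lerXn2r ?nnegrE// coord_le_norm.
by rewrite !sumr_const !card_ord -mulrnA mulr_natl mulnC.
Qed.

Lemma continuous_edotB x : continuous (fun y => edot (x - y) (x - y)).
Proof.
move=> y; apply: (@cvg_big _ _ _ _ _ add_continuous _ (nbhs y)) => i _.
apply: (@cvg_big _ _ _ _ _ add_continuous _ (nbhs y)) => k _.
have cxy : (x - z) i k @[z --> y] --> (x - y) i k.
  rewrite !mxE; under eq_fun do rewrite !mxE.
  apply: (@cvgB _ _ _ (nbhs y)); first exact: (@cvg_cst _ _ _ (nbhs y)).
  exact: coord_continuous.
exact: cvgM.
Qed.

End euclidean.

Lemma edot_rows {R : realType} (m n : nat) (x : 'M[R]_(m, n)) :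
  edot x x = \sum_(i < m) edot (row i x) (row i x).
Proof.
apply: eq_bigr => i _; rewrite /edot big_ord1.
by apply: eq_bigr => k _; rewrite mxE.
Qed.

Lemma convex_set_line (R : realType) (d : nat) (C : set 'rV[R]_d) x y (l : R) :
  convex_set C -> C x -> C y -> 0 <= l <= 1 -> C (x + l *: (y - x)).
Proof.
move=> cC Cx Cy l01.
case/andP: l01 => l0 l1.
have -> : x + l *: (y - x) = l *: y + (1 - l) *: x.
  by rewrite scalerBl scale1r scalerBr addrCA.
by have := cC y x (Itv01 l0 l1); rewrite !inE; apply.
Qed.

(** * Projection onto a compact convex set *)

Section projection.
Context {R : realType} {d : nat}.
Variable C : set 'rV[R]_d.
Hypotheses (C0 : C !=set0) (cC : compact C) (vC : convex_set C).

Lemma projP (x : 'rV[R]_d) : C (Defs.proj C x) /\ forall z, C z -> enorm (x - Defs.proj C x) <= enorm (x - z).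
Proof.
rewrite /Defs.proj; apply: (@getPex _ [set y | C y /\ forall z, C z -> enorm (x - y) <= enorm (x - z)]).
have cf : {within C, continuous (fun y => edot (x - y) (x - y))}.
  by apply: continuous_subspaceT; exact: continuous_edotB.
have [c] := compact_EVT_min C0 cC cf.
rewrite inE => Cc cmin; exists c; split => // z Cz.
by apply: ler_wsqrtr; apply: cmin; rewrite inE.
Qed.

(* The segment from the projection to [a] stays in [C], so the first-order
   optimality condition gives <x - p, a - p> <= 0. *)
Lemma proj_le (x a : 'rV[R]_d) : C a ->
  edot (Defs.proj C x - a) (Defs.proj C x - a) <= edot (x - a) (x - a).
Proof.
move=> Ca; have [Cp pmin] := projP x; set p := Defs.proj C x in Cp pmin *.
have dot_le0 : edot (x - p) (a - p) <= 0.
  rewrite leNgt; apply/negP => dp; set D := edot (x - p) (a - p) in dp.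
  pose E := edot (a - p) (a - p).
  have E0 : 0 <= E by exact: edot_ge0.
  (* Moving from [p] by [l] towards [a] changes the squared distance to [x] by
     [- 2 * l * D + l ^+ 2 * E], which is negative because [l * (E + 1) <= D]; the [+ 1] covers
     [E = 0]. *)
  pose l := Num.min 1 (D / (E + 1)).
  have E1 : 0 < E + 1 by lra.
  have l0 : 0 < l by rewrite lt_min ltr01 divr_gt0.
  have l1 : l <= 1 by rewrite ge_min lexx.
  have lD : l * (E + 1) <= D by rewrite -ler_pdivlMr// ge_min lexx orbT.
  have Cl : C (p + l *: (a - p)) by apply: convex_set_line => //; rewrite (ltW l0).
  have := pmin _ Cl; rewrite -ler_sqr ?nnegrE ?sqrtr_ge0// !sqr_enorm.
  have -> : x - (p + l *: (a - p)) = (x - p) + (- l) *: (a - p).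
    by rewrite opprD addrA scaleNr.
  rewrite edot_line -/D -/E.
  have := @edot_ge0 _ _ _ (x - p); nra.
have -> : x - a = (x - p) + (-1) *: (a - p).
  by rewrite scaleN1r opprB addrA subrK.
have -> : p - a = (-1) *: (a - p) by rewrite scaleN1r opprB.
rewrite edot_line edotZl edotZr.
have := @edot_ge0 _ _ _ (x - p); lra.
Qed.

End projection.

(** * Mean value theorem and compactness bounds *)

Section derivatives.
Context {R : realType} {m n : nat}.
Implicit Types (f : 'M[R]_(m, n) -> R) (x y v : 'M[R]_(m, n)).

Lemma derive_sum_delta f x v : differentiable f x ->
  'D_v f x =
  \sum_(i < m) \sum_(k < n) v i k * 'D_(delta_mx i k) f x.
Proof.
move=> df; rewrite deriveE// [in LHS](matrix_sum_delta v) linear_sum.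
apply: eq_bigr => i _; rewrite linear_sum; apply: eq_bigr => k _.
by rewrite linearZ deriveE.
Qed.

Lemma is_derive_line f x v (t : R) : differentiable f (x + t *: v) ->
  is_derive t 1 (fun u => f (x + u *: v)) ('D_v f (x + t *: v)).
Proof.
move=> /(diff_derivable (v := v)) df.
have E : (fun h : R => h^-1 *: (((fun u : R => f (x + u *: v)) \o shift t) (h *: 1)
      - f (x + t *: v))) =
    (fun h : R => h^-1 *: ((f \o shift (x + t *: v)) (h *: v) - f (x + t *: v))).
  apply/funext => h /=; congr (_ *: (f _ - _)).
  by rewrite [h *: 1]mulr1 scalerDl addrCA addrA.
by apply: DeriveDef; rewrite /derivable /derive E.
Qed.

Lemma mvt_line f x v :
  (forall z, differentiable f z) ->
  exists2 t, 0 <= t <= 1 & f (x + v) - f x = 'D_v f (x + t *: v).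
Proof.
move=> df; pose g (t : R) := f (x + t *: v).
have dg (t : R) : is_derive t 1 g ('D_v f (x + t *: v)).
  exact: is_derive_line.
have cg : {within `[0, 1], continuous g}.
  apply: continuous_subspaceT => t; apply: differentiable_continuous.
  by apply/derivable1_diffP; exact: ex_derive.
have [t] := @MVT R g (fun t => 'D_v f (x + t *: v)) 0 1 ltr01 (fun t _ => dg t) cg.
rewrite in_itv/= => /andP[t0 t1]; rewrite /g scale1r scale0r addr0 subr0 mulr1 => ->.
by exists t => //; rewrite !ltW.
Qed.

(** The box is the image, under the continuous reshaping [vec_mx], of a product of [m * n]
    segments. *)
Lemma compact_box (rho : R) : compact [set x : 'M[R]_(m, n) | `|x| <= rho].
Proof.
have [r0|r0] := ltP rho 0.
  rewrite (_ : mkset _ = set0); first exact: compact0.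
  by apply/seteqP; split => x //= xr; have := normr_ge0 x; lra.
have cv : continuous (@vec_mx R m n).
  move=> v; apply/(@cvgrPdist_le _ _ _ (nbhs v)) => e e0; near=> u.
  apply: (@le_trans _ _ `|v - u|); last by near: u; exact: cvgr_dist_le.
  apply: norm_le_coord => // i k; rewrite !mxE.
  by have := coord_le_norm (v - u) ord0 (mxvec_index i k); rewrite !mxE.
rewrite (_ : mkset _ = @vec_mx R m n @`
    [set v : 'rV[R]_(m * n) | forall i, `[- rho, rho]%classic (v ord0 i)]).
  apply: continuous_compact; first exact: continuous_subspaceT.
  by apply: (@rV_compact _ _ (fun=> `[- rho, rho]%classic)) => _;
    exact: segment_compact.
apply/seteqP; split => [x /= xr|_ [v /= vr <-] /=].
  exists (mxvec x); last by rewrite mxvecK.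
  move=> p; case/mxvec_indexP: p => i k.
  by rewrite mxvecE in_itv/= -ler_norml (le_trans (coord_le_norm _ _ _)).
apply: norm_le_coord => // i k; rewrite mxE ler_norml.
by have := vr (mxvec_index i k); rewrite in_itv.
Unshelve. all: by end_near.
Qed.

Lemma bounded_on_box f (rho : R) : continuous f ->
  exists2 K, 0 <= K & forall x, `|x| <= rho -> `|f x| <= K.
Proof.
move=> cf.
have : bounded_set (f @` [set x : 'M[R]_(m, n) | `|x| <= rho]).
  apply: compact_bounded; apply: continuous_compact; last exact: compact_box.
  exact: continuous_subspaceT.
move=> /ex_strict_bound_gt0[K K0 hK]; exists K; first exact: ltW.
by move=> x xr; apply: ltW; apply: hK; exists x.
Qed.

(** The box is convex, so the mean value point of a segment stays in it, where compactness bounds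
    every partial derivative. *)
Lemma lipschitz_on_box f (rho : R) :
  (forall x, differentiable f x) -> (forall v, continuous ('D_v f)) ->
  exists2 L, 0 <= L & forall x y, `|x| <= rho -> `|y| <= rho ->
    `|f y - f x| <= L * `|y - x|.
Proof.
move=> df cf.
have /choice[K hK] (p : 'I_m * 'I_n) :
    exists K, 0 <= K /\ forall x, `|x| <= rho -> `|'D_(delta_mx p.1 p.2) f x| <= K.
  by have [K K0 hK] := bounded_on_box rho (cf (delta_mx p.1 p.2)); exists K.
exists (\sum_(i < m) \sum_(k < n) K (i, k)).
  by apply: sumr_ge0 => i _; apply: sumr_ge0 => k _; have [] := hK (i, k).
move=> x y xr yr; have [t /andP[t0 t1]] := mvt_line x (y - x) df.
rewrite (_ : x + (y - x) = y); last by rewrite addrC subrK.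
move=> ->; rewrite derive_sum_delta//.
have zr : `|x + t *: (y - x)| <= rho.
  have -> : x + t *: (y - x) = (1 - t) *: x + t *: y.
    by rewrite scalerBl scale1r scalerBr addrAC addrA.
  rewrite (le_trans (ler_normD _ _))// !normrZ !ger0_norm ?subr_ge0//.
  by have := ler_wpM2l t0 yr; have := @ler_wpM2l _ (1 - t) _ _ _ xr; lra.
rewrite (le_trans (ler_norm_sum _ _ _))// mulr_suml; apply: ler_sum => i _.
rewrite (le_trans (ler_norm_sum _ _ _))// mulr_suml; apply: ler_sum => k _.
rewrite normrM mulrC; apply: ler_pM => //; last exact: coord_le_norm.
by have [_ /(_ _ zr)] := hK (i, k).
Qed.

End derivatives.

(** * First-order condition and uniqueness of the equilibrium *)

Section nash.
Context {R : realType} {N d : nat}.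
Variables (A : 'I_N -> set 'rV[R]_d) (J : 'I_N -> 'M[R]_(N, d) -> R).

Lemma joint_action_set_bounded : (forall i, compact (A i)) ->
  exists2 rho, 0 <= rho & forall a, joint_action_set A a -> `|a| <= rho.
Proof.
move=> cA.
have /choice[K hK] i : exists K, 0 <= K /\ forall x, A i x -> `|x| <= K.
  have /ex_strict_bound_gt0[K K0 h] := compact_bounded (cA i).
  by exists K; split; [exact: ltW|move=> x /h /ltW].
have K0 : 0 <= \sum_i K i by apply: sumr_ge0 => i _; have [] := hK i.
exists (\sum_i K i) => // a Aa; apply: norm_le_coord => // i k.
have [_ /(_ _ (Aa i)) h] := hK i.
have := coord_le_norm (row i a) ord0 k; rewrite mxE => /le_trans; apply.
apply: (le_trans h); rewrite (bigD1 i)//= lerDl.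
by apply: sumr_ge0 => l _; have [] := hK l.
Qed.

Hypotheses (vA : forall i, convex_set (A i))
  (dJ : forall i x, differentiable (J i) x).

(** By convexity each player may deviate along the segment towards [a]; optimality makes the right
    derivative of the own cost nonnegative at [b], and the players' derivatives add up to the inner
    product. *)
Lemma nash_first_order b a : nash_equilibrium A J b -> joint_action_set A a ->
  0 <= edot (pseudo_gradient J b) (a - b).
Proof.
move=> [Ab bmin] Aa; apply: sumr_ge0 => i _.
pose u : 'M[R]_(N, d) := \matrix_(l, k) (if l == i then a i k - b i k else 0).
have -> : \sum_(k < d) pseudo_gradient J b i k * (a - b) i k = 'D_u (J i) b.
  rewrite derive_sum_delta// [RHS](bigD1 i)//= [X in _ = _ + X]big1 ?addr0 => [|l li].
    by apply: eq_bigr => k _; rewrite !mxE eqxx mulrC.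
  by apply: big1 => k _; rewrite !mxE (negbTE li) mul0r.
have dJu : h^-1 *: (J i (h *: u + b) - J i b) @[h --> (0 : R)^'+] --> 'D_u (J i) b.
  by apply: cvg_dnbhs_at_right; exact: (diff_derivable (dJ i b)).
apply: (cvgr_to_ge dJu); near=> h.
have h0 : 0 < h by near: h; exact: nbhs_right_gt.
have h1 : h <= 1 by near: h; exact: nbhs_right_le.
rewrite mulr_ge0 ?invr_ge0 ?(ltW h0)// subr_ge0.
have -> : h *: u + b = deviate b i (row i b + h *: (row i a - row i b)).
  apply/matrixP => l k; rewrite !mxE; case: eqP => [->|]; first by rewrite addrC.
  by rewrite mulr0 add0r.
apply: bmin; apply: convex_set_line => //.
by rewrite (ltW h0).
Unshelve. all: by end_near.
Qed.

(** Stability at [b] and the first-order condition at [b] tested against [astar] bound the same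
    inner product from opposite sides, which forces the distance to be 0. *)
Lemma nash_unique nu astar b : 0 < nu -> joint_action_set A astar ->
  strongly_variationally_stable A J nu astar ->
  nash_equilibrium A J b -> b = astar.
Proof.
move=> nu0 Aastar stab nb; have [Ab _] := nb.
have := stab _ Ab; have := nash_first_order nb Aastar.
have -> : astar - b = (-1) *: (b - astar) by rewrite scaleN1r opprB.
rewrite edotZr sqr_enorm; have := edot_ge0 (b - astar).
set E := edot (b - astar) _; set F := edot _ _ => E0 F0 FE.
have {}E0 : E = 0 by nra.
by apply/eqP; rewrite -subr_eq0; apply/eqP/edot_eq0.
Qed.

End nash.

(** * Costs at Gaussian query points *)

Definition zero_coord {R : realType} {m n : nat} (p : 'I_m * 'I_n) (z : 'M[R]_(m, n)) :
    'M[R]_(m, n) :=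
  \matrix_(l, h) (if (l, h) == p then 0 else z l h).

Section growth.
Context {R : realType} {m n : nat}.
Implicit Types (f : 'M[R]_(m, n) -> R) (x z mu : 'M[R]_(m, n)).

Lemma powR_le_sqr (alpha e : R) : alpha < 2 -> 0 < e ->
  exists r, forall u, r <= u -> u `^ alpha <= e * u ^+ 2.
Proof.
move=> a2 e0; have p0 : 0 < 2 - alpha by lra.
(* The second threshold solves [u ^ (2 - alpha) = e^-1]; the maximum with 1 makes [u] positive. *)
pose r := Num.max 1 (e^-1 `^ (2 - alpha)^-1).
exists r => u; rewrite ge_max => /andP[u1 ru].
have u0 : 0 < u by lra.
have : e^-1 <= u `^ (2 - alpha).
  have ei0 : 0 <= e^-1 by rewrite invr_ge0 ltW.
  rewrite -[leLHS]powRr1// -[X in _ `^ X](mulVf (x := 2 - alpha)) ?gt_eqF//.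
  rewrite powRrM; apply: ge0_ler_powR => //; [exact: ltW| |].
    by rewrite nnegrE powR_ge0.
  by rewrite nnegrE ltW.
rewrite -(ler_pM2r (powR_gt0 alpha u0)) -powRD; last by rewrite (gt_eqF u0) implybT.
by rewrite subrK powR_mulrn ?(ltW u0)// mulrC ler_pdivrMr// mulrC.
Qed.

Lemma norm_le_enorm x : `|x| <= enorm x.
Proof.
apply: norm_le_coord => [|i k]; first exact: sqrtr_ge0.
by rewrite -sqrtr_sqr ler_wsqrtr// edot_coord_le.
Qed.

(** Outside a ball [alpha < 2] lets the quadratic exponent win; inside, continuity gives a bound. As
    [e] is arbitrary, several such factors can later be multiplied and still be integrable against a
    Gaussian. *)
Lemma growth_gaussian f (alpha e : R) : continuous f ->
  exp_power_growth alpha f -> alpha < 2 -> 0 < e ->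
  exists2 K, 0 <= K & forall x, `|f x| <= K * expR (e * edot x x).
Proof.
move=> cf [C [r fC]] a2 e0; have [r' hr'] := powR_le_sqr a2 e0.
have [K K0 hK] := bounded_on_box (Num.max r r') cf.
exists (K + `|C|); first by rewrite addr_ge0.
move=> x; have E1 : 1 <= expR (e * edot x x).
  by rewrite -expR0 ler_expR mulr_ge0 ?edot_ge0// ltW.
have [xr|] := ltP (enorm x) (Num.max r r').
  apply: (@le_trans _ _ K).
    by apply: hK; rewrite (le_trans (norm_le_enorm _))// ltW.
  have := normr_ge0 C; nra.
rewrite ge_max => /andP[rx r'x]; apply: (le_trans (fC _ rx)).
have CC := ler_norm C; have K1 : `|C| <= K + `|C| by lra.
apply: (le_trans (ler_wpM2r (expR_ge0 _) (le_trans CC K1))).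
rewrite ler_wpM2l// ?ler_expR ?addr_ge0//.
by rewrite -sqr_enorm; exact: hr'.
Qed.

(** Absorbs a power of the noise into the exponential weight: by [1 + x <= expR x], the factor
    [1 + e^-1] yields at least [1 + t ^+ 2]. *)
Lemma le_exp_sqr (e t : R) : 0 < e -> t <= (1 + e^-1) * expR (e * t ^+ 2).
Proof.
move=> e0; have ei : 0 < e^-1 by rewrite invr_gt0.
apply: (@le_trans _ _ ((1 + e^-1) * (1 + e * t ^+ 2))).
  have -> : (1 + e^-1) * (1 + e * t ^+ 2) = 1 + e * t ^+ 2 + e^-1 + t ^+ 2.
    by field; rewrite gt_eqF.
  have := sqr_ge0 (t - 1); have : 0 <= e * t ^+ 2 by rewrite mulr_ge0 ?sqr_ge0 ?ltW.
  by have := sqr_ge0 t; nra.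
rewrite ler_wpM2l ?expR_ge1Dx//; lra.
Qed.

Lemma sqr_le_exp_sqr (e t : R) : 0 < e -> t ^+ 2 <= (1 + e^-1) * expR (e * t ^+ 2).
Proof.
move=> e0; have ei : 0 < e^-1 by rewrite invr_gt0.
apply: (@le_trans _ _ ((1 + e^-1) * (1 + e * t ^+ 2))).
  have -> : (1 + e^-1) * (1 + e * t ^+ 2) = 1 + e * t ^+ 2 + e^-1 + t ^+ 2.
    by field; rewrite gt_eqF.
  have : 0 <= e * t ^+ 2 by rewrite mulr_ge0 ?sqr_ge0 ?ltW.
  by have := sqr_ge0 t; lra.
rewrite ler_wpM2l ?expR_ge1Dx//; lra.
Qed.

Section perturbation.
Variables (f : 'M[R]_(m, n) -> R) (alpha rho a : R).
Hypotheses (df : forall x, differentiable f x)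
  (cf : forall v, continuous ('D_v f))
  (gf : exp_power_growth alpha f) (a2 : alpha < 2) (a0 : 0 < a).

Let contf : continuous f.
Proof. by move=> x; exact: differentiable_continuous. Qed.

Lemma perturbed_value_le e : 0 < e ->
  exists2 K, 0 <= K & forall mu s z, `|mu| <= rho -> 0 < s <= a ->
    `|f (mu + s *: z)| <= K * expR (e * `|z| ^+ 2).
Proof.
move=> e0; pose n' : R := (m * n)%:R + 1.
have n'0 : 0 < n' by rewrite ltr_wpDl.
(* Since [edot x x <= n' * (2 * rho ^+ 2 + 2 * a ^+ 2 * |z| ^+ 2)], this exponent leaves exactly
   [e * |z| ^+ 2], and the [rho] term goes into the constant. *)
pose e' := e / (2 * a ^+ 2 * n').
have e'0 : 0 < e' by rewrite divr_gt0// !mulr_gt0// exprn_gt0.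
have [K K0 hK] := growth_gaussian contf gf a2 e'0.
exists (K * expR (e' * (n' * (2 * rho ^+ 2)))); first by rewrite mulr_ge0// expR_ge0.
move=> mu s z mur /andP[s0 sa]; apply: (le_trans (hK _)).
rewrite -mulrA ler_wpM2l// -expRD ler_expR.
set x := mu + s *: z.
have h1 : edot x x <= n' * `|x| ^+ 2.
  by rewrite (le_trans (edot_le_norm _))// ler_wpM2r ?sqr_ge0// /n' lerDl.
have h2 : `|x| <= rho + a * `|z|.
  rewrite (le_trans (ler_normD _ _))// normrZ gtr0_norm// lerD//.
  by rewrite ler_wpM2r.
have h3 : `|x| ^+ 2 <= 2 * rho ^+ 2 + 2 * a ^+ 2 * `|z| ^+ 2.
  apply: (@le_trans _ _ ((rho + a * `|z|) ^+ 2)).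
    by rewrite lerXn2r// nnegrE// (le_trans (normr_ge0 x)).
  by have := sqr_ge0 (rho - a * `|z|); nra.
have -> : e * `|z| ^+ 2 = e' * (n' * (2 * a ^+ 2 * `|z| ^+ 2)).
  by rewrite /e'; field; rewrite !gt_eqF.
rewrite -mulrDr -mulrDr ler_wpM2l ?(ltW e'0)//.
by rewrite (le_trans h1)// ler_wpM2l// ltW.
Qed.

(** Two regimes. If [s * |z| <= 1], both points lie in a fixed box where [f] is Lipschitz. Otherwise
    the growth bound is multiplied by [s * |z| >= 1], which supplies the factor [s]. Half of [e]
    pays for the growth, half for the factor [|z|]. *)
Lemma perturbed_diff_le e : 0 < e ->
  exists2 K, 0 <= K & forall mu s z, `|mu| <= rho -> 0 < s <= a ->
    `|f (mu + s *: z) - f mu| <= K * s * expR (e * `|z| ^+ 2).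
Proof.
move=> e0; have e20 : 0 < e / 2 by rewrite divr_gt0.
have [K K0 hK] := perturbed_value_le e20.
have [L L0 hL] := lipschitz_on_box (rho + 1) df cf.
pose c := 1 + (e / 2)^-1.
have c0 : 0 < c by rewrite addr_gt0 ?invr_gt0.
exists ((L + 2 * K) * c); first by rewrite mulr_ge0 ?(ltW c0)// addr_ge0// mulr_ge0.
move=> mu s z mur sa; have /andP[s0 _] := sa.
set E := expR (e / 2 * `|z| ^+ 2).
have E1 : 1 <= E.
  by rewrite -expR0 ler_expR mulr_ge0 ?sqr_ge0 ?(ltW e20).
have EE : expR (e * `|z| ^+ 2) = E * E.
  by rewrite -expRD; congr expR; field.
have zE : `|z| <= c * E by exact: le_exp_sqr.
have z0 := normr_ge0 z; rewrite EE.
have [sz|sz] := leP (s * `|z|) 1.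
  have /hL : `|mu| <= rho + 1 by rewrite (le_trans mur)// lerDl.
  move=> /(_ (mu + s *: z)) h; apply: (le_trans (h _)).
    rewrite (le_trans (ler_normD _ _))// lerD// normrZ gtr0_norm//.
  rewrite addrC addKr normrZ gtr0_norm//.
  apply: (@le_trans _ _ (L * (s * (c * E)))).
    by rewrite ler_wpM2l// ler_wpM2l// ltW.
  have : 0 <= L * (s * c) * E by rewrite !mulr_ge0// ?(ltW s0) ?(ltW c0)//; lra.
  have : 0 <= K * (s * c) * (E * E).
    by rewrite !mulr_ge0// ?(ltW s0) ?(ltW c0)//; lra.
  nra.
have h1 := hK mu s z mur sa; rewrite -/E in h1.
have h2 : `|f mu| <= K.
  have := hK mu s 0 mur sa.
  by rewrite scaler0 addr0 normr0 expr0n mulr0 expR0 mulr1.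
apply: (@le_trans _ _ (2 * K * E)).
  rewrite (le_trans (ler_normB _ _))//; nra.
apply: (@le_trans _ _ (2 * K * E * (s * `|z|))).
  rewrite ler_peMr ?mulr_ge0// ?(ltW sz)//; lra.
apply: (@le_trans _ _ (2 * K * E * (s * (c * E)))).
  by rewrite ler_wpM2l ?mulr_ge0//; [lra|rewrite ler_wpM2l// ltW].
have : 0 <= L * (s * c) * (E * E).
  by rewrite !mulr_ge0// ?(ltW s0) ?(ltW c0)//; lra.
nra.
Qed.

Lemma zero_coordK (p : 'I_m * 'I_n) z :
  zero_coord p z + z p.1 p.2 *: delta_mx p.1 p.2 = z.
Proof.
case: p => i k; apply/matrixP => l h; rewrite !mxE/= xpair_eqE.
case: (eqVneq l i) => [->|li]; case: (eqVneq h k) => [->|hk] /=.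
- by rewrite mulr1 add0r.
- by rewrite mulr0 addr0.
- by rewrite mulr0 addr0.
- by rewrite mulr0 addr0.
Qed.

Lemma norm_zero_coordD (p : 'I_m * 'I_n) z (t : R) : 0 <= t <= 1 ->
  `|zero_coord p z + (t * z p.1 p.2) *: delta_mx p.1 p.2| <= `|z|.
Proof.
move=> /andP[t0 t1]; case: p => i k; apply: norm_le_coord => // l h.
rewrite !mxE/= xpair_eqE.
case: (eqVneq l i) => [->|li]; case: (eqVneq h k) => [->|hk] /=;
  rewrite ?mulr1 ?mulr0 ?add0r ?addr0 ?coord_le_norm//.
rewrite normrM ger0_norm//; apply: le_trans (coord_le_norm z i k).
by rewrite ler_piMl.
Qed.

Lemma norm_zero_coord (p : 'I_m * 'I_n) z : `|zero_coord p z| <= `|z|.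
Proof.
have := @norm_zero_coordD p z 0; rewrite mul0r scale0r addr0; apply.
by rewrite lexx ler01.
Qed.

Variable p : 'I_m * 'I_n.
Let g := 'D_(delta_mx p.1 p.2) f.
Hypotheses (dg : forall x, differentiable g x) (cg : forall v, continuous ('D_v g)).

(** If [s * |z| <= 1], the mean value theorem in direction [p] yields [g] at a point within
    [s * |z|] of [mu], and [g] is Lipschitz there. Evaluating [g] at [mu] itself makes the
    first-order coefficient a function of the state alone. If [s * |z| > 1], the three terms are
    bounded separately. *)
Lemma perturbed_coord_le e : 0 < e ->
  exists2 K, 0 <= K & forall mu s z, `|mu| <= rho -> 0 < s <= a ->
    `|f (mu + s *: z) - f (mu + s *: zero_coord p z) - s * z p.1 p.2 * g mu|
      <= K * s ^+ 2 * expR (e * `|z| ^+ 2).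
Proof.
move=> e0; have e20 : 0 < e / 2 by rewrite divr_gt0.
have [K K0 hK] := perturbed_value_le e20.
have [L L0 hL] := lipschitz_on_box (rho + 1) dg cg.
have [Kg Kg0 hKg] := bounded_on_box rho (@cf (delta_mx p.1 p.2)).
pose c := 1 + (e / 2)^-1.
have c0 : 0 < c by rewrite addr_gt0 ?invr_gt0.
exists ((L + 2 * K + Kg) * c).
  by rewrite mulr_ge0 ?(ltW c0)// !addr_ge0// mulr_ge0.
move=> mu s z mur sa; have /andP[s0 _] := sa.
set E := expR (e / 2 * `|z| ^+ 2).
have E1 : 1 <= E.
  by rewrite -expR0 ler_expR mulr_ge0 ?sqr_ge0 ?(ltW e20).
have EE : expR (e * `|z| ^+ 2) = E * E.
  by rewrite -expRD; congr expR; field.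
have zE : `|z| ^+ 2 <= c * E by exact: sqr_le_exp_sqr.
have z0 := normr_ge0 z; rewrite EE; set z' := zero_coord p z.
have zz' : `|z'| <= `|z| by exact: norm_zero_coord.
(* The size of a second-order remainder; in the second regime it exceeds 1, so crude bounds may be
   multiplied by it. *)
pose B := (s * `|z|) ^+ 2.
have B0 : 0 <= B by exact: sqr_ge0.
have BE : B <= s ^+ 2 * (c * E) by rewrite /B exprMn ler_wpM2l ?sqr_ge0.
suff main : `|f (mu + s *: z) - f (mu + s *: z') - s * z p.1 p.2 * g mu|
    <= (L + 2 * K + Kg) * E * B.
  apply: (le_trans main).
  have D0 : 0 <= (L + 2 * K + Kg) * E.
    by rewrite mulr_ge0 ?expR_ge0// !addr_ge0// mulr_ge0.
  by apply: (le_trans (ler_wpM2l D0 BE)); rewrite le_eqVlt; apply/orP; left; apply/eqP; ring.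
have [sz|sz] := leP (s * `|z|) 1.
  have -> : mu + s *: z = (mu + s *: z') + (s * z p.1 p.2) *: delta_mx p.1 p.2.
    by rewrite -addrA -scalerA -scalerDr zero_coordK.
  have [t t01 ->] := mvt_line (mu + s *: z') ((s * z p.1 p.2) *: delta_mx p.1 p.2) df.
  rewrite deriveE// linearZ/= -deriveE// -/g -mulrBr.
  set q := mu + _ + _.
  have qmu : q - mu = s *: (z' + (t * z p.1 p.2) *: delta_mx p.1 p.2).
    rewrite /q scalerDr !scalerA addrAC (addrC mu) addrK; congr (_ + _ *: _).
    by ring.
  have nq : `|q - mu| <= s * `|z|.
    by rewrite qmu normrZ gtr0_norm// ler_wpM2l ?(ltW s0)// norm_zero_coordD.
  have mu1 : `|mu| <= rho + 1 by rewrite (le_trans mur)// lerDl.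
  have q1 : `|q| <= rho + 1.
    rewrite -(subrK mu q) (le_trans (ler_normD _ _))// addrC lerD//.
    exact: le_trans nq sz.
  have gq := hL _ _ mu1 q1.
  have gq' : `|g q - g mu| <= L * (s * `|z|).
    by rewrite (le_trans gq)// ler_wpM2l.
  rewrite normrM (normrM s) (gtr0_norm s0).
  have zp : s * `|z p.1 p.2| <= s * `|z| by rewrite ler_wpM2l ?(ltW s0)// coord_le_norm.
  apply: (@le_trans _ _ (s * `|z| * (L * (s * `|z|)))).
    by apply: ler_pM => //; rewrite mulr_ge0 ?(ltW s0).
  have -> : s * `|z| * (L * (s * `|z|)) = L * B by rewrite /B; ring.
  rewrite ler_wpM2r//.
  have : 0 <= (2 * K + Kg) * E by rewrite mulr_ge0 ?expR_ge0// addr_ge0// mulr_ge0.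
  have : L <= L * E by rewrite ler_peMr.
  lra.
have B1 : s * `|z| <= B by rewrite /B expr2 ler_peMl// ?mulr_ge0 ?(ltW s0) ?(ltW sz).
have h1 := hK mu s z mur sa; rewrite -/E in h1.
have h2 : `|f (mu + s *: z')| <= K * E.
  apply: (le_trans (hK mu s z' mur sa)); rewrite ler_wpM2l// ler_expR.
  by rewrite ler_wpM2l ?(ltW e20)// lerXn2r ?nnegrE.
have h3 : `|s * z p.1 p.2 * g mu| <= B * Kg.
  rewrite normrM; apply: ler_pM => //; last exact: hKg.
  apply: le_trans B1; rewrite normrM gtr0_norm// ler_wpM2l ?(ltW s0)//.
  exact: coord_le_norm.
rewrite (le_trans (ler_normB _ _))//.
have h4 := ler_normB (f (mu + s *: z)) (f (mu + s *: z')).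
have B1' : 1 <= B by rewrite (le_trans (ltW sz)).
have KE : 0 <= K * E by rewrite mulr_ge0 ?expR_ge0.
have h5 : K * E <= K * E * B by rewrite ler_peMr.
have E0 : 0 <= E by exact: le_trans ler01 E1.
have h6 : 0 <= L * E * B by apply: mulr_ge0 => //; apply: mulr_ge0.
have h7 : B * Kg <= Kg * E * B by rewrite mulrC ler_wpM2r// ler_peMr.
have -> : (L + 2 * K + Kg) * E * B = L * E * B + 2 * (K * E * B) + Kg * E * B by ring.
lra.
Qed.

End perturbation.

End growth.

(** * Standardized Gaussian queries *)

Section gaussian_moments.
Context {R : realType}.
Local Notation leb := (@lebesgue_measure R).
Local Notation N01 := (normal_prob (0 : R) 1).

(** The Radon-Nikodym derivative of the normal law agrees almost everywhere with its density, as
    both have the same integral over every measurable set. *)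
Lemma ge0_integral_normal_prob (m s : R) (f : R -> \bar R) :
  (forall x, 0 <= f x)%E -> measurable_fun setT f ->
  (\int[normal_prob m s]_x f x = \int[leb]_x (f x * (normal_pdf m s x)%:E))%E.
Proof.
move=> f0 mf.
rewrite -(Radon_Nikodym_SigmaFinite.change_of_variables
  (normal_prob_dominates m s) f0 measurableT mf).
have mpdf : measurable_fun [set: R] (EFin \o normal_pdf m s).
  by apply/measurable_EFinP; exact: measurable_normal_pdf.
have intf := Radon_Nikodym_SigmaFinite.f_integrable (normal_prob_dominates m s).
apply: ae_eq_integral => //.
- by apply: emeasurable_funM => //; exact: measurable_int intf.
- exact: emeasurable_funM.
- apply: ae_eqe_mul2l; apply: integral_ae_eq => //=.
  move=> E _ mE; rewrite -Radon_Nikodym_SigmaFinite.f_integral//.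
  exact: normal_prob_dominates.
Qed.

(** Completing the square turns the integrand into [expR (l ^+ 2 / 2)] times the density of mean [l]
    and variance 1. *)
Lemma normal_mgf (l : R) :
  (\int[N01]_x (expR (l * x))%:E = (expR (l ^+ 2 / 2))%:E)%E.
Proof.
rewrite ge0_integral_normal_prob; last 2 first.
- by move=> x; rewrite lee_fin expR_ge0.
- by apply/measurable_EFinP; apply: measurableT_comp.
transitivity (\int[leb]_x ((expR (l ^+ 2 / 2))%:E * (normal_pdf l 1 x)%:E))%E.
  apply: eq_integral => x _; rewrite -!EFinM; congr EFin.
  rewrite !normal_pdfE ?oner_neq0// /normal_fun mulrCA [RHS]mulrCA.
  congr (_ * _); rewrite -!expRD; congr expR; rewrite subr0; by field.
rewrite ge0_integralZl//.
- by rewrite integral_normal_pdf mule1.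
- by apply/measurable_EFinP; exact: measurable_normal_pdf.
- by move=> x _; rewrite lee_fin normal_pdf_ge0.
Qed.

(** The integrand times the standard density is [s] times the density of standard deviation [s]. The
    value [s = Num.sqrt 2] gives the exponent 1/4. *)
Lemma normal_square_mgf (s : R) : 0 < s ->
  (\int[N01]_x (expR ((1 - s ^- 2) / 2 * x ^+ 2))%:E = s%:E)%E.
Proof.
move=> s0; rewrite ge0_integral_normal_prob; last 2 first.
- by move=> x; rewrite lee_fin expR_ge0.
- apply/measurable_EFinP; apply: measurableT_comp => //.
  by apply: measurable_funM => //; exact: measurable_funX.
transitivity (\int[leb]_x (s%:E * (normal_pdf 0 s x)%:E))%E.
  apply: eq_integral => x _; rewrite -!EFinM; congr EFin.
  rewrite !normal_pdfE ?oner_neq0 ?gt_eqF// /normal_fun !subr0.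
  have -> : @normal_peak R 1 = s * @normal_peak R s.
    rewrite /normal_peak expr1n mul1r -mulrnAr sqrtrM ?sqr_ge0// sqrtr_sqr.
    by rewrite gtr0_norm// invfM mulrA divff ?gt_eqF// mul1r.
  rewrite [LHS]mulrCA -[LHS]mulrA.
  congr (_ * _); congr (_ * _); rewrite -expRD.
  by congr expR; field; rewrite gt_eqF.
rewrite ge0_integralZl//.
- by rewrite integral_normal_pdf mule1.
- by apply/measurable_EFinP; exact: measurable_normal_pdf.
- by move=> x _; rewrite lee_fin normal_pdf_ge0.
- by rewrite lee_fin ltW.
Qed.

Lemma normal_exp_square_quarter :
  (\int[N01]_x (expR (x ^+ 2 / 4))%:E = (Num.sqrt 2)%:E)%E.
Proof.
rewrite -[RHS]normal_square_mgf ?sqrtr_gt0//; apply: eq_integral => x _.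
by congr (expR _)%:E; rewrite -exprVn exprVn sqr_sqrtr//; field.
Qed.

Lemma integrable_normal_expM (l : R) :
  (normal_prob (0 : R) 1).-integrable setT (fun x : R => (expR (l * x))%:E).
Proof.
apply/integrableP; split.
  apply/measurable_EFinP; by apply: measurableT_comp.
under eq_integral do rewrite gee0_abs ?lee_fin ?expR_ge0//.
by rewrite normal_mgf ltry.
Qed.

Lemma integrable_normal_id :
  (normal_prob (0 : R) 1).-integrable setT (fun x : R => x%:E).
Proof.
apply: (@le_integrable _ _ _ (normal_prob (0 : R) 1) _ measurableT _
    ((fun x : R => (expR (1 * x))%:E) \+ (fun x : R => (expR (- 1 * x))%:E))%E).
- exact/measurable_EFinP.
- move=> x _; rewrite /= lee_fin [leRHS]ger0_norm ?addr_ge0 ?expR_ge0//.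
  rewrite mul1r mulN1r.
  have := expR_ge1Dx x; have := expR_ge1Dx (- x).
  have := expR_ge0 x; have := expR_ge0 (- x) => *.
  by rewrite ler_norml; apply/andP; split; lra.
- apply: integrableD => //; exact: integrable_normal_expM.
Qed.

Lemma integrable_normal_sqr :
  (normal_prob (0 : R) 1).-integrable setT (fun x : R => (x ^+ 2)%:E).
Proof.
apply: (@le_integrable _ _ _ (normal_prob (0 : R) 1) _ measurableT _
    (fun x : R => 4%:E * (expR (x ^+ 2 / 4))%:E)%E).
- by apply/measurable_EFinP; exact: measurable_funX.
- move=> x _; rewrite -EFinM /= lee_fin ger0_norm ?sqr_ge0//.
  rewrite [leRHS]ger0_norm; last by rewrite mulr_ge0// expR_ge0.
  by have := expR_ge1Dx (x ^+ 2 / 4); lra.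
- apply: (@integrableZl _ _ _ (normal_prob (0 : R) 1) _ measurableT 4
    (fun x : R => (expR (x ^+ 2 / 4))%:E)).
  apply/integrableP; split.
    apply/measurable_EFinP; apply: measurableT_comp => //.
    by apply: measurable_funM => //; exact: measurable_funX.
  under eq_integral do rewrite gee0_abs ?lee_fin ?expR_ge0//.
  by rewrite normal_exp_square_quarter ltry.
Qed.

(** Extracts a moment of [g] from an exponential family with known integrals: with [f] close to
    [1 + l * g], small [l] of both signs bound the mean of [g] from both sides. *)
Lemma normal_affine_le (g f : R -> R) (l m e : R) :
  measurable_fun setT f ->
  (normal_prob (0 : R) 1).-integrable setT (EFin \o g) ->
  (\int[N01]_x (f x)%:E = m%:E)%E ->
  (forall x, 0 <= f x) -> (forall x, 1 + l * g x <= f x) ->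
  (\int[N01]_x (g x)%:E = e%:E)%E -> 1 + l * e <= m.
Proof.
move=> mf ig fm f0 gf ge.
have if_ : (normal_prob (0 : R) 1).-integrable setT (EFin \o f).
  apply/integrableP; split; first exact/measurable_EFinP.
  by under eq_integral do rewrite gee0_abs ?lee_fin//; rewrite fm ltry.
rewrite -lee_fin -fm EFinD EFinM -ge.
have <- : (\int[N01]_x (1 + l * g x)%:E = 1%:E + l%:E * \int[N01]_x (g x)%:E)%E.
  under eq_integral do rewrite EFinD EFinM.
  rewrite integralD//=; last 2 first.
  - by apply: finite_measure_integrable_cst.
  - exact: integrableZl.
  rewrite integral_cst// integralZl//; congr (_ + _)%E.
  by rewrite mul1e; exact: (@probability_setT _ _ _ (normal_prob 0 1)).
apply: le_integral => //.
- rewrite (_ : (fun _ => _) = (cst 1%:E \+ (fun x => l%:E * (g x)%:E))%E); last first.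
    by apply/funext => x /=; rewrite EFinD EFinM.
  apply: (@integrableD _ _ _ (normal_prob (0 : R) 1) _ measurableT
    (cst 1%:E) (fun x => l%:E * (g x)%:E)%E); last exact: integrableZl.
  exact: finite_measure_integrable_cst.
- by move=> x _; rewrite lee_fin.
Qed.

Lemma normal_mean : (\int[N01]_x x%:E = 0)%E.
Proof.
have /integrable_fin_num := integrable_normal_id => /(_ measurableT).
move=> /fineK; set e := fine _ => Ee.
have main l : 1 + l * e <= expR (l ^+ 2 / 2).
  apply: (@normal_affine_le id (fun x => expR (l * x))) => //.
  - exact: measurableT_comp.
  - exact: integrable_normal_id.
  - exact: normal_mgf.
  - by move=> x; exact: expR_ge1Dx.
(* For [y <= 1], [expR (y / 2) <= 1 / (1 - y / 2) <= 1 + y]; dividing by [l] of either sign and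
   letting [l] tend to 0 then forces [e = 0]. *)
have up l : l ^+ 2 <= 1 -> l * e <= l ^+ 2.
  move=> l1; have := main l.
  have h1 := expR_ge1Dx (- (l ^+ 2 / 2)).
  have h2 : expR (l ^+ 2 / 2) * expR (- (l ^+ 2 / 2)) = 1.
    by rewrite -expRD subrr expR0.
  have h3 := expR_gt0 (l ^+ 2 / 2).
  have := sqr_ge0 l.
  set y := l ^+ 2 in l1 h1 h2 h3 *; set E := expR (y / 2) in h2 h3 *.
  move=> y0 lE.
  have : E * (1 - y / 2) <= 1.
    by rewrite -[leRHS]h2 ler_pM2l.
  nra.
suff e_eq : e = 0 by rewrite -Ee e_eq.
apply/eqP; rewrite eq_le; apply/andP; split; apply/ler_addgt0Pr => d d0.
  rewrite add0r; set l := Num.min d 1.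
  have l0 : 0 < l by rewrite lt_min d0/=.
  have ld : l <= d by rewrite ge_min lexx.
  have l1 : l <= 1 by rewrite ge_min lexx orbT.
  have /up : l ^+ 2 <= 1 by rewrite expr_le1// ltW.
  by rewrite expr2 ler_pM2l// => /le_trans; apply.
set l := Num.min d 1.
have l0 : 0 < l by rewrite lt_min d0/=.
have ld : l <= d by rewrite ge_min lexx.
have l1 : l <= 1 by rewrite ge_min lexx orbT.
have /up : (- l) ^+ 2 <= 1 by rewrite sqrrN expr_le1// ltW.
rewrite sqrrN mulNr -mulrN expr2 ler_pM2l// => h; lra.
Qed.

(** Same method with the family of [normal_square_mgf] near [s = 1]: dividing by [s - 1] on either
    side of 1 squeezes the moment. *)
Lemma normal_second_moment : (\int[N01]_x (x ^+ 2)%:E = 1)%E.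
Proof.
have /integrable_fin_num := integrable_normal_sqr => /(_ measurableT).
move=> /fineK; set e := fine _ => Ee.
have main s : 0 < s -> 1 + (1 - s ^- 2) / 2 * e <= s.
  move=> s0.
  apply: (@normal_affine_le (fun x => x ^+ 2)
    (fun x => expR ((1 - s ^- 2) / 2 * x ^+ 2))) => //.
  - by apply: measurableT_comp => //; apply: measurable_funM.
  - exact: integrable_normal_sqr.
  - exact: normal_square_mgf.
  - by move=> x; exact: expR_ge1Dx.
(* Multiplying by [2 * s ^+ 2] exposes the common factor [s - 1], whose sign decides which bound
   results. *)
have {}main s : 0 < s -> (s - 1) * ((s + 1) * e) <= (s - 1) * (2 * s ^+ 2).
  move=> s0; have := main s s0.
  rewrite -(@ler_pM2r _ (2 * s ^+ 2)) ?mulr_gt0 ?exprn_gt0// => h.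
  have : (1 + (1 - s ^- 2) / 2 * e) * (2 * s ^+ 2) =
         2 * s ^+ 2 + (s ^+ 2 - 1) * e by field; rewrite gt_eqF.
  move=> h'; rewrite h' in h; nra.
suff e_eq : e = 1 by rewrite -Ee e_eq.
have e0 : 0 <= e.
  by apply: fine_ge0; apply: integral_ge0 => x _; rewrite lee_fin sqr_ge0.
apply/eqP; rewrite eq_le; apply/andP; split; apply/ler_addgt0Pr => d d0.
  set l := Num.min d 1.
  have l0 : 0 < l by rewrite lt_min d0/=.
  have ld : l <= d by rewrite ge_min lexx.
  have l1 : l <= 1 by rewrite ge_min lexx orbT.
  have : 0 < 1 + l / 3 by lra.
  by move=> /main; rewrite addrAC subrr add0r ler_pM2l ?divr_gt0//; nra.
set l := Num.min d 1.
have l0 : 0 < l by rewrite lt_min d0/=.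
have ld : l <= d by rewrite ge_min lexx.
have l1 : l <= 1 by rewrite ge_min lexx orbT.
have : 0 < 1 - l / 3 by lra.
move=> /main; rewrite addrAC subrr add0r !mulNr lerN2 ler_pM2l ?divr_gt0//; nra.
Qed.

End gaussian_moments.

(** * Independence extended from generators, and Fubini *)

Section independence.
Context d (T : measurableType d) (R : realType) (P : probability T R).
Variables (G : set_system T) (Y : T -> R) (nu : probability (measurableTypeR R) R).
Hypotheses (mG : G `<=` measurable) (setIG : setI_closed G) (GT : G setT).
Hypothesis mY : measurable_fun [set: T] Y.
Hypothesis indepG : forall A b, G A ->
  P (A `&` Y @^-1` `]-oo, b[%classic) = (P A * nu `]-oo, b[%classic)%E.

Lemma sigma_measurable (A : set T) : <<s G >> A -> measurable A.
Proof. by apply: smallest_sub => //; exact: sigma_algebra_measurable. Qed.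

Let measurable_preimage (B : set R) : measurable B -> measurable (Y @^-1` B).
Proof. by move=> mB; rewrite -[X in measurable X]setTI; exact: mY. Qed.

(** Independence is extended by uniqueness of measures in two rounds: here in [A] for a fixed ray,
    from the pi-system [G]; next in the Borel set for a fixed [A], from the rays. *)
Lemma indep_sigma_ray (A : set T) b : <<s G >> A ->
  P (A `&` Y @^-1` `]-oo, b[%classic) = (P A * nu `]-oo, b[%classic)%E.
Proof.
have mD := measurable_preimage (measurable_itv `]-oo, b[).
have nub : (0 <= fine (nu `]-oo, b[%classic))%R by exact: fine_ge0.
pose m1 : {measure set T -> \bar R} := mrestr P mD.
pose m2 : {measure set T -> \bar R} := mscale (NngNum nub) P.
suff m12 : forall A, <<s G >> A -> m1 A = m2 A.
  move=> GA; have := m12 A GA; rewrite /m1 /m2/= /mrestr /mscale/= => ->.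
  by rewrite fineK ?fin_num_measure// muleC.
apply: (@g_sigma_algebra_measure_unique _ _ _ G mG (fun=> setT)) => //.
- by rewrite bigcup_const//; exists 0%N.
- move=> B GB; rewrite /m1 /m2/= /mrestr /mscale/=.
  by rewrite fineK ?fin_num_measure// muleC indepG.
- move=> _; rewrite /m1/= /mrestr setTI; apply: le_lt_trans (ltry 1).
  exact: probability_le1.
Qed.

Lemma indep_sigma (A : set T) (B : set R) : <<s G >> A -> measurable B ->
  P (A `&` Y @^-1` B) = (P A * nu B)%E.
Proof.
move=> GA mB; have mA := sigma_measurable GA.
have PA : (0 <= fine (P A))%R by exact: fine_ge0.
have mYm : measurable_fun [set: T] (Y : T -> measurableTypeR R) by exact: mY.
pose m1 : {measure set (measurableTypeR R) -> \bar R} :=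
  @pushforward _ _ T (measurableTypeR R) R (mrestr P mA) Y.
pose m2 : {measure set (measurableTypeR R) -> \bar R} :=
  mscale (NngNum PA) (nu : {measure set (measurableTypeR R) -> \bar R}).
suff : m1 mY B = m2 B.
  rewrite /m1 /m2/= /pushforward /mrestr /mscale/= setIC => ->.
  by rewrite fineK ?fin_num_measure.
apply: (@measure_unique _ R (measurableTypeR R) (@RGenInftyO.G R)
  (fun n => `]-oo, n%:R[%classic) _ _ _ _ (m1 mY) m2).
- exact: RGenInftyO.measurableE.
- move=> _ _ [x ->] [y ->]; exists (Num.min x y).
  by apply/seteqP; split => z /=; rewrite !in_itv/= lt_min => /andP.
- by move=> n; exists n%:R.
- rewrite -subTset => x _; exists (Num.truncn x).+1 => //=.
  by rewrite in_itv/= Num.Theory.truncnS_gt.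
- move=> _ [x ->]; rewrite /m1 /m2/= /pushforward /mrestr /mscale/= setIC.
  by rewrite fineK ?fin_num_measure// indep_sigma_ray.
- move=> n; rewrite /m1/= /pushforward /mrestr; apply: le_lt_trans (ltry 1).
  by apply: probability_le1; apply: measurableI => //; exact: measurable_preimage.
- exact: mB.
Qed.

Let TG := g_sigma_algebraType G.

Let measurable_to_G : measurable_fun [set: T] (id : T -> TG).
Proof.
by move=> _ B GB; rewrite setTI preimage_id; exact: sigma_measurable.
Qed.

(** The pair of [w], seen in the coarser sigma-algebra, and [Y w] has a product law; Fubini then
    integrates [h] first, which gives 0 for every value of [X]. *)
Lemma expectation_indep0 (X : TG -> R) (h : R -> R) :
  measurable_fun setT X -> measurable_fun setT h ->
  P.-integrable setT (fun w => (X w * h (Y w))%:E) ->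
  nu.-integrable setT (EFin \o h) ->
  (\int[nu]_y (h y)%:E = 0)%E -> (\int[P]_w (X w * h (Y w))%:E = 0)%E.
Proof.
move=> mX mh iXh ih h0.
pose phi (w : T) : TG * measurableTypeR R := (w, Y w).
have mphi : measurable_fun [set: T] phi by exact: measurable_fun_pair.
pose toG : {mfun T >-> TG} :=
  HB.pack (id : T -> TG) (isMeasurableFun.Build _ _ T TG id measurable_to_G).
pose PG : probability TG R := distribution P toG.
pose m' : {measure set (TG * measurableTypeR R) -> \bar R} :=
  pushforward P phi.
have prodE : forall A, measurable A -> (PG \x nu)%E A = m' mphi A.
  apply: product_measure_unique => A B mA mB.
  by rewrite /m' /PG /distribution /pushforward/= -indep_sigma.
pose f (z : TG * measurableTypeR R) := (X z.1 * h z.2)%:E.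
have mf : measurable_fun setT f.
  apply/measurable_EFinP; apply: measurable_funM.
    by apply: measurableT_comp => //; exact: measurable_fst.
  by apply: measurableT_comp => //; exact: measurable_snd.
have if_ : (m' mphi).-integrable setT f by apply: integrable_pushforward.
transitivity (\int[m' mphi]_z f z)%E.
  by rewrite integral_pushforward.
have if' : (PG \x nu)%E.-integrable setT f.
  apply/integrableP; split => //; move/integrableP : if_ => [_].
  congr (_ < +oo)%E; apply: eq_measure_integral => A mA _.
  by apply/esym; exact: prodE.
transitivity (\int[(PG \x nu)%E]_z f z)%E.
  by apply: eq_measure_integral => A mA _; apply/esym; exact: prodE.
rewrite -integral12_prod_meas1//; apply: integral0_eq => u _.
transitivity ((X u)%:E * \int[nu]_y (h y)%:E)%E; last by rewrite h0 mule0.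
by rewrite -integralZl.
Qed.

Lemma ge0_integral_indep (f : R -> \bar R) :
  (forall y, 0 <= f y)%E -> measurable_fun setT f ->
  (\int[P]_w f (Y w) = \int[nu]_y f y)%E.
Proof.
move=> f0 mf.
have mY' : measurable_fun [set: T] (Y : T -> measurableTypeR R) by exact: mY.
transitivity (\int[pushforward P (Y : T -> measurableTypeR R)]_y f y)%E.
  by rewrite ge0_integral_pushforward.
apply: eq_measure_integral => B mB _.
suff : P (setT `&` Y @^-1` B) = (P setT * nu B)%E.
  by rewrite setTI probability_setT mul1e.
by apply: indep_sigma => //; exact: sub_sigma_algebra.
Qed.

End independence.

Section gaussian_rays.
Context {R : realType}.
Local Notation N01 := (normal_prob (0 : R) 1).

Lemma normal_prob_ray (m s b : R) : 0 < s ->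
  normal_prob m s `]-oo, m + s * b[%classic = N01 `]-oo, b[%classic.
Proof.
move=> s0; pose F (x : R^o) : R^o := m + s * x.
have F'E : F^`()%classic = cst s.
  apply/funext => x; rewrite /F derive1E deriveD// derive_cst add0r.
  by rewrite deriveM// derive_id derive_cst scaler0 addr0 [LHS]mulr1.
have mpdf n t A : measurable_fun A (EFin \o normal_pdf n t : R -> \bar R).
  by apply/measurable_EFinP/measurable_funTS; exact: measurable_normal_pdf.
rewrite /normal_prob !integral_itv_bndo_bndc//; last 2 first.
- exact: mpdf.
- exact: mpdf.
rewrite (@increasing_ge0_integration_by_substitutionNy _ F).
- apply: eq_integral => x _; rewrite F'E; congr EFin => /=.
  rewrite !normal_pdfE ?oner_neq0 ?gt_eqF// /normal_fun.
  have -> : @normal_peak R 1 = s * @normal_peak R s.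
    rewrite /normal_peak expr1n mul1r -mulrnAr sqrtrM ?sqr_ge0// sqrtr_sqr.
    by rewrite gtr0_norm// invfM mulrA divff ?gt_eqF// mul1r.
  rewrite mulrC mulrA; congr (_ * _ * expR _).
  by rewrite /F; field; rewrite gt_eqF.
- by move=> x y _ _ xy; rewrite /F ltrD2l ltr_pM2l.
- by rewrite F'E => x _; exact: cvg_cst.
- by rewrite F'E; exact: is_cvg_cst.
- by rewrite F'E; exact: cvg_cst.
- split; first by move=> x _; rewrite /F; exact: derivableD.
  apply: cvg_at_left_filter; rewrite /F.
  by apply: cvgD; [exact: cvg_cst|apply: cvgM; [exact: cvg_cst|exact: cvg_id]].
- apply/cvgrNyPle => B.
  apply: filterS (nbhs_ninfty_le (num_real ((B - m) / s))) => x.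
  by rewrite ler_pdivlMr// mulrC /F -lerBrDl.
- by apply: continuous_subspaceT; apply: continuous_normal_pdf; rewrite gt_eqF.
- by move=> x _; exact: normal_pdf_ge0.
Qed.

(** An interval has mass at most its length times the peak of the density. This continuity is what
    makes rounding errors of the means vanish with the mesh. *)
Lemma normal_prob_ray_lipschitz (b c : R) : b <= c ->
  fine (N01 `]-oo, c[%classic) <=
  fine (N01 `]-oo, b[%classic) + normal_peak 1 * (c - b).
Proof.
move=> bc.
have bcE : `]-oo, c[%classic = `]-oo, b[%classic `|` `[b, c[%classic :> set R.
  apply/seteqP; split => x /=.
    by rewrite in_itv/= => xc; case: (ltP x b) => xb; [left|right];
      by rewrite in_itv/= xb.
  by rewrite !in_itv/= => -[/lt_le_trans|/andP[]//]; exact.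
rewrite -lee_fin EFinD !fineK ?fin_num_measure// bcE.
apply: le_trans (measureU2 _ _ _) _ => //.
rewrite leeD2l// /normal_prob.
apply: (@le_trans _ _ (\int[lebesgue_measure]_(x in `[b, c[) (normal_peak 1)%:E)%E).
  apply: ge0_le_integral => //=.
  - by move=> x _; rewrite lee_fin normal_pdf_ge0.
  - by apply/measurable_EFinP/measurable_funTS; exact: measurable_normal_pdf.
  - by move=> x _; rewrite lee_fin normal_pdf_ub ?oner_neq0.
rewrite integral_cst//= lebesgue_measure_itv/= lte_fin.
case: ifPn => [_|_]; first by rewrite -EFinB -EFinM.
by rewrite mule0 lee_fin mulr_ge0// ?normal_peak_ge0 ?subr_ge0.
Qed.

End gaussian_rays.

Section countable_partition.
Context d (T : measurableType d) (R : realType) (P : {measure set T -> \bar R}).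
Context (I : countType) (F : I -> set T) (C : set T) (c : R).
Hypotheses (mF : forall i, measurable (F i)) (mC : measurable C).
Hypotheses (tF : trivIset setT F) (c0 : 0 <= c).

(** Cells are renumbered by natural numbers, with empty sets at the codes of no index, so that
    countable additivity applies. *)
Let F' n := if @pickle_inv I n is Some i then F i else set0.

Let mF' n : measurable (F' n).
Proof. by rewrite /F'; case: pickle_inv. Qed.

Let tF' : trivIset setT F'.
Proof.
move=> m n _ _ []; rewrite /F' => x.
case Em: (@pickle_inv I m) => [i|] [] //; case En: (@pickle_inv I n) => [j|] // Fi Fj.
have ij : i = j by apply: tF => //; exists x.
have := @pickle_invK I m; have := @pickle_invK I n.
by rewrite Em En /= => <- <-; rewrite ij.
Qed.

Let UF' : \bigcup_n F' n = \bigcup_i F i.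
Proof.
apply/seteqP; split => [x [n _]|x [i _ Fix]].
  by rewrite /F'; case: pickle_inv => // i Fi; exists i.
by exists (pickle i) => //; rewrite /F' pickleK_inv.
Qed.

Let measureUF' : P (\bigcup_i F i) = (\sum_(0 <= n <oo) P (F' n))%E.
Proof. rewrite -UF' measure_bigcup//. by apply: eq_eseriesl => n; rewrite in_setT. Qed.

Let measureUF'C : P (\bigcup_i F i `&` C) = (\sum_(0 <= n <oo) P (F' n `&` C))%E.
Proof.
rewrite -UF' setI_bigcupl measure_bigcup//.
- by apply: eq_eseriesl => n; rewrite in_setT.
- by move=> n _; exact: measurableI.
- exact: trivIset_setIr.
Qed.

Lemma measure_partition_le :
  (forall i, P (F i `&` C) <= c%:E * P (F i))%E ->
  (P (\bigcup_i F i `&` C) <= c%:E * P (\bigcup_i F i))%E.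
Proof.
move=> le; rewrite measureUF'C measureUF' -nneseriesZl; last first.
  by move=> n _; exact: measure_ge0.
apply: lee_nneseries => n _; first by move=> _; exact: measure_ge0.
by rewrite /F'; case: pickle_inv => [i|]; rewrite ?set0I ?measure0 ?mule0.
Qed.

Lemma measure_partition_ge :
  (forall i, c%:E * P (F i) <= P (F i `&` C))%E ->
  (c%:E * P (\bigcup_i F i) <= P (\bigcup_i F i `&` C))%E.
Proof.
move=> le; rewrite measureUF'C measureUF' -nneseriesZl; last first.
  by move=> n _; exact: measure_ge0.
apply: lee_nneseries => n _.
  by move=> _; rewrite mule_ge0 ?lee_fin// measure_ge0.
by rewrite /F'; case: pickle_inv => [i|]; rewrite ?set0I ?measure0 ?mule0.
Qed.

End countable_partition.

Definition ray {R : realType} (o : option R) : set R :=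
  if o is Some b then `]-oo, b[%classic else setT.

(** The shift [u] is the rounding error of a mean in standardized units. *)
Definition std_normal_ray {R : realType} (o : option R) (u : R) : R :=
  fine (normal_prob 0 1 (ray (omap (fun b => b + u) o))).

Section rays.
Context {R : realType}.
Implicit Types (o : option R) (u : R).

Lemma measurable_ray o : measurable (ray o).
Proof. by case: o => [b|]; [exact: measurable_itv|exact: measurableT]. Qed.

Lemma std_normal_ray_ge0 o u : 0 <= std_normal_ray o u.
Proof. exact: fine_ge0. Qed.

Lemma std_normal_ray_homo o : {homo std_normal_ray o : u v / u <= v}.
Proof.
case: o => [b|] u v uv //; rewrite fine_le ?fin_num_measure//=.
apply: le_measure; rewrite ?inE//.
by apply: subset_itvl; rewrite bnd_simp lerD2l.
Qed.

Lemma measurable_std_normal_ray o : measurable_fun setT (std_normal_ray o).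
Proof. by apply: nondecreasing_measurable => //; exact: std_normal_ray_homo. Qed.

Lemma cvg_std_normal_ray o : std_normal_ray o u @[u --> 0] --> std_normal_ray o 0.
Proof.
case: o => [b|]; last by rewrite /std_normal_ray/=; exact: cvg_cst.
have K0 : 0 < normal_peak (1 : R) by rewrite normal_peak_gt0 ?oner_neq0.
have lip u v : u <= v ->
    std_normal_ray (Some b) v <= std_normal_ray (Some b) u + normal_peak 1 * (v - u).
  move=> uv; have -> : v - u = (b + v) - (b + u) by lra.
  by apply: normal_prob_ray_lipschitz; rewrite lerD2l.
apply/cvgrPdist_le => e e0.
have d0 : 0 < e / normal_peak 1 by rewrite divr_gt0.
near=> u.
have : `|u| <= e / normal_peak 1.
  near: u; apply: (@cvgr0_norm_le _ R^o _ _ _ id) => //; exact: cvg_id.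
rewrite ler_pdivlMr// => ue.
have [u0|/ltW u0] := leP 0 u.
  rewrite distrC ger0_norm ?subr_ge0 ?std_normal_ray_homo//.
  have := lip _ _ u0; rewrite subr0 => h; rewrite ger0_norm// in ue; lra.
rewrite ger0_norm ?subr_ge0 ?std_normal_ray_homo//.
have := lip _ _ u0; rewrite sub0r => h; rewrite ler0_norm// in ue; lra.
Unshelve. all: by end_near.
Qed.

End rays.

(** * Independence of the standardized noise from the past *)

Section whitening.
Context d (T : measurableType d) (R : realType) (P : probability T R).
Context (I : finType) (G : set_system T) (m x : I -> T -> R) (s : R).
Hypothesis s0 : 0 < s.
Hypothesis GP : <<s G >> `<=` measurable.
Let PT := g_sigma_algebraType G.
Hypothesis mm : forall p, measurable_fun setT (m p : PT -> R).
Hypothesis mx : forall p, measurable_fun setT (x p).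
Hypothesis law : forall E, <<s G >> E ->
  forall B : I -> set R, (forall p, measurable (B p)) ->
  P (E `&` [set w | forall p, B p (x p w)]) =
  (\int[P]_(w in E) (\prod_p fine (normal_prob (m p w) s (B p)))%:E)%E.

Definition standardized p w := (x p w - m p w) / s.
Local Notation Z := standardized.

Let mmT p : measurable_fun [set: T] (m p).
Proof. by move=> _ B mB; apply: GP; exact: mm. Qed.

Lemma measurable_standardized p : measurable_fun setT (Z p).
Proof. by apply: measurable_funM => //; apply: measurable_funB. Qed.

Definition standardized_box (o : I -> option R) :=
  [set w | forall p, ray (o p) (Z p w)].

Let measurable_forall (D : I -> set T) : (forall p, measurable (D p)) ->
  measurable [set w | forall p, D p w].
Proof.
move=> mD; rewrite (_ : mkset _ = \bigcap_(p in setT) D p).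
  by apply: fin_bigcap_measurable => //; exact: finite_finset.
by apply/seteqP; split => w /= h p; [move=> _; exact: h|exact: h].
Qed.

Lemma measurable_standardized_box o : measurable (standardized_box o).
Proof.
apply: (measurable_forall (D := fun p => Z p @^-1` ray (o p))) => p.
by rewrite -[X in measurable X]setTI; apply: measurable_standardized => //;
  exact: measurable_ray.
Qed.

(** [law] only speaks of boxes with deterministic ends. Putting the constant [c p] in place of the
    random mean costs a shift [(c p - m p w) / s] in the standardized ray. *)
Let integrand o (c : I -> R) (E : set T) : <<s G >> E ->
  P (E `&` [set w | forall p, ray (omap (fun b => s * b + c p) (o p)) (x p w)]) =
  (\int[P]_(w in E) (\prod_p std_normal_ray (o p) ((c p - m p w) / s))%:E)%E.
Proof.
move=> GE; rewrite (law GE (B := fun p => ray (omap (fun b => s * b + c p) (o p)))); last first.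
  by move=> p; exact: measurable_ray.
apply: eq_integral => w _; congr EFin; apply: eq_bigr => p _.
rewrite /std_normal_ray; case: (o p) => [b|] /=.
  rewrite -(normal_prob_ray (m p w) _ s0).
  suff -> : m p w + s * (b + (c p - m p w) / s) = s * b + c p by [].
  by field; rewrite gt_eqF.
by rewrite !(@probability_setT _ _ _ (normal_prob _ _)).
Qed.

Let measurable_integrand o (c : I -> R) (E : set T) :
  measurable_fun E (fun w => (\prod_p std_normal_ray (o p) ((c p - m p w) / s))%:E).
Proof.
apply/measurable_funTS/measurable_EFinP; apply: measurable_prod => p _.
apply: (measurableT_comp (measurable_std_normal_ray (o p))).
by apply: measurable_funM => //; apply: measurable_funB.
Qed.

Let measurable_box o (c : I -> R) :
  measurable [set w | forall p, ray (omap (fun b => s * b + c p) (o p)) (x p w)].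
Proof.
apply: (measurable_forall (D := fun p => x p @^-1` ray _)) => p.
by rewrite -[X in measurable X]setTI; apply: mx => //; exact: measurable_ray.
Qed.

(* Rounding the means to a mesh of size [s * e] makes them constant on each
   cell, up to an error of [e] in the standardized variable. *)
Section mesh.
Variable e : R.
Hypothesis e0 : 0 < e.

Let cell (q : {ffun I -> int}) : set T :=
  [set w | forall p, Num.floor (m p w / (s * e)) = q p].

Let Gcell E q : <<s G >> E -> <<s G >> (E `&` cell q).
Proof.
move=> GE.
have mcell : @measurable _ PT (cell q).
  rewrite (_ : cell q = \bigcap_(p in setT)
      [set w : PT | Num.floor (m p w / (s * e)) = q p]); last first.
    by apply/seteqP; split => w /= h p; [move=> _; exact: h|exact: h].
  apply: fin_bigcap_measurable => [|p _]; first exact: finite_finset.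
  have mf : measurable_fun setT (fun w : PT => m p w / (s * e)).
    exact: measurable_funM.
  rewrite (_ : mkset _ = setT `&` (fun w : PT => m p w / (s * e)) @^-1`
     `[(q p)%:~R, (q p + 1)%:~R[%classic).
    by apply: mf => //; exact: measurable_itv.
  rewrite setTI; apply/seteqP; split => w /=; rewrite in_itv/=.
    by move=> <-; exact: floor_itv.
  exact: floor_def.
exact: (@measurableI _ PT).
Qed.

Let cellU (E : set T) : \bigcup_q (E `&` cell q) = E.
Proof.
apply/seteqP; split => [w [q _ []//]|w Ew].
by exists [ffun p => Num.floor (m p w / (s * e))] => //; split => // p; rewrite ffunE.
Qed.

Let cell_triv (E : set T) : trivIset setT (fun q => E `&` cell q).
Proof.
move=> q r _ _ [w [[_ wq] [_ wr]]]; apply/ffunP => p.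
by rewrite -(wq p) -(wr p).
Qed.

Let cell_itv q w p : cell q w ->
  s * e * (q p)%:~R <= m p w < s * e * (q p)%:~R + s * e.
Proof.
move=> /(_ p) wq; have := floor_itv (m p w / (s * e)); rewrite wq.
have se0 : 0 < s * e by rewrite mulr_gt0.
rewrite ler_pdivlMr// ltr_pdivrMr// intrD mulrDl mul1r mulrC => /andP[-> /=].
by rewrite mulrC.
Qed.

Lemma standardized_box_le o E : <<s G >> E ->
  (P (E `&` standardized_box o) <=
   (\prod_p std_normal_ray (o p) e)%:E * P E)%E.
Proof.
move=> GE; rewrite -[X in P (X `&` _)](cellU E) -[X in (_ * P X)%E](cellU E).
apply: measure_partition_le => [q|||q].
- by apply: GP; exact: Gcell.
- exact: measurable_standardized_box.
- exact: cell_triv.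
(* The upper corner of the cell: it dominates the means, so the box with ends shifted by [c]
   contains the standardized box, and the shift is at most [e]. *)
pose c p := s * e * (q p)%:~R + s * e.
apply: (@le_trans _ _ (P (E `&` cell q `&`
    [set w | forall p, ray (omap (fun b => s * b + c p) (o p)) (x p w)]))).
  apply: le_measure; rewrite ?inE; last first.
  - move=> w [[Ew wq] wo]; split => // p; have := wo p.
    case: (o p) => [b|] //=; rewrite !in_itv/= /standardized ltr_pdivrMr//.
    by have /andP[h1 h2] := cell_itv p wq; rewrite /c; lra.
  - apply: measurableI => //; apply: GP; exact: Gcell.
  - apply: measurableI; last exact: measurable_standardized_box.
    apply: GP; exact: Gcell.
rewrite integrand; last exact: Gcell.
have mE : measurable (E `&` cell q) by apply: GP; exact: Gcell.
rewrite -integral_cst//; apply: ge0_le_integral => //.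
- move=> w _; rewrite lee_fin; apply: prodr_ge0 => p _; exact: std_normal_ray_ge0.
- move=> w [_ wq]; rewrite lee_fin; apply: ler_prod => p _.
  rewrite std_normal_ray_ge0/=; apply: std_normal_ray_homo.
  have /andP[h1 h2] := cell_itv p wq; rewrite ler_pdivrMr// /c; lra.
Qed.

Lemma standardized_box_ge o E : <<s G >> E ->
  ((\prod_p std_normal_ray (o p) (- e))%:E * P E <=
   P (E `&` standardized_box o))%E.
Proof.
move=> GE; rewrite -[X in P (X `&` _)](cellU E) -[X in (_ * P X)%E](cellU E).
apply: measure_partition_ge => [q||||q].
- by apply: GP; exact: Gcell.
- exact: measurable_standardized_box.
- exact: cell_triv.
- by apply: prodr_ge0 => p _; exact: std_normal_ray_ge0.
(* The lower corner: the inclusion is reversed, and the shift is at least [- e]. *)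
pose c p := s * e * (q p)%:~R.
apply: (@le_trans _ _ (P (E `&` cell q `&`
    [set w | forall p, ray (omap (fun b => s * b + c p) (o p)) (x p w)]))); last first.
  apply: le_measure; rewrite ?inE; last first.
  - move=> w [[Ew wq] wo]; split => // p; have := wo p.
    case: (o p) => [b|] //=; rewrite !in_itv/= /standardized ltr_pdivrMr//.
    by have /andP[h1 h2] := cell_itv p wq; rewrite /c; lra.
  - apply: measurableI; last exact: measurable_standardized_box.
    apply: GP; exact: Gcell.
  - apply: measurableI => //; apply: GP; exact: Gcell.
rewrite integrand; last exact: Gcell.
have mE : measurable (E `&` cell q) by apply: GP; exact: Gcell.
rewrite -integral_cst//; apply: ge0_le_integral => //.
- move=> w _; rewrite lee_fin; apply: prodr_ge0 => p _; exact: std_normal_ray_ge0.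
- move=> w [_ wq]; rewrite lee_fin; apply: ler_prod => p _.
  rewrite std_normal_ray_ge0/=; apply: std_normal_ray_homo.
  have /andP[h1 h2] := cell_itv p wq; rewrite ler_pdivlMr// /c; lra.
Qed.

End mesh.

(** Both mesh bounds tend to the same product when [e] tends to 0. The factor [P E] expresses
    independence from the past, the product over [p] independence of the coordinates. *)
Lemma standardized_boxE o E : <<s G >> E ->
  P (E `&` standardized_box o) = ((\prod_p std_normal_ray (o p) 0)%:E * P E)%E.
Proof.
move=> GE; pose c u := \prod_p std_normal_ray (o p) u.
have cc : c u @[u --> 0] --> c 0.
  apply: cvg_big => [|p _]; last exact: cvg_std_normal_ray.
  exact: mul_continuous.
have mE : measurable E by exact: GP.
have mEo : measurable (E `&` standardized_box o).
  by apply: measurableI => //; exact: measurable_standardized_box.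
rewrite -[LHS]fineK ?fin_num_measure// -[X in (_ * X)%E]fineK ?fin_num_measure//.
rewrite -EFinM; congr EFin; apply/eqP; rewrite eq_le; apply/andP; split.
  apply: (@cvgr_to_ge _ (0 : R)^'+ _ _ (fun u => c u * fine (P E))).
    apply: cvgMr_tmp; apply: cvg_at_right_filter; exact: cc.
  near=> u; rewrite -lee_fin EFinM !fineK ?fin_num_measure//.
  by apply: standardized_box_le => //; near: u; exact: nbhs_right_gt.
apply: (@cvgr_to_le _ (0 : R)^'+ _ _ (fun u => c (- u) * fine (P E))).
  apply: cvgMr_tmp; apply: cvg_at_right_filter.
  apply: (cvg_comp (fun u : R => - u) c); last exact: cc.
  have := @oppr_continuous R R^o (0 : R); rewrite /continuous_at oppr0; exact.
near=> u; rewrite -lee_fin EFinM !fineK ?fin_num_measure//.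
by apply: standardized_box_ge => //; near: u; exact: nbhs_right_gt.
Unshelve. all: by end_near.
Qed.

(* A pi-system generating the past together with all the standardized
   coordinates except [p0] (the rays at [None] are the whole line). *)
Definition other_coordinates (p0 : I) : set_system T :=
  [set F | exists E o, [/\ <<s G >> E, o p0 = None & F = E `&` standardized_box o]].

Lemma other_coordinates_measurable p0 : other_coordinates p0 `<=` measurable.
Proof.
move=> _ [E [ o [GE _ ->]]]; apply: measurableI; first exact: GP.
exact: measurable_standardized_box.
Qed.

Lemma other_coordinates_setI p0 : setI_closed (other_coordinates p0).
Proof.
move=> _ _ [E [ o [GE oN ->]]] [E1 [ o' [GE1 oN' ->]]].
pose om b c : option R := match b, c with
  | Some b, Some c => Some (Num.min b c)
  | None, c => c | b, None => b
  end.
exists (E `&` E1), (fun p => om (o p) (o' p)); split.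
- exact: (@measurableI _ PT).
- by rewrite oN oN'.
rewrite setIACA; congr (_ `&` _).
have rayI p z : ray (om (o p) (o' p)) z <-> ray (o p) z /\ ray (o' p) z.
  rewrite /om; case: (o p) => [b|]; case: (o' p) => [c|] //=; try by split => // -[].
  by rewrite !in_itv/= lt_min; split => [/andP|[-> ->]].
apply/seteqP; split => w /=; first by move=> [h h'] p; apply/rayI.
by move=> h; split=> p; have /rayI[] := h p.
Qed.

Let box_None : standardized_box (fun=> None) = setT.
Proof. by apply/seteqP; split. Qed.

Lemma other_coordinates_past p0 E : <<s G >> E -> other_coordinates p0 E.
Proof. by move=> GE; exists E, (fun=> None); rewrite box_None setIT. Qed.

Lemma other_coordinates_setT p0 : other_coordinates p0 setT.
Proof. by apply: other_coordinates_past; exact: (@measurableT _ PT). Qed.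

(** A box free at [p0], intersected with a ray in that coordinate, is again a box; its probability
    differs by the factor at [p0]. *)
Lemma other_coordinates_indep p0 F b : other_coordinates p0 F ->
  P (F `&` Z p0 @^-1` `]-oo, b[%classic) =
  (P F * normal_prob 0 1 `]-oo, b[%classic)%E.
Proof.
move=> [E [ o [GE oN ->]]].
pose o' p := if p == p0 then Some b else o p.
have -> : E `&` standardized_box o `&` Z p0 @^-1` `]-oo, b[%classic =
          E `&` standardized_box o'.
  rewrite -setIA; congr (_ `&` _); apply/seteqP; split => w /=.
    by move=> [h hb] p; rewrite /o'; case: eqP => [->|].
  move=> h; split; last by have := h p0; rewrite /o' eqxx.
  move=> p; case: (eqVneq p p0) => [->|pp0]; first by rewrite oN.
  by have := h p; rewrite /o' (negbTE pp0).
rewrite !standardized_boxE// (bigD1 p0)//= [in RHS](bigD1 p0)//=.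
rewrite {1}/o' eqxx oN /std_normal_ray/= addr0.
rewrite (@probability_setT _ _ _ (normal_prob 0 1))/= mul1r.
rewrite EFinM fineK ?fin_num_measure//.
rewrite -muleA muleC; congr (_%:E * _ * _)%E; apply: eq_bigr => p pp0.
by rewrite /o' (negbTE pp0).
Qed.

Lemma measurable_past_other p0 p :
  measurable_fun setT (m p : g_sigma_algebraType (other_coordinates p0) -> R).
Proof.
move=> _ B mB; apply: sub_sigma_algebra; apply: other_coordinates_past.
exact: mm.
Qed.

Lemma measurable_standardized_other p0 p : p != p0 ->
  measurable_fun setT (Z p : g_sigma_algebraType (other_coordinates p0) -> R).
Proof.
move=> pp0; apply: (measurability _ (RGenInftyO.measurableE R)).
move=> _ [_ [b ->] <-]; apply: sub_sigma_algebra.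
exists setT, (fun q => if q == p then Some b else None).
split; first exact: (@measurableT _ PT).
  by rewrite eq_sym (negbTE pp0).
congr (_ `&` _); apply/seteqP; split => w /=.
  by move=> h q; case: eqP => [->|].
by move=> /(_ p); rewrite eqxx.
Qed.

Lemma expectation_standardized0 p0
    (X : g_sigma_algebraType (other_coordinates p0) -> R) (h : R -> R) :
  measurable_fun setT X -> measurable_fun setT h ->
  P.-integrable setT (fun w => (X w * h (Z p0 w))%:E) ->
  (normal_prob (0 : R) 1).-integrable setT (EFin \o h) ->
  (\int[normal_prob (0 : R) 1]_y (h y)%:E = 0)%E ->
  (\int[P]_w (X w * h (Z p0 w))%:E = 0)%E.
Proof.
move=> mX mh iXh ih h0.
exact: (expectation_indep0 (@other_coordinates_measurable p0)
  (@other_coordinates_setI p0) (other_coordinates_setT p0)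
  (measurable_standardized p0) (nu := normal_prob 0 1)
  (@other_coordinates_indep p0)).
Qed.

Lemma ge0_integral_standardized p (f : R -> \bar R) :
  (forall y, 0 <= f y)%E -> measurable_fun setT f ->
  (\int[P]_w f (Z p w) = \int[normal_prob (0 : R) 1]_y f y)%E.
Proof.
move=> f0 mf.
exact: (ge0_integral_indep (@other_coordinates_measurable p)
  (@other_coordinates_setI p) (other_coordinates_setT p)
  (measurable_standardized p) (nu := normal_prob 0 1)
  (@other_coordinates_indep p)).
Qed.

End whitening.

(** * Measurability of continuous functions of random matrices *)

Section continuous_of_random_matrix.
Context d (T : measurableType d) (R : realType) (N D : nat).
Variables (X : T -> 'M[R]_(N, D)).
Hypothesis mX : forall i k, measurable_fun [set: T] (fun w => X w i k).

(** Rounding the entries of [X] down to multiples of [1 / (n + 1)] gives a matrix with countably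
    many values, so its image by [f] is measurable; continuity of [f] gives pointwise
    convergence. *)
Lemma measurable_continuous_matrix (f : 'M[R]_(N, D) -> R) :
  continuous f -> measurable_fun [set: T] (fun w => f (X w)).
Proof.
move=> cf.
pose q n w : {ffun 'I_N * 'I_D -> int} :=
  [ffun p => Num.floor (X w p.1 p.2 * n.+1%:R)].
pose v n (r : {ffun 'I_N * 'I_D -> int}) : 'M[R]_(N, D) :=
  \matrix_(i, k) ((r (i, k))%:~R / n.+1%:R).
have mq n r : measurable [set w | q n w = r].
  rewrite (_ : mkset _ = \bigcap_(p in setT)
      ((fun w => X w p.1 p.2 * n.+1%:R) @^-1`
       `[(r p)%:~R, (r p + 1)%:~R[%classic)); last first.
    apply/seteqP; split => w /=.
      by move=> <- p _ /=; rewrite in_itv/= ffunE; exact: floor_itv.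
    move=> h; apply/ffunP => p; rewrite ffunE.
    by have := h p I; rewrite /= in_itv/=; exact: floor_def.
  apply: fin_bigcap_measurable => [|p _]; first exact: finite_finset.
  rewrite -[X in measurable X]setTI.
  suff : measurable_fun setT (fun w => X w p.1 p.2 * n.+1%:R).
    by apply => //; exact: measurable_itv.
  by apply: measurable_funM.
have mfv n : measurable_fun [set: T] (fun w => f (v n (q n w))).
  move=> _ B mB; rewrite setTI.
  rewrite (_ : _ @^-1` _ = \bigcup_r [set w | q n w = r /\ B (f (v n r))]).
    apply: countable_bigcupT_measurable => // r.
    have [Br|nBr] := pselect (B (f (v n r))).
      by rewrite (_ : mkset _ = [set w | q n w = r])//; apply/seteqP; split => w // [].
    by rewrite (_ : mkset _ = set0)//; apply/seteqP; split => w // [].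
  by apply/seteqP; split => w /=; [move=> Bw; exists (q n w)|move=> [r _ [->]]].
apply: (measurable_fun_cvg mfv) => w _.
apply: (cvg_comp (fun n => v n (q n w)) f); last exact: cf.
apply/cvgrPdist_le => e e0.
near=> n.
rewrite /Num.Def.normr/= mx_normrE (bigmax_le _ (ltW e0))//= => -[i k] _ /=.
rewrite !mxE !ffunE/=; set y := X w i k.
have n0 : (0 : R) < n.+1%:R by [].
have -> : y - (Num.floor (y * n.+1%:R))%:~R / n.+1%:R =
   (y * n.+1%:R - (Num.floor (y * n.+1%:R))%:~R) / n.+1%:R.
  by field; rewrite addrC natr1.
have /andP[h1 h2] := floor_itv (y * n.+1%:R).
rewrite normrM normfV (gtr0_norm n0) ler_pdivrMr//.
rewrite ger0_norm ?subr_ge0// (@le_trans _ _ 1)//.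
  by rewrite intrD in h2; lra.
rewrite mulrC -ler_pdivrMr// mul1r.
near: n; exists (Num.truncn e^-1) => // n /= hn.
by apply: ltW; apply: lt_le_trans (truncnS_gt _) _; rewrite ler_nat.
Unshelve. all: by end_near.
Qed.

End continuous_of_random_matrix.

(** * Bounds on the gradient estimators *)

Lemma uniform_constant (R : realType) (I : finType) (Q : I -> R -> Prop) :
  (forall i, exists2 K, 0 <= K & Q i K) ->
  (forall i K K', K <= K' -> Q i K -> Q i K') ->
  exists2 K, 0 <= K & forall i, Q i K.
Proof.
move=> h mQ; have /choice[K hK] i : exists K, 0 <= K /\ Q i K.
  by have [K K0 QK] := h i; exists K.
exists (\sum_i K i) => [|i]; first by apply: sumr_ge0 => i _; have [] := hK i.
have [_] := hK i; apply: mQ; rewrite (bigD1 i)//= lerDl.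
by apply: sumr_ge0 => l _; have [] := hK l.
Qed.

(* The exponent 1/96 makes the 24th power exp(|z|^2/4), which is integrable for
   a standard Gaussian z; 24 is what [small_increments] requires. *)
Definition noise_weight {R : realType} {N d : nat} (z : 'M[R]_(N, d)) : R :=
  expR (`|z| ^+ 2 / 96).

(** The two-point baseline is kept in this part: it depends on the state only, so the whole value
    still does not involve [z_p]. *)
Definition frozen_cost {R : realType} {N d : nat} (j : oracle)
    (J : 'I_N -> 'M[R]_(N, d) -> R) (s : R) (mu z : 'M[R]_(N, d))
    (p : 'I_N * 'I_d) : R :=
  J p.1 (mu + s *: zero_coord p z) - (if j is TwoPoint then J p.1 mu else 0).

(** The order of the estimator: a difference of costs is [O(s)] and cancels the division by [s],
    whereas a single cost does not. *)
Definition estimate_scale {R : realType} (j : oracle) (s : R) : R :=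
  if j is TwoPoint then 1 else s^-1.

Section estimate_bounds.
Context {R : realType} {N d : nat}.
Variables (J : 'I_N -> 'M[R]_(N, d) -> R) (alpha rho a : R) (j : oracle).
Hypotheses (J_C1 : forall i, continuously_differentiable (J i : _ -> R^o))
  (J_growth : forall i, exp_power_growth alpha (J i))
  (M_smooth : twice_differentiable (pseudo_gradient J))
  (alpha_lt2 : alpha < 2) (a0 : 0 < a).

(** Half the exponent of [noise_weight]: each bound is a product of one such factor for the cost and
    at most one for the coordinate of the noise. *)
Let e : R := 192^-1.
Let e0 : 0 < e. Proof. by rewrite invr_gt0. Qed.
Let dJ i x : differentiable (J i) x. Proof. exact: (J_C1 i).1. Qed.
Let cJ i v : continuous ('D_v (J i)). Proof. exact: (J_C1 i).2. Qed.

Lemma pseudo_gradient_coord (p : 'I_N * 'I_d) :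
  (fun x => pseudo_gradient J x p.1 p.2) = 'D_(delta_mx p.1 p.2) (J p.1).
Proof. by apply/funext => x; rewrite mxE. Qed.

Let dg (p : 'I_N * 'I_d) x : differentiable ('D_(delta_mx p.1 p.2) (J p.1)) x.
Proof.
rewrite -pseudo_gradient_coord.
apply: (@differentiable_comp _ _ _ _ (pseudo_gradient J)
  (fun M : 'M[R]_(N, d) => M p.1 p.2)).
  exact: M_smooth.1.
exact: differentiable_coord.
Qed.

(** Differentiability of the first derivatives of the pseudo-gradient makes them continuous; hence
    the partial derivatives of the costs are Lipschitz on boxes, as the second-order expansion
    requires. *)
Let cg (p : 'I_N * 'I_d) v : continuous ('D_v ('D_(delta_mx p.1 p.2) (J p.1))).
Proof.
rewrite -pseudo_gradient_coord.
have -> : 'D_v (fun x => pseudo_gradient J x p.1 p.2) =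
    (fun x => 'D_v (pseudo_gradient J) x p.1 p.2).
  apply/funext => x; rewrite derive_mx ?mxE//.
  by apply: diff_derivable; exact: M_smooth.1.
move=> x; apply: (@continuous_comp _ _ _ ('D_v (pseudo_gradient J))
  (fun M : 'M[R]_(N, d) => M p.1 p.2)).
  by apply: differentiable_continuous; exact: M_smooth.2.
exact: coord_continuous.
Qed.

Lemma continuous_pseudo_gradient p : continuous (fun x => pseudo_gradient J x p.1 p.2).
Proof.
by rewrite pseudo_gradient_coord => x; apply: differentiable_continuous; exact: dg.
Qed.

Lemma grad_estimateE s mu z (p : 'I_N * 'I_d) : s != 0 ->
  grad_estimate j J s mu (mu + s *: z) p.1 p.2 =
  (J p.1 (mu + s *: z) - (if j is TwoPoint then J p.1 mu else 0)) * (z p.1 p.2 / s).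
Proof.
move=> s0; have E : (mu p.1 p.2 + s * z p.1 p.2 - mu p.1 p.2) / s ^+ 2 = z p.1 p.2 / s.
  by field.
by rewrite /grad_estimate; case: j; rewrite !mxE ?subr0 E.
Qed.

Let h0 (z : 'M[R]_(N, d)) : R := expR (e * `|z| ^+ 2).
Let h0_ge1 z : 1 <= h0 z.
Proof. by rewrite -expR0 ler_expR mulr_ge0 ?sqr_ge0 ?(ltW e0). Qed.
Let h0h0 z : h0 z * h0 z = noise_weight z.
Proof. by rewrite -expRD /noise_weight; congr expR; rewrite /e; field. Qed.
Let coord_h0 (z : 'M[R]_(N, d)) i k : `|z i k| <= (1 + e^-1) * h0 z.
Proof. by apply: le_trans (coord_le_norm _ _ _) _; exact: le_exp_sqr. Qed.

(** The first bound controls the quadratic term and the pathwise increments, the second the bias;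
    the last two make the mean-zero parts integrable. *)
Lemma estimate_bound : exists2 K, 0 <= K & forall p mu s z,
  `|mu| <= rho -> 0 < s <= a ->
  [/\ `|grad_estimate j J s mu (mu + s *: z) p.1 p.2|
        <= K * estimate_scale j s * noise_weight z,
      `|grad_estimate j J s mu (mu + s *: z) p.1 p.2 -
         (frozen_cost j J s mu z p / s * z p.1 p.2 +
          pseudo_gradient J mu p.1 p.2 * z p.1 p.2 ^+ 2)| <= K * s * noise_weight z,
      `|frozen_cost j J s mu z p| <= K * noise_weight z &
      `|pseudo_gradient J mu p.1 p.2| <= K].
Proof.
pose Q (p : 'I_N * 'I_d) K := forall mu s z,
  `|mu| <= rho -> 0 < s <= a ->
  [/\ `|grad_estimate j J s mu (mu + s *: z) p.1 p.2|
        <= K * estimate_scale j s * noise_weight z,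
      `|grad_estimate j J s mu (mu + s *: z) p.1 p.2 -
         (frozen_cost j J s mu z p / s * z p.1 p.2 +
          pseudo_gradient J mu p.1 p.2 * z p.1 p.2 ^+ 2)| <= K * s * noise_weight z,
      `|frozen_cost j J s mu z p| <= K * noise_weight z &
      `|pseudo_gradient J mu p.1 p.2| <= K].
apply: (@uniform_constant R _ Q) => [p|p K K' KK' QK mu s z mur sa]; last first.
  have [h1 h2 h3 h4] := QK mu s z mur sa; have /andP[s0 _] := sa.
  have w0 : 0 <= noise_weight z by exact: expR_ge0.
  have q0 : 0 <= estimate_scale j s.
    by rewrite /estimate_scale; case: j; rewrite ?ler01// invr_ge0 ltW.
  split; first by rewrite (le_trans h1)// !ler_wpM2r.
  - by rewrite (le_trans h2)// !ler_wpM2r// ltW.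
  - by rewrite (le_trans h3)// ler_wpM2r.
  - exact: le_trans KK'.
have [K1 K10 hK1] := perturbed_value_le rho (dJ p.1) (@J_growth p.1) alpha_lt2 a0 e0.
have [K2 K20 hK2] := perturbed_diff_le rho (dJ p.1) (@cJ p.1) (@J_growth p.1)
  alpha_lt2 a0 e0.
have [K3 K30 hK3] := perturbed_coord_le rho (dJ p.1) (@cJ p.1) (@J_growth p.1)
  alpha_lt2 a0  (@dg p) (@cg p) e0.
have [K4 K40 hK4] := bounded_on_box rho (@cJ p.1 (delta_mx p.1 p.2)).
pose c := 1 + e^-1; have c0 : 0 <= c by rewrite addr_ge0// invr_ge0 ltW.
exists ((2 * K1 + K2 + K3) * (c + 1) + K4).
  nra.
move=> mu s z mur sa; have /andP[s0 _] := sa.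
have sn0 : s != 0 by rewrite gt_eqF.
have H1 := h0_ge1 z; have HH := h0h0 z.
have zc := coord_h0 z p.1 p.2; rewrite -/c in zc.
have v1 := hK1 mu s z mur sa; rewrite -/(h0 z) in v1.
have v2 := hK2 mu s z mur sa; rewrite -/(h0 z) in v2.
have v3 := hK3 mu s z mur sa; rewrite -/(h0 z) in v3.
have v4 : `|pseudo_gradient J mu p.1 p.2| <= K4 by rewrite mxE; exact: hK4.
have v0 : `|J p.1 mu| <= K1.
  have := hK1 mu s 0 mur sa.
  by rewrite scaler0 addr0 normr0 expr0n mulr0 expR0 mulr1.
have v5 : `|J p.1 (mu + s *: zero_coord p z)| <= K1 * h0 z.
  apply: (le_trans (hK1 mu s _ mur sa)); rewrite ler_wpM2l// ler_expR.
  by rewrite ler_wpM2l ?(ltW e0)// lerXn2r ?nnegrE// norm_zero_coord.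
rewrite grad_estimateE// -HH; set H := h0 z in H1 HH zc v1 v2 v3 v5 *.
set zp := z p.1 p.2 in zc v3 *; set g := pseudo_gradient J mu p.1 p.2 in v4 *.
have gE : 'D_(delta_mx p.1 p.2) (J p.1) mu = g by rewrite /g mxE.
rewrite gE in v3.
set X := J p.1 (mu + s *: z) in v1 v2 v3 *.
set Y := J p.1 (mu + s *: zero_coord p z) in v3 v5 *.
have H0 : 0 <= H by lra.
have zs : `|zp / s| <= c * H / s.
  by rewrite normrM normfV (gtr0_norm s0) ler_pM2r ?invr_gt0.
have si0 : 0 <= s^-1 by rewrite invr_ge0 ltW.
pose KK := (2 * K1 + K2 + K3) * (c + 1) + K4.
have le1 : K1 * c <= KK by rewrite /KK; nra.
have le2 : K2 * c <= KK by rewrite /KK; nra.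
have le3 : K3 * c <= KK by rewrite /KK; nra.
have le4 : 2 * K1 <= KK by rewrite /KK; nra.
have le5 : K4 <= KK by rewrite /KK; nra.
rewrite -/KK; have HH0 : 0 <= H * H by rewrite mulr_ge0.
have HHH : H <= H * H by rewrite ler_peMr.
split.
- rewrite normrM /estimate_scale; case: (j) => /=; rewrite ?subr0.
    apply: (@le_trans _ _ (K1 * H * (c * H / s))); first exact: ler_pM.
    have -> : K1 * H * (c * H / s) = K1 * c * s^-1 * (H * H) by ring.
    by rewrite ler_wpM2r// ler_wpM2r.
  apply: (@le_trans _ _ (K2 * s * H * (c * H / s))); first exact: ler_pM.
  have -> : K2 * s * H * (c * H / s) = K2 * c * (H * H) by field.
  by rewrite mulr1 ler_wpM2r.
- rewrite /frozen_cost -/Y; set th := (if _ is TwoPoint then _ else _).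
  have -> : (X - th) * (zp / s) - ((Y - th) / s * zp + g * zp ^+ 2) =
      (X - Y - s * zp * g) * (zp / s) by field.
  rewrite normrM; apply: (@le_trans _ _ (K3 * s ^+ 2 * H * (c * H / s))).
    exact: ler_pM.
  have -> : K3 * s ^+ 2 * H * (c * H / s) = K3 * c * s * (H * H) by field.
  by rewrite ler_wpM2r// ler_wpM2r// ltW.
- rewrite /frozen_cost -/Y (le_trans (ler_normB _ _))//.
  apply: (@le_trans _ _ (K1 * H + K1 * H)).
    rewrite lerD//; case: (j); first by rewrite normr0 mulr_ge0.
    by rewrite (le_trans v0)// ler_peMr.
  apply: (@le_trans _ _ (2 * K1 * (H * H))); last by rewrite ler_wpM2r.
  by have := ler_wpM2l K10 HHH; lra.
- exact: le_trans le5.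
Qed.

End estimate_bounds.

(** * Rates from recursions *)

Section recursions.
Context {R : realType}.

(** Inductively [x t <= K * r t]. The contraction [3 / (2 t)] exceeds the relative decay [1 / t]
    allowed to [r] by [1 / (2 t)], and this surplus absorbs the source term once [K >= 2 * C]. *)
Lemma rate_recursion (x r : nat -> R) (C : R) (t0 : nat) :
  (1 < t0)%N -> 0 <= C -> (forall t, (t0 <= t)%N -> 0 <= x t) ->
  (forall t, (t0 <= t)%N -> 0 < r t) ->
  (forall t, (t0 <= t)%N -> (1 - t%:R^-1) * r t <= r t.+1) ->
  (forall t, (t0 <= t)%N ->
    x t.+1 <= (1 - 3 / 2 / t%:R) * x t + C * (r t / t%:R)) ->
  exists2 K, 0 <= K & forall t, (t0 <= t)%N -> x t <= K * r t.
Proof.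
move=> t01 C0 x0 r0 rr xx; pose K := 2 * C + x t0 / r t0.
have K0 : 0 <= K.
  by rewrite addr_ge0 ?mulr_ge0// ?x0// invr_ge0 ltW// r0.
exists K => //; elim=> [|t IH]; first by rewrite leqn0 => /eqP t00; rewrite t00 in t01.
rewrite leq_eqVlt => /orP[/eqP<-|].
  have rt := r0 _ (leqnn t0); rewrite /K mulrDl divfK ?gt_eqF// lerDr.
  by rewrite !mulr_ge0// ltW.
rewrite ltnS => tt; have {}IH := IH tt.
have t1 : (2 : R) <= t%:R by rewrite ler_nat (leq_trans t01).
apply: (le_trans (xx _ tt)).
have rt := r0 _ tt; have i0 : 0 < t%:R^-1 :> R by rewrite invr_gt0; lra.
have i1 : t%:R * t%:R^-1 = 1 :> R by rewrite divff// gt_eqF//; lra.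
have h := rr _ tt.
apply: (@le_trans _ _ (K * ((1 - t%:R^-1) * r t))); last by rewrite ler_wpM2l.
apply: (@le_trans _ _ ((1 - 3 / 2 / t%:R) * (K * r t) + C * (r t / t%:R))).
  rewrite lerD2r ler_wpM2l//; nra.
have KC : 2 * C <= K.
  by rewrite /K lerDl mulr_ge0 ?x0// invr_ge0 ltW// r0.
have : 0 <= (K / 2 - C) * (r t / t%:R).
  by rewrite mulr_ge0//; [lra|rewrite mulr_ge0// ltW].
nra.
Qed.

Lemma cube_between t : (0 < t)%N ->
  exists k, [/\ (0 < k)%N, (k ^ 3 <= t)%N & (t < k.+1 ^ 3)%N].
Proof.
elim: t => // -[_ _|t IH _]; first by exists 1%N.
have [//|k [k0 kt tk]] := IH.
have [h|h] := ltnP t.+2 (k.+1 ^ 3).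
  by exists k; split => //; exact: leq_trans kt _.
exists k.+1; split => //.
by apply: (leq_ltn_trans tk); rewrite ltn_exp2r.
Qed.

(* Between consecutive cubes there are at most [7 k^2] steps, each of size
   [o(k^-2)]. *)
Lemma cvg0_along_cubes (v : nat -> R) :
  (forall t, 0 <= v t) ->
  (forall e, 0 < e -> \forall t \near \oo, forall k, (0 < k)%N ->
     (k ^ 3 <= t)%N -> v t.+1 <= v t + e / k%:R ^+ 2) ->
  v (k ^ 3)%N @[k --> \oo] --> 0 -> v t @[t --> \oo] --> 0.
Proof.
move=> v0 vinc vcube; apply/cvgrPdist_le => e e0.
(* One half of [e] is for the value at the cube, the other is spread over at most [(k + 1)^3 - k^3 =
   3 k^2 + 3 k + 1 <= 7 k^2] steps. *)
have e16 : 0 < e / 14 by rewrite divr_gt0.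
have [t0 _ ht0] := vinc _ e16.
have [k0 _ hk0] : \forall k \near \oo, v (k ^ 3)%N <= e / 2.
  have e2 : 0 < e / 2 by rewrite divr_gt0.
  move/cvgrPdist_le : vcube => /(_ _ e2); apply: filterS => k.
  by rewrite sub0r normrN ger0_norm.
pose k1 := maxn 1 (maxn t0 k0).
exists (k1 ^ 3)%N => // t /= k1t.
have t_gt0 : (0 < t)%N by apply: leq_trans k1t; rewrite expn_gt0 leq_max.
have [k [kk kt tk]] := cube_between t_gt0.
have k1k : (k1 <= k)%N.
  by rewrite -ltnS -(ltn_exp2r _ _ (e := 3))//; exact: leq_ltn_trans k1t tk.
rewrite sub0r normrN ger0_norm//.
have kt0 : (t0 <= k ^ 3)%N.
  apply: (@leq_trans k); last by rewrite -{1}(expn1 k) leq_pexp2l.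
  by apply: leq_trans k1k; rewrite /k1 !leq_max leqnn orbT.
have kk0 : (k0 <= k)%N.
  by apply: leq_trans k1k; rewrite /k1 !leq_max leqnn !orbT.
have step i : v (k ^ 3 + i)%N <= e / 2 + i%:R * (e / 14 / k%:R ^+ 2).
  elim: i => [|i IH]; first by rewrite addn0 mul0r addr0; exact: hk0.
  rewrite addnS; apply: le_trans (ht0 (k ^ 3 + i)%N _ k kk _) _.
  - by rewrite /= (leq_trans kt0)// leq_addr.
  - exact: leq_addr.
  - by rewrite -[i.+1]addn1 natrD mulrDl mul1r addrA lerD2r.
have := step (t - k ^ 3)%N; rewrite subnKC// => /le_trans; apply.
have kR : 0 < k%:R ^+ 2 :> R by rewrite exprn_gt0// ltr0n.
have nk : (t - k ^ 3 <= 7 * k ^ 2)%N.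
  rewrite leq_subLR -ltnS; apply: (leq_trans tk).
  rewrite -addn1 !expnS !expn0; nia.
have : (t - k ^ 3)%:R * (e / 14 / k%:R ^+ 2) <= 7 * k%:R ^+ 2 * (e / 14 / k%:R ^+ 2).
  rewrite ler_wpM2r ?mulr_ge0 ?invr_ge0 ?(ltW kR) ?(ltW e0)//.
  by rewrite -natrX -natrM ler_nat.
have -> : 7 * k%:R ^+ 2 * (e / 14 / k%:R ^+ 2) = e / 2 :> R.
  by field; rewrite gt_eqF// ltr0n.
lra.
Qed.

End recursions.

(** The series of the [X k] has mean at most [b 0], since the bounds telescope and [b] is
    nonnegative. It is thus almost surely finite, and its terms tend to 0 because its tails do. *)
Lemma ae_cvg0_of_telescoping_means d (T : measurableType d) (R : realType)
    (P : probability T R) (X : nat -> T -> R) (b : nat -> R) :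
  (forall k, measurable_fun setT (X k)) -> (forall k w, 0 <= X k w) ->
  (forall k, 0 <= b k) ->
  (forall k, \int[P]_w (X k w)%:E <= (b k - b k.+1)%:E)%E ->
  {ae P, forall w, X k w @[k --> \oo] --> 0}.
Proof.
move=> mX X0 b0 Xb.
have mXE k : measurable_fun setT (EFin \o X k) by apply/measurable_EFinP.
have sumX : (\int[P]_w (\sum_(0 <= k <oo) (X k w)%:E) <= (b 0%N)%:E)%E.
  rewrite integral_nneseries//; last by move=> k w _; rewrite lee_fin; exact: X0.
  apply: lime_le; first by apply: is_cvg_nneseries => k _ _; apply: integral_ge0 => w _;
    rewrite lee_fin; exact: X0.
  apply: nearW => n; apply: (@le_trans _ _ (\sum_(0 <= k < n) (b k - b k.+1))%:E).
    by rewrite -sumEFin; apply: lee_sum.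
  rewrite lee_fin; suff -> : \sum_(0 <= k < n) (b k - b k.+1) = b 0%N - b n.
    by rewrite gerBl.
  elim: n => [|n IH]; first by rewrite big_nil subrr.
  by rewrite big_nat_recr//= IH addrA subrK.
have int_sum : P.-integrable setT (fun w => \sum_(0 <= k <oo) (X k w)%:E)%E.
  apply/integrableP; split.
    have : measurable_fun setT (fun w => \sum_(0 <= k <oo) (X k w)%:E)%E.
      by apply: ge0_emeasurable_sum => [k w _ _|k _]; [rewrite lee_fin|exact: mXE].
    exact.
  under eq_integral => w _.
    rewrite gee0_abs; first over.
    by apply: nneseries_ge0 => k _ _; rewrite lee_fin.
  exact: le_lt_trans sumX (ltry _).
apply: filterS (integrable_ae measurableT int_sum) => w /(_ I) fin.
have sum_lt : (\sum_(0 <= k <oo) (X k w)%:E < +oo)%E by rewrite ltey_eq fin.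
have /fine_cvgP[tail_fin tail0] : (\sum_(n <= k <oo) (X k w)%:E)%E @[n --> \oo] --> 0%:E.
  by apply: nneseries_tail_cvg => // k _; rewrite lee_fin.
apply: (squeeze_cvgr _ (cvg_cst 0) tail0).
near=> n; rewrite X0/= -lee_fin fineK; last by near: n.
have -> : (X n w)%:E = (\sum_(n <= k < n.+1) (X k w)%:E)%E by rewrite big_nat1.
by apply: nneseries_lim_ge => k _ _; rewrite lee_fin; exact: X0.
Unshelve. all: by end_near.
Qed.

(** * One step of the algorithm *)

Lemma edot_pair {R : realType} {m n : nat} (x y : 'M[R]_(m, n)) :
  edot x y = \sum_(p : 'I_m * 'I_n) x p.1 p.2 * y p.1 p.2.
Proof. by rewrite /edot pair_big. Qed.

Section one_step.
Context {R : realType} {N d : nat}.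
Variables (A : 'I_N -> set 'rV[R]_d) (J : 'I_N -> 'M[R]_(N, d) -> R).
Variables (nu rho a K : R) (astar : 'M[R]_(N, d)) (j : oracle).
Hypotheses (A_convex : forall i, convex_set (A i))
  (A_compact : forall i, compact (A i)) (Aastar : joint_action_set A astar)
  (nu_gt0 : 0 < nu) (stable : strongly_variationally_stable A J nu astar)
  (A_rho : forall x, joint_action_set A x -> `|x| <= rho) (K0 : 0 <= K).
Hypothesis hK : forall p mu s z, `|mu| <= rho -> 0 < s <= a ->
  [/\ `|grad_estimate j J s mu (mu + s *: z) p.1 p.2|
        <= K * estimate_scale j s * noise_weight z,
      `|grad_estimate j J s mu (mu + s *: z) p.1 p.2 -
         (frozen_cost j J s mu z p / s * z p.1 p.2 +
          pseudo_gradient J mu p.1 p.2 * z p.1 p.2 ^+ 2)| <= K * s * noise_weight z,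
      `|frozen_cost j J s mu z p| <= K * noise_weight z &
      `|pseudo_gradient J mu p.1 p.2| <= K].

Variables (g s : R) (mu mu' z : 'M[R]_(N, d)).
Hypotheses (g0 : 0 < g) (sa : 0 < s <= a) (Amu : joint_action_set A mu).
Let m := grad_estimate j J s mu (mu + s *: z).
Hypothesis step : forall i, row i mu' = Defs.proj (A i) (row i mu - g *: row i m).

Let V := edot (mu - astar) (mu - astar).
Let V' := edot (mu' - astar) (mu' - astar).
Let h := noise_weight z.
Let q := estimate_scale j s.

Lemma step_in_action_set : joint_action_set A mu'.
Proof.
by move=> i; rewrite step; apply: (projP _ _ _).1 => //; exists (row i astar); exact: Aastar.
Qed.

Let step_le : V' <= \sum_(p : 'I_N * 'I_d)
  ((mu - astar) p.1 p.2 - g * m p.1 p.2) ^+ 2.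
Proof.
rewrite /V' edot_rows.
have -> : \sum_(p : 'I_N * 'I_d) ((mu - astar) p.1 p.2 - g * m p.1 p.2) ^+ 2 =
    edot (mu - g *: m - astar) (mu - g *: m - astar).
  by rewrite edot_pair; apply: eq_bigr => p _; rewrite !mxE; ring.
rewrite [leRHS]edot_rows; apply: ler_sum => i _.
have E (x y : 'M[R]_(N, d)) : row i (x - y) = row i x - row i y by exact: raddfB.
have EZ : row i (g *: m) = g *: row i m by exact: linearZ.
rewrite !E EZ step; apply: proj_le => //.
by exists (row i astar); exact: Aastar.
Qed.

(* The first term of each summand is odd in [z p] given the other coordinates,
   and [z p ^+ 2 - 1] has mean 0: in expectation the sum vanishes. *)
Lemma one_step_drift : V' <= (1 - 3 / 2 * (nu * g)) * V +
  \sum_(p : 'I_N * 'I_d)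
    ((- 2 * g * (mu - astar) p.1 p.2 * frozen_cost j J s mu z p / s) * z p.1 p.2 +
     (- 2 * g * (mu - astar) p.1 p.2 * pseudo_gradient J mu p.1 p.2) *
       (z p.1 p.2 ^+ 2 - 1)) +
  (N * d)%:R * (2 / nu * K ^+ 2 * (g * s ^+ 2) + K ^+ 2 * (g ^+ 2 * q ^+ 2)) * h ^+ 2.
Proof.
have /andP[s0 _] := sa.
have mur := A_rho Amu.
have VE : V = \sum_(p : 'I_N * 'I_d) (mu - astar) p.1 p.2 ^+ 2.
  by rewrite /V edot_pair; apply: eq_bigr => p _; rewrite expr2.
have ME := stable Amu; rewrite sqr_enorm -/V edot_pair in ME.
apply: (le_trans step_le).
(* Stability will turn the inner product into [- 2 * nu * g * V]; the term [nu * g / 2 * V] comes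
   from Young's inequality, and 3/2 is the difference. *)
apply: (@le_trans _ _ (V - 2 * g * (\sum_(p : 'I_N * 'I_d)
   pseudo_gradient J mu p.1 p.2 * (mu - astar) p.1 p.2) + nu * g / 2 * V +
  \sum_(p : 'I_N * 'I_d)
    ((- 2 * g * (mu - astar) p.1 p.2 * frozen_cost j J s mu z p / s) * z p.1 p.2 +
     (- 2 * g * (mu - astar) p.1 p.2 * pseudo_gradient J mu p.1 p.2) *
       (z p.1 p.2 ^+ 2 - 1)) +
  (N * d)%:R * (2 / nu * K ^+ 2 * (g * s ^+ 2) + K ^+ 2 * (g ^+ 2 * q ^+ 2)) * h ^+ 2)).
  have -> : (N * d)%:R * (2 / nu * K ^+ 2 * (g * s ^+ 2) + K ^+ 2 * (g ^+ 2 * q ^+ 2))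
       * h ^+ 2 =
     \sum_(p : 'I_N * 'I_d)
       (2 / nu * K ^+ 2 * (g * s ^+ 2) + K ^+ 2 * (g ^+ 2 * q ^+ 2)) * h ^+ 2.
    by rewrite -[LHS]mulrA sumr_const card_prod !card_ord mulr_natl.
  rewrite VE !mulr_sumr -sumrB -!big_split/=; apply: ler_sum => p _.
  have [h1 h2 _ _] := hK p z mur sa; rewrite -/m -/h -/q in h1 h2.
  set w := (mu - astar) p.1 p.2; set mp := m p.1 p.2 in h1 h2 *.
  set F := frozen_cost j J s mu z p in h2 *.
  set M := pseudo_gradient J mu p.1 p.2 in h2 *; set zp := z p.1 p.2 in h2 *.
  set r := mp - _ in h2.
  have r2 : r ^+ 2 <= (K * s * h) ^+ 2.
    by rewrite -real_normK ?num_real// lerXn2r// nnegrE (le_trans _ h2).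
  have m2 : mp ^+ 2 <= (K * q * h) ^+ 2.
    by rewrite -real_normK ?num_real// lerXn2r// nnegrE (le_trans _ h1).
  (* The weights are those of a perfect square, so that the remainder costs [r ^+ 2], of order
     [s ^+ 2]. *)
  have young : - 2 * g * w * r <= nu * g / 2 * w ^+ 2 + g * (2 / nu) * r ^+ 2.
    rewrite -subr_ge0.
    have -> : nu * g / 2 * w ^+ 2 + g * (2 / nu) * r ^+ 2 - - 2 * g * w * r =
       g * (nu / 2) * (w + 2 / nu * r) ^+ 2 by field; rewrite gt_eqF.
    by rewrite mulr_ge0 ?sqr_ge0// mulr_ge0// ltW// divr_gt0.
  have mE : mp = F / s * zp + M * zp ^+ 2 + r by rewrite /r; ring.
  have r2' : g * (2 / nu) * r ^+ 2 <= g * (2 / nu) * (K * s * h) ^+ 2.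
    by rewrite ler_wpM2l// mulr_ge0// ltW// divr_gt0.
  have m2' : g ^+ 2 * mp ^+ 2 <= g ^+ 2 * (K * q * h) ^+ 2.
    by rewrite ler_wpM2l// sqr_ge0.
  have -> : (w - g * mp) ^+ 2 = w ^+ 2 - 2 * g * w * mp + g ^+ 2 * mp ^+ 2 by ring.
  have -> : 2 * g * w * mp = 2 * g * w * (F / s * zp + M * zp ^+ 2) + 2 * g * w * r.
    by rewrite {1}mE; ring.
  rewrite !exprMn in r2' m2'.
  (* Writing [zp ^+ 2 = 1 + (zp ^+ 2 - 1)] extracts the exact partial derivative and leaves only
     centred terms. *)
  have e1 : 2 * g * w * (F / s * zp + M * zp ^+ 2) =
     2 * g * (M * w) - (- 2 * g * w * F / s * zp + - 2 * g * w * M * (zp ^+ 2 - 1)).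
    by field; rewrite gt_eqF.
  rewrite e1.
  have -> : (2 / nu * K ^+ 2 * (g * s ^+ 2) + K ^+ 2 * (g ^+ 2 * q ^+ 2)) * h ^+ 2 =
    g * (2 / nu) * (K ^+ 2 * s ^+ 2 * h ^+ 2) + g ^+ 2 * (K ^+ 2 * q ^+ 2 * h ^+ 2) by ring.
  lra.
rewrite !lerD2r.
have := ler_wpM2l (ltW g0) ME; lra.
Qed.

(** A pathwise bound, for use between cubes: the coordinates of [mu - astar] are at most [2 * rho],
    which gives the coefficient [4 * rho * K] of the cross term. *)
Lemma one_step_increment : V' <= V +
  (N * d)%:R * (4 * rho * K * (g * q * h) + K ^+ 2 * (g * q * h) ^+ 2).
Proof.
have mur := A_rho Amu.
have VE : V = \sum_(p : 'I_N * 'I_d) (mu - astar) p.1 p.2 ^+ 2.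
  by rewrite /V edot_pair; apply: eq_bigr => p _; rewrite expr2.
apply: (le_trans step_le).
have -> : (N * d)%:R * (4 * rho * K * (g * q * h) + K ^+ 2 * (g * q * h) ^+ 2) =
   \sum_(p : 'I_N * 'I_d) (4 * rho * K * (g * q * h) + K ^+ 2 * (g * q * h) ^+ 2).
  by rewrite sumr_const card_prod !card_ord mulr_natl.
rewrite VE -big_split/=; apply: ler_sum => p _.
have [h1 _ _ _] := hK p z mur sa; rewrite -/m -/h -/q in h1.
set mp := m p.1 p.2 in h1 *; set w := (mu - astar) p.1 p.2.
have wr : `|w| <= 2 * rho.
  rewrite (le_trans (coord_le_norm _ _ _))// (le_trans (ler_normB _ _))//.
  by have := A_rho Aastar; lra.
have -> : (w - g * mp) ^+ 2 = w ^+ 2 - 2 * (g * (w * mp)) + (g * mp) ^+ 2 by ring.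
have gm : `|g * mp| <= K * (g * q * h).
  rewrite normrM gtr0_norm//.
  have -> : K * (g * q * h) = g * (K * q * h) by ring.
  by rewrite ler_pM2l.
have gm2 : (g * mp) ^+ 2 <= K ^+ 2 * (g * q * h) ^+ 2.
  rewrite -exprMn -real_normK ?num_real// lerXn2r// nnegrE//.
  exact: le_trans gm.
have : `|w * (g * mp)| <= 2 * rho * (K * (g * q * h)) by rewrite normrM; apply: ler_pM.
rewrite ler_norml => /andP[h3 _].
have -> : g * (w * mp) = w * (g * mp) by ring.
lra.
Qed.

End one_step.

(** * Exponential weights of the noise *)

Definition big_weight {R : realType} {N d : nat} (z : 'M[R]_(N, d)) : R :=
  expR (`|z| ^+ 2 / 4).

Section weights.
Context {R : realType} {N d : nat}.
Implicit Types z : 'M[R]_(N, d).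

Lemma big_weight_ge1 z : 1 <= big_weight z.
Proof. by rewrite -expR0 ler_expR divr_ge0 ?sqr_ge0. Qed.

Lemma noise_weight_ge1 z : 1 <= noise_weight z.
Proof. by rewrite -expR0 ler_expR divr_ge0 ?sqr_ge0. Qed.

Lemma noise_weightX24 z : noise_weight z ^+ 24 = big_weight z.
Proof.
by rewrite /noise_weight -expRM_natl /big_weight; congr expR; field.
Qed.

Lemma sqr_noise_weight_le z : noise_weight z ^+ 2 <= big_weight z.
Proof.
by rewrite -noise_weightX24; apply: ler_weXn2l => //; exact: noise_weight_ge1.
Qed.

Lemma coord_le_noise_weight z i k : `|z i k| <= 97 * noise_weight z.
Proof.
apply: le_trans (coord_le_norm _ _ _) _.
have e0 : 0 < 96^-1 :> R by rewrite invr_gt0 ltr0n.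
have := le_exp_sqr `|z| e0.
by rewrite invrK (mulrC 96^-1) (_ : 1 + 96 = 97 :> R); [exact|ring].
Qed.

Lemma sqr_coord_le_noise_weight z i k : z i k ^+ 2 <= 97 * noise_weight z.
Proof.
apply: (@le_trans _ _ (`|z| ^+ 2)).
  by rewrite -real_normK ?num_real// lerXn2r ?nnegrE// coord_le_norm.
have e0 : 0 < 96^-1 :> R by rewrite invr_gt0 ltr0n.
have := sqr_le_exp_sqr `|z| e0.
by rewrite invrK (mulrC 96^-1) (_ : 1 + 96 = 97 :> R); [exact|ring].
Qed.

(** The sup norm is attained at a single entry, so one-dimensional Gaussian integrals suffice to
    bound the mean of the weight. *)
Lemma big_weight_le_sum z :
  big_weight z <= 1 + \sum_(p : 'I_N * 'I_d) expR (z p.1 p.2 ^+ 2 / 4).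
Proof.
have S0 : 0 <= \sum_(p : 'I_N * 'I_d) expR (z p.1 p.2 ^+ 2 / 4).
  by apply: sumr_ge0 => p _; exact: expR_ge0.
have [z0|/mx_norm_neq0[p zp]] := eqVneq (mx_norm z) 0.
  rewrite /big_weight [`|z|]z0 expr0n mul0r expR0; lra.
rewrite /big_weight [`|z|]zp real_normK ?num_real//.
rewrite (bigD1 p)//= addrCA lerDl addr_ge0//.
by apply: sumr_ge0 => l _; exact: expR_ge0.
Qed.

Lemma continuous_big_weight : continuous (@big_weight R N d).
Proof.
have c : continuous (fun t : R => expR (t ^+ 2 / 4)).
  move=> t; apply: (@continuous_comp _ _ _ (fun t : R => t ^+ 2 / 4) expR).
    by apply: cvgM; [exact: exprn_continuous|exact: cvg_cst].
  exact: continuous_expR.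
by move=> z; apply: (continuous_comp (@norm_continuous _ _ z) (c `|z|)).
Qed.

End weights.

(** * Mean of one step *)

Section expectations.
Context {R : realType} {N d : nat} {dT : measure_display} {T : measurableType dT}.
Variables (P : probability T R) (G : set_system T) (mu xi : T -> 'M[R]_(N, d)) (s : R).
Hypotheses (s0 : 0 < s) (GP : <<s G >> `<=` measurable).
Let coord (X : T -> 'M[R]_(N, d)) (p : 'I_N * 'I_d) w := X w p.1 p.2.
Hypothesis mm : forall p,
  measurable_fun setT (coord mu p : g_sigma_algebraType G -> R).
Hypothesis mx : forall p, measurable_fun setT (coord xi p).
Hypothesis law : forall E, <<s G >> E ->
  forall B : 'I_N * 'I_d -> set R, (forall p, measurable (B p)) ->
  P (E `&` [set w | forall p, B p (coord xi p w)]) =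
  (\int[P]_(w in E) (\prod_p fine (normal_prob (coord mu p w) s (B p)))%:E)%E.

Definition noise w : 'M[R]_(N, d) := s^-1 *: (xi w - mu w).

Let noiseE w p : noise w p.1 p.2 = standardized (coord mu) (coord xi) s p w.
Proof. by rewrite /noise !mxE /standardized mulrC. Qed.

Lemma query_noise w : xi w = mu w + s *: noise w.
Proof. by rewrite /noise scalerA divff ?gt_eqF// scale1r addrC subrK. Qed.

Lemma measurable_mu p : measurable_fun [set: T] (coord mu p).
Proof. by move=> _ B mB; apply: GP; exact: mm. Qed.

Lemma measurable_noise p : measurable_fun [set: T] (fun w => noise w p.1 p.2).
Proof.
rewrite (_ : (fun w => _) = standardized (coord mu) (coord xi) s p).
  exact: (measurable_standardized s GP mm mx).
by apply/funext => w; rewrite noiseE.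
Qed.

Lemma measurable_big_weight : measurable_fun [set: T] (fun w => big_weight (noise w)).
Proof.
apply: measurable_continuous_matrix; last exact: continuous_big_weight.
by move=> i k; exact: (measurable_noise (i, k)).
Qed.

Definition weight_moment : R := 1 + (N * d)%:R * Num.sqrt 2.

Lemma weight_moment_le :
  (\int[P]_w (big_weight (noise w))%:E <= weight_moment%:E)%E.
Proof.
have mE p : measurable_fun [set: T] (fun w => expR (noise w p.1 p.2 ^+ 2 / 4)).
  apply: measurableT_comp => //; apply: measurable_funM => //.
  by apply: measurable_funX; exact: measurable_noise.
apply: (@le_trans _ _ (\int[P]_w (1%:E + \sum_(p : 'I_N * 'I_d)
    (expR (noise w p.1 p.2 ^+ 2 / 4))%:E)%E)%E).
  apply: ge0_le_integral => //.
  - by move=> w _; rewrite lee_fin expR_ge0.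
  - by apply/measurable_EFinP; exact: measurable_big_weight.
  - apply: emeasurable_funD => //; apply: emeasurable_sum => p.
    by apply/measurable_EFinP; exact: mE.
  - by move=> w _; rewrite sumEFin -EFinD lee_fin; exact: big_weight_le_sum.
rewrite ge0_integralD//=; last 2 first.
- by move=> w _; apply: sume_ge0 => p _; rewrite lee_fin expR_ge0.
- by apply: emeasurable_sum => p; apply/measurable_EFinP; exact: mE.
rewrite integral_cst//= (@probability_setT _ _ _ P) mule1 /weight_moment EFinD leeD2l//.
rewrite ge0_integral_sum//; last first.
  by move=> p; apply/measurable_EFinP; exact: mE.
rewrite (eq_bigr (fun=> (Num.sqrt 2)%:E)).
  by rewrite sumEFin sumr_const card_prod !card_ord mulr_natl.
move=> p _; rewrite -normal_exp_square_quarter.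
rewrite -(ge0_integral_standardized s0 GP mm mx law p (f := fun y => (expR (y ^+ 2 / 4))%:E)).
- by apply: eq_integral => w _; rewrite noiseE.
- by move=> y; rewrite lee_fin expR_ge0.
- apply/measurable_EFinP; apply: measurableT_comp => //.
  by apply: measurable_funM => //; exact: measurable_funX.
Qed.

Lemma integrable_big_weight :
  P.-integrable setT (fun w => (big_weight (noise w))%:E).
Proof.
apply/integrableP; split.
  by apply/measurable_EFinP; exact: measurable_big_weight.
under eq_integral do rewrite gee0_abs ?lee_fin ?expR_ge0//.
exact: le_lt_trans weight_moment_le (ltry _).
Qed.

Lemma integrable_dominated (f : T -> R) (c : R) : measurable_fun setT f ->
  (forall w, `|f w| <= c * big_weight (noise w)) -> P.-integrable setT (EFin \o f).
Proof.
move=> mf fc; apply: (@le_integrable _ _ _ P _ measurableT _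
    (fun w => c%:E * (big_weight (noise w))%:E)%E).
- exact/measurable_EFinP.
- by move=> w _; rewrite -EFinM /= lee_fin (le_trans (fc w))// ler_norm.
- by apply: integrableZl => //; exact: integrable_big_weight.
Qed.

(** At entry [p] the noise is frozen and only the state, known from the past, remains; every other
    entry involves a standardized coordinate that generates the sigma-algebra. *)
Lemma measurable_frozen_query p i k :
  measurable_fun setT (fun w : g_sigma_algebraType (other_coordinates G
      (coord mu) (coord xi) s p) => (mu w + s *: zero_coord p (noise w)) i k).
Proof.
have mmu : measurable_fun setT (fun w : g_sigma_algebraType (other_coordinates G
      (coord mu) (coord xi) s p) => mu w i k).
  exact: (@measurable_past_other _ T R _ G (coord mu) (coord xi) s mm p (i, k)).
case: (eqVneq (i, k) p) => [ikp|ikp].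
  by under eq_fun do rewrite !mxE ikp eqxx mulr0 addr0.
rewrite (_ : (fun w => _) = (fun w => mu w i k +
    s * standardized (coord mu) (coord xi) s (i, k) w)).
  apply: measurable_funD => //; apply: measurable_funM => //.
  exact: (@measurable_standardized_other _ T R _ G (coord mu) (coord xi) s p (i, k)).
by apply/funext => w; rewrite [LHS]mxE [X in _ + X]mxE mxE (negbTE ikp) -noiseE.
Qed.

Section one_step_mean.
Variables (A : 'I_N -> set 'rV[R]_d) (J : 'I_N -> 'M[R]_(N, d) -> R).
Variables (nu rho a K g : R) (astar : 'M[R]_(N, d)) (j : oracle).
Variable mu' : T -> 'M[R]_(N, d).
Hypotheses (A_convex : forall i, convex_set (A i))
  (A_compact : forall i, compact (A i)) (Aastar : joint_action_set A astar)
  (nu_gt0 : 0 < nu) (stable : strongly_variationally_stable A J nu astar)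
  (A_rho : forall x, joint_action_set A x -> `|x| <= rho) (K0 : 0 <= K).
Hypothesis hK : forall p mu s z, `|mu| <= rho -> 0 < s <= a ->
  [/\ `|grad_estimate j J s mu (mu + s *: z) p.1 p.2|
        <= K * estimate_scale j s * noise_weight z,
      `|grad_estimate j J s mu (mu + s *: z) p.1 p.2 -
         (frozen_cost j J s mu z p / s * z p.1 p.2 +
          pseudo_gradient J mu p.1 p.2 * z p.1 p.2 ^+ 2)| <= K * s * noise_weight z,
      `|frozen_cost j J s mu z p| <= K * noise_weight z &
      `|pseudo_gradient J mu p.1 p.2| <= K].
Hypotheses (cJ : forall i, continuous (J i))
  (cM : forall p : 'I_N * 'I_d, continuous (fun x => pseudo_gradient J x p.1 p.2)).
Hypotheses (g0 : 0 < g) (sa : s <= a) (Amu : forall w, joint_action_set A (mu w)).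
Hypothesis step : forall w i, row i (mu' w) =
  Defs.proj (A i) (row i (mu w) - g *: row i (grad_estimate j J s (mu w) (xi w))).
Hypothesis mmu' : forall i k, measurable_fun setT (fun w => mu' w i k).

Let sq_dist x := edot (x - astar) (x - astar).

Lemma sq_dist_le x : joint_action_set A x ->
  sq_dist x <= (N * d)%:R * (2 * rho) ^+ 2.
Proof.
move=> Ax; rewrite (le_trans (edot_le_norm _))// ler_wpM2l//.
rewrite lerXn2r ?nnegrE//.
  by have := A_rho Ax; have := normr_ge0 x; lra.
by rewrite (le_trans (ler_normB _ _))//; have := A_rho Ax; have := A_rho Aastar; lra.
Qed.

Lemma continuous_sq_dist : continuous sq_dist.
Proof.
have -> : sq_dist = (fun x => edot (astar - x) (astar - x)).
  apply/funext => x; rewrite /sq_dist -[x - astar]opprB -scaleN1r edotZl edotZr.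
  by rewrite mulrA mulrNN !mulr1 mul1r.
exact: continuous_edotB.
Qed.

Lemma measurable_sq_dist (X : T -> 'M[R]_(N, d)) :
  (forall i k, measurable_fun setT (fun w => X w i k)) ->
  measurable_fun setT (fun w => sq_dist (X w)).
Proof.
by move=> mX; apply: measurable_continuous_matrix => //; exact: continuous_sq_dist.
Qed.

Lemma integrable_sq_dist (X : T -> 'M[R]_(N, d)) :
  (forall i k, measurable_fun setT (fun w => X w i k)) ->
  (forall w, joint_action_set A (X w)) ->
  P.-integrable setT (fun w => (sq_dist (X w))%:E).
Proof.
move=> mX AX.
apply: (@integrable_dominated (fun w => sq_dist (X w)) ((N * d)%:R * (2 * rho) ^+ 2)).
  exact: measurable_sq_dist.
move=> w; rewrite ger0_norm ?edot_ge0//.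
have B0 : 0 <= (N * d)%:R * (2 * rho) ^+ 2 :> R by rewrite mulr_ge0 ?sqr_ge0.
apply: (le_trans (sq_dist_le (AX w))); rewrite ler_peMr//.
exact: big_weight_ge1.
Qed.

(** With [drift], the coefficients of [z_p] and [z_p ^+ 2 - 1] in [one_step_drift]; neither involves
    [z_p]. *)
Let bias p w := - 2 * g * (mu w - astar) p.1 p.2 *
  frozen_cost j J s (mu w) (noise w) p / s.
Let drift (p : 'I_N * 'I_d) w := - 2 * g * (mu w - astar) p.1 p.2 *
  pseudo_gradient J (mu w) p.1 p.2.

Let coord_le p w : `|(mu w - astar) p.1 p.2| <= 2 * rho.
Proof.
rewrite (le_trans (coord_le_norm _ _ _))// (le_trans (ler_normB _ _))//.
by have := A_rho Aastar; have := A_rho (Amu w); lra.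
Qed.

Let sa' : 0 < s <= a. Proof. by rewrite s0. Qed.

Let measurable_bias p : measurable_fun setT (bias p :
  g_sigma_algebraType (other_coordinates G (coord mu) (coord xi) s p) -> R).
Proof.
have mmu := fun q => @measurable_past_other _ T R _ G (coord mu) (coord xi) s mm p q.
apply: measurable_funM => //; apply: measurable_funM.
  apply: measurable_funM => //; under eq_fun do rewrite !mxE.
  by apply: measurable_funB => //; exact: mmu.
apply: measurable_funB.
  apply: measurable_continuous_matrix; last exact: cJ.
  exact: measurable_frozen_query.
case: (j) => //; apply: measurable_continuous_matrix; last exact: cJ.
by move=> i k; exact: (mmu (i, k)).
Qed.

Let measurable_drift p : measurable_fun setT (drift p :
  g_sigma_algebraType (other_coordinates G (coord mu) (coord xi) s p) -> R).
Proof.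
have mmu := fun q => @measurable_past_other _ T R _ G (coord mu) (coord xi) s mm p q.
apply: measurable_funM.
  apply: measurable_funM => //; under eq_fun do rewrite !mxE.
  by apply: measurable_funB => //; exact: mmu.
have mmuik i k := mmu (i, k).
exact: (measurable_continuous_matrix mmuik (@cM p)).
Qed.

Let integrable_bias p :
  P.-integrable setT (fun w => (bias p w * standardized (coord mu) (coord xi) s p w)%:E).
Proof.
pose c := 2 * g * (2 * rho) * K / s * 97.
have mB : measurable_fun [set: T] (bias p).
  move=> _ B mB; apply: (sigma_measurable (other_coordinates_measurable GP mm mx (p0 := p))).
  exact: measurable_bias.
apply: (@integrable_dominated (fun w => bias p w * standardized (coord mu) (coord xi) s p w) c).
  by apply: measurable_funM => //; exact: (measurable_standardized s GP mm mx).
move=> w; rewrite -noiseE; set z := noise w.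
have [_ _ h3 _] := hK p z (A_rho (Amu w)) sa'.
have h1 := coord_le p w; have hz := coord_le_noise_weight z p.1 p.2.
have h0 : 0 <= noise_weight z by exact: expR_ge0.
have si0 : 0 < s^-1 by rewrite invr_gt0.
apply: (@le_trans _ _ (c * noise_weight z ^+ 2)); last first.
  apply: ler_wpM2l (sqr_noise_weight_le z).
  have r0 : 0 <= 2 * rho by apply: le_trans h1.
  rewrite /c; move: (2 * rho) r0 => r r0.
  by repeat apply: mulr_ge0 => //; exact: ltW.
have -> : c * noise_weight z ^+ 2 =
  2 * g * ((2 * rho) * (K * noise_weight z)) / s * (97 * noise_weight z).
  by rewrite /c; field; rewrite gt_eqF.
rewrite normrM; apply: ler_pM => //.
rewrite /bias -/z normrM (gtr0_norm si0) ler_pM2r//.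
rewrite -mulrA normrM mulNr normrN (ger0_norm (mulr_ge0 _ (ltW g0)))//.
by rewrite ler_pM2l ?mulr_gt0// normrM; apply: ler_pM.
Qed.

Let integrable_drift p :
  P.-integrable setT (fun w => (drift p w *
    (standardized (coord mu) (coord xi) s p w ^+ 2 - 1))%:E).
Proof.
pose c := 2 * g * (2 * rho) * K * 98.
have mB : measurable_fun [set: T] (drift p).
  move=> _ B mB; apply: (sigma_measurable (other_coordinates_measurable GP mm mx (p0 := p))).
  exact: measurable_drift.
apply: (@integrable_dominated (fun w => drift p w *
    (standardized (coord mu) (coord xi) s p w ^+ 2 - 1)) c).
  apply: measurable_funM => //; apply: measurable_funB => //; apply: measurable_funX.
  exact: (measurable_standardized s GP mm mx).
move=> w; rewrite -noiseE; set z := noise w.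
have [_ _ _ h4] := hK p z (A_rho (Amu w)) sa'.
have h1 := coord_le p w; have hz := sqr_coord_le_noise_weight z p.1 p.2.
have h0 : 1 <= noise_weight z by exact: noise_weight_ge1.
have hn : noise_weight z <= big_weight z.
  by apply: le_trans (sqr_noise_weight_le z); rewrite expr2 ler_peMl//; lra.
have -> : c * big_weight z = 2 * g * ((2 * rho) * K) * (98 * big_weight z).
  by rewrite /c; ring.
rewrite normrM; apply: ler_pM => //.
  rewrite /drift -mulrA normrM mulNr normrN (ger0_norm (mulr_ge0 _ (ltW g0)))//.
  by rewrite ler_pM2l ?mulr_gt0// normrM; apply: ler_pM.
have := sqr_ge0 (z p.1 p.2).
by rewrite ler_norml => z2; apply/andP; split; lra.
Qed.

Let mean_bias p :
  (\int[P]_w (bias p w * standardized (coord mu) (coord xi) s p w)%:E = 0)%E.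
Proof.
apply: (@expectation_standardized0 _ T R P _ G _ _ s s0 GP mm mx law p (bias p) id).
- exact: measurable_bias.
- exact: measurable_id.
- exact: integrable_bias.
- exact: integrable_normal_id.
- exact: normal_mean.
Qed.

Let mean_drift p : (\int[P]_w (drift p w *
    (standardized (coord mu) (coord xi) s p w ^+ 2 - 1))%:E = 0)%E.
Proof.
have i1 : (normal_prob (0 : R) 1).-integrable setT (EFin \o cst (1 : R)).
  exact: finite_measure_integrable_cst.
apply: (@expectation_standardized0 _ T R P _ G _ _ s s0 GP mm mx law p (drift p)
  (fun y => y ^+ 2 - 1)).
- exact: measurable_drift.
- by apply: measurable_funB => //; exact: measurable_funX.
- exact: integrable_drift.
- exact: (integrableB measurableT integrable_normal_sqr i1).
- have E1 : (\int[normal_prob (0 : R) 1]_y (cst (1 : R) y)%:E = 1)%E.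
    transitivity (1%:E * normal_prob (0 : R) 1 setT)%E.
      exact: (@integral_cst _ _ R (normal_prob (0 : R) 1) _ measurableT 1%:E).
    by rewrite (@probability_setT _ _ _ (normal_prob 0 1)) mule1.
  transitivity (\int[normal_prob (0 : R) 1]_y (y ^+ 2)%:E -
      \int[normal_prob (0 : R) 1]_y (cst (1 : R) y)%:E)%E.
    exact: (integralB_EFin measurableT integrable_normal_sqr i1).
  by rewrite normal_second_moment E1 -EFinB subrr.
Qed.

(** The mean of [one_step_drift]: each centred term is integrable and has mean 0, and the squared
    weight is bounded through [big_weight]. *)
Lemma one_step_mean (v : R) : (\int[P]_w (sq_dist (mu w))%:E = v%:E)%E ->
  (\int[P]_w (sq_dist (mu' w))%:E <= ((1 - 3 / 2 * (nu * g)) * v +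
     (N * d)%:R * (2 / nu * K ^+ 2 * (g * s ^+ 2) +
       K ^+ 2 * (g ^+ 2 * estimate_scale j s ^+ 2)) * weight_moment)%:E)%E.
Proof.
move=> Ev; set B := (N * d)%:R * _.
have B0 : 0 <= B.
  have i2 : 0 <= 2 / nu by rewrite divr_ge0// ltW.
  have gs : 0 <= g * s ^+ 2 by rewrite mulr_ge0 ?sqr_ge0// ltW.
  have K2 := sqr_ge0 K.
  have gq : 0 <= g ^+ 2 * estimate_scale j s ^+ 2 by rewrite mulr_ge0 ?sqr_ge0.
  by apply: mulr_ge0 => //; apply: addr_ge0; apply: mulr_ge0 => //; apply: mulr_ge0.
have mmu i k : measurable_fun [set: T] (fun w => mu w i k) := measurable_mu (i, k).
pose u p w := ((bias p w * standardized (coord mu) (coord xi) s p w)%:E +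
  (drift p w * (standardized (coord mu) (coord xi) s p w ^+ 2 - 1))%:E)%E.
have iu p : P.-integrable setT (u p).
  by apply: integrableD; [by []|exact: integrable_bias|exact: integrable_drift].
have iV := integrable_sq_dist mmu Amu.
have Amu' w : joint_action_set A (mu' w).
  apply: (step_in_action_set A_compact Aastar (j := j) (J := J) (g := g) (s := s)
    (mu := mu w) (z := noise w)) => i.
  by rewrite step query_noise.
have iV' := integrable_sq_dist mmu' Amu'.
have iU : P.-integrable setT (fun w => \sum_(p : 'I_N * 'I_d) u p w)%E.
  exact: integrable_sum.
pose F w := ((1 - 3 / 2 * (nu * g))%:E * (sq_dist (mu w))%:E +
   (\sum_(p : 'I_N * 'I_d) u p w) + B%:E * (big_weight (noise w))%:E)%E.
have iZV : P.-integrable setT (fun w => (1 - 3 / 2 * (nu * g))%:E * (sq_dist (mu w))%:E)%E.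
  exact: integrableZl.
have iBW : P.-integrable setT (fun w => B%:E * (big_weight (noise w))%:E)%E.
  by apply: integrableZl => //; exact: integrable_big_weight.
have iZVU := integrableD measurableT iZV iU.
apply: (@le_trans _ _ (\int[P]_w F w)%E).
  apply: le_integral => //; first exact: integrableD.
  move=> w _; rewrite /F /u.
  under eq_bigr do rewrite -EFinD.
  rewrite sumEFin -!EFinM -!EFinD lee_fin.
  have step' i : row i (mu' w) = Defs.proj (A i) (row i (mu w) -
      g *: row i (grad_estimate j J s (mu w) (mu w + s *: noise w))).
    by rewrite step -query_noise.
  have := one_step_drift A_convex A_compact Aastar nu_gt0 stable A_rho hK g0 sa'
    (Amu w) step'.
  move=> /le_trans; apply; rewrite -/B.
  apply: lerD; last by rewrite ler_wpM2l// sqr_noise_weight_le.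
  rewrite lerD2l; apply: ler_sum => p _; rewrite -noiseE.
  by [].
rewrite /F integralD// integralD//.
rewrite integralZl// Ev integralZl//; last exact: integrable_big_weight.
rewrite integral_sum//.
rewrite big1 => [|p _]; last first.
  by rewrite /u integralD// mean_bias mean_drift adde0.
rewrite adde0 [leRHS]EFinD [X in (_ <= X + _)%E]EFinM leeD2l// [leRHS]EFinM.
by apply: lee_wpmul2l; [rewrite lee_fin|exact: weight_moment_le].
Qed.

End one_step_mean.

End expectations.

(** * Step sizes and convergence of a run *)

Section schedules.
Context {R : realType}.

(** The dependence of [mse_rate] on time alone. *)
Definition rate (j : oracle) (t : nat) : R :=
  if j is TwoPoint then t%:R^-1 else (t%:R `^ 2^-1)^-1.

Lemma powR_root (x : R) (m k : nat) : (0 < k)%N ->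
  (x `^ (k * m)%:R^-1) ^+ k = x `^ m%:R^-1.
Proof.
move=> k0; rewrite -powR_mulrn ?powR_ge0// -powRrM natrM invfM mulrAC.
by rewrite mulVf ?mul1r// pnatr_eq0 -lt0n.
Qed.

Lemma powR_ge1 (x b : R) : 1 <= x -> 0 <= b -> 1 <= x `^ b.
Proof.
by move=> x1 b0; rewrite -(powRr0 x) ler_powR.
Qed.

Lemma rootK (x : R) (n : nat) : 0 <= x -> (0 < n)%N -> (x `^ n%:R^-1) ^+ n = x.
Proof.
move=> x0 n0; rewrite -powR_mulrn ?powR_ge0// -powRrM mulVf ?powRr1//.
by rewrite pnatr_eq0 -lt0n.
Qed.

Lemma rate_gt0 j t : (0 < t)%N -> 0 < rate j t.
Proof. by move=> t0; case: j; rewrite /= invr_gt0 ?powR_gt0// ltr0n. Qed.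

Lemma rate_le_one_point j t : (0 < t)%N -> rate j t <= rate OnePoint t.
Proof.
move=> t0; case: j => //=; have t1 : 1 <= t%:R :> R by rewrite ler1n.
have h : 1 <= t%:R `^ 2^-1 :> R by apply: powR_ge1 => //; rewrite invr_ge0.
have E : t%:R = (t%:R `^ 2^-1) ^+ 2 :> R by rewrite (@rootK _ 2)// ler0n.
rewrite lef_pV2 ?posrE ?powR_gt0 ?ltr0n//.
by rewrite [leRHS]E expr2 ler_peMl//; lra.
Qed.

Lemma rate_succ j t : (0 < t)%N -> (1 - t%:R^-1) * rate j t <= rate j t.+1.
Proof.
move=> t0; have t1 : 1 <= t%:R :> R by rewrite ler1n.
have tS : t.+1%:R = t%:R + 1 :> R by rewrite -natr1.
case: j => /=; last first.
  rewrite tS -[leRHS]mul1r ler_pdivlMr; last by lra.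
  have -> : (1 - t%:R^-1) * t%:R^-1 * (t%:R + 1) = 1 - t%:R ^- 2 :> R.
    by field; rewrite gt_eqF//; lra.
  by rewrite gerBl invr_ge0 exprn_ge0.
set x := t%:R `^ 2^-1; set y := t.+1%:R `^ 2^-1.
have x0 : 0 < x by apply: powR_gt0; rewrite ltr0n.
have y0 : 0 < y by apply: powR_gt0; rewrite ltr0n.
have x2 : x ^+ 2 = t%:R by rewrite (@rootK _ 2)// ler0n.
have y2 : y ^+ 2 = t%:R + 1 by rewrite (@rootK _ 2)// ler0n.
have tx : (1 - t%:R^-1) * t%:R = t%:R - 1 :> R.
  by rewrite mulrBl mul1r mulVf// gt_eqF//; lra.
rewrite ler_pdivrMr// mulrC ler_pdivlMr//.
have i0 : 0 <= 1 - t%:R^-1 :> R by rewrite subr_ge0 invf_le1//; lra.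
have xy : x <= y by rewrite ge0_ler_powR ?nnegrE ?invr_ge0 ?ler_nat.
rewrite -(ler_pM2r x0) -mulrA -expr2 x2.
(* [(1 - 1 / t) * (t + 1) = t - 1 / t] is at most [t], so this crude bound suffices. *)
have yx : y * x <= t%:R + 1 by rewrite -y2 expr2 ler_pM2l.
apply: le_trans (ler_wpM2l i0 yx) _.
rewrite mulrDr tx mulr1 -addrA gerDl addrC subr_le0.
by rewrite lerBlDr; have : 0 <= t%:R^-1 :> R; [rewrite invr_ge0|lra].
Qed.

Lemma stddev_bounds j (a s : R) t : 0 < a -> 1 <= s -> (0 < t)%N ->
  0 < query_stddev j a s t <= a.
Proof.
move=> a0 s1 t0; have t1 : 1 <= t%:R :> R by rewrite ler1n.
have s0 : 0 <= s by lra.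
case: j => /=; rewrite divr_gt0 ?powR_gt0 ?ltr0n// ler_pdivrMr ?powR_gt0 ?ltr0n//;
  by rewrite ler_peMr ?powR_ge1// ?invr_ge0// ltW.
Qed.

(** In the variable [t^(1/12)] the powers 1/4 and 1/2 of the schedules and the power 1/3 of the
    cubes all have integer exponents. *)
Lemma twelfth_root (t : nat) : (0 < t)%N -> let x := t%:R `^ 12^-1 : R in
  [/\ 1 <= x, x ^+ 12 = t%:R, t%:R `^ 4^-1 = x ^+ 3 & t%:R `^ 2^-1 = x ^+ 6].
Proof.
move=> t0 x; have t1 : 1 <= t%:R :> R by rewrite ler1n.
split; first by apply: powR_ge1 => //; rewrite invr_ge0.
- by rewrite (@rootK _ 12)// ler0n.
- by rewrite /x (@powR_root _ 4 3).
- by rewrite /x (@powR_root _ 2 6).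
Qed.

(** For one point, [sigma_t] of order [t^(-1/4)] balances bias and variance, both of order
    [t^(-3/2)]. For two points, the variance has order [t^(-2)], and [s >= 1] keeps the bias below
    it up to a constant. *)
Lemma noise_budget j (a s c : R) t : 0 < a -> 1 <= s -> 0 < c -> (0 < t)%N ->
  let sg := query_stddev j a s t in
  (c / t%:R) * sg ^+ 2 <= c * a ^+ 2 * (rate j t / t%:R) /\
  (c / t%:R) ^+ 2 * estimate_scale j sg ^+ 2 <=
    c ^+ 2 * (1 + a ^- 2) * (rate j t / t%:R).
Proof.
move=> a0 s1 c0 t0 sg; have t1 : 1 <= t%:R :> R by rewrite ler1n.
have [x1 x12 x3 x6] := twelfth_root t0.
have r0 : 0 <= rate j t / t%:R by rewrite divr_ge0 ?ler0n// ltW// rate_gt0.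
have a2 : 0 < a ^- 2 by rewrite invr_gt0 exprn_gt0.
have t0' : t%:R != 0 :> R by rewrite pnatr_eq0 -lt0n.
rewrite /sg {sg}; case: j r0 => /= r0.
  rewrite x3 x6 in r0 *; set x := t%:R `^ 12^-1 in x1 x12 x3 x6 r0 *.
  have x0 : x != 0 by rewrite gt_eqF//; lra.
  split; first by rewrite le_eqVlt; apply/orP; left; apply/eqP; rewrite -x12; field; rewrite x0.
  apply: (@le_trans _ _ (c ^+ 2 * a ^- 2 * ((x ^+ 6)^-1 / t%:R))).
    by rewrite le_eqVlt; apply/orP; left; apply/eqP; rewrite -x12; field; rewrite x0 gt_eqF.
  by apply: ler_wpM2r => //; rewrite ler_pM2l ?exprn_gt0//; lra.
have ts : t%:R <= t%:R `^ s by rewrite -[leLHS]powRr1 ?ler_powR// ler0n.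
have T0 : 0 < t%:R :> R by rewrite ltr0n.
split; last first.
  rewrite expr1n mulr1 expr_div_n expr2 -[X in _ <= _ * X]invfM -expr2.
  rewrite ler_pM2r ?invr_gt0 ?exprn_gt0//.
  by rewrite -[leLHS]mulr1 ler_pM2l ?exprn_gt0//; lra.
have -> : c / t%:R * (a / t%:R `^ s) ^+ 2 = c * a ^+ 2 * (t%:R `^ s ^- 2 / t%:R).
  by rewrite expr_div_n; ring.
rewrite ler_pM2l ?mulr_gt0 ?exprn_gt0// ler_pM2r ?invr_gt0//.
rewrite lef_pV2 ?posrE ?exprn_gt0 ?(lt_le_trans T0)// (le_trans ts)//.
by rewrite expr2 ler_peMl ?powR_ge0// (le_trans t1).
Qed.

(** The bound is [t^(-3/4)]: the one-point estimator attains it, with [t^(-1)] from the step size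
    and [t^(1/4)] from [sigma_t^-1]. *)
Lemma increment_budget j (a s c : R) t : 0 < a -> 1 <= s -> 0 < c -> (0 < t)%N ->
  c / t%:R * estimate_scale j (query_stddev j a s t) <=
    c * (1 + a^-1) * (t%:R `^ 12^-1) ^- 9.
Proof.
move=> a0 s1 c0 t0; have [x1 x12 x3 x6] := twelfth_root t0.
set x := t%:R `^ 12^-1 in x1 x12 x3 x6 *.
have x0 : x != 0 by rewrite gt_eqF//; lra.
have x9 : 0 < x ^- 9 by rewrite invr_gt0 exprn_gt0//; lra.
have i0 : 0 < a^-1 by rewrite invr_gt0.
case: j => /=.
  apply: (@le_trans _ _ (c * a^-1 * x ^- 9)); last first.
    by rewrite ler_pM2r// ler_pM2l//; lra.
  by rewrite le_eqVlt; apply/orP; left; apply/eqP; rewrite x3 -x12; field; rewrite x0 gt_eqF.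
rewrite mulr1; apply: (@le_trans _ _ (c * 1 * x ^- 9)); last first.
  by rewrite ler_pM2r// ler_pM2l//; lra.
rewrite mulr1 ler_pM2l// lef_pV2 ?posrE ?exprn_gt0 ?ltr0n//; last by lra.
by rewrite -x12 ler_weXn2l.
Qed.

(** A crude decay common to both schedules, for convergence in probability, where no rate is
    claimed. *)
Lemma schedules_le_root j (a s : R) t : 0 < a -> 1 <= s -> (0 < t)%N ->
  rate j t <= (t%:R `^ 12^-1)^-1 /\
  query_stddev j a s t ^+ 2 <= a ^+ 2 * (t%:R `^ 12^-1)^-1.
Proof.
move=> a0 s1 t0; have [x1 x12 x3 x6] := twelfth_root t0.
have ts : t%:R <= t%:R `^ s by rewrite -[leLHS]powRr1 ?ler_powR ?ler1n.
set x := t%:R `^ 12^-1 in x1 x12 x3 x6 *.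
have x0 : 0 < x by lra.
have xn n : (0 < n)%N -> (x ^+ n)^-1 <= x^-1.
  by move=> n0; rewrite lef_pV2 ?posrE ?exprn_gt0// -[leLHS]expr1 ler_weXn2l.
split.
  by apply: le_trans (rate_le_one_point _ _) _ => //; rewrite /rate x6 xn.
have sx : query_stddev j a s t <= a / x ^+ 3.
  case: (j) => /=; first by rewrite x3.
  rewrite ler_pM2l// lef_pV2 ?posrE ?exprn_gt0 ?powR_gt0 ?ltr0n//.
  by apply: le_trans ts; rewrite -x12 ler_weXn2l.
have /andP[q0 _] := stddev_bounds j a0 s1 t0.
apply: (@le_trans _ _ ((a / x ^+ 3) ^+ 2)).
  by rewrite lerXn2r// nnegrE ?(ltW q0)// (le_trans (ltW q0)).
rewrite exprMn ler_pM2l ?exprn_gt0// exprVn -exprM.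
exact: xn.
Qed.

Lemma cvg_inv_root : (t%:R `^ 12^-1)^-1 @[t --> \oo] --> (0 : R).
Proof.
apply/cvgrPdist_le => e e0; near=> t.
have t0 : (0 < t)%N by near: t; exact: nbhs_infty_gt.
have et : e ^- 12 < t%:R by near: t; exact: nbhs_infty_gtr.
have [x1 x12 _ _] := twelfth_root t0; set x := _ `^ _ in x1 x12 *.
have x0 : 0 < x by lra.
rewrite sub0r normrN ger0_norm ?invr_ge0 ?(ltW x0)//.
rewrite invf_ple ?posrE// -(@ler_pXn2r _ 12) ?nnegrE ?invr_ge0 ?(ltW x0) ?(ltW e0)//.
by rewrite x12 exprVn ltW.
Unshelve. all: by end_near.
Qed.

End schedules.

Section small_increments.
Context {R : realType}.

(* With [x = t^(1/12)], the hypothesis on [h] gives [h t <= delta x] eventually,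
   so [u t * h t <= L delta x^-8], where [x^4 >= k] as soon as [k^3 <= t]. *)
Lemma small_increments (v u h : nat -> R) (B1 B2 L : R) :
  0 <= B1 -> 0 <= B2 -> 0 <= L -> (forall t, 0 <= v t) -> (forall t, 0 <= u t) ->
  (forall t, 1 <= h t) ->
  (forall t, (0 < t)%N -> u t <= L * (t%:R `^ 12^-1) ^- 9) ->
  (forall t, (1 < t)%N -> v t.+1 <= v t + (B1 * (u t * h t) + B2 * (u t * h t) ^+ 2)) ->
  h t ^+ 24 / t%:R ^+ 2 @[t --> \oo] --> 0 -> v (k ^ 3)%N @[k --> \oo] --> 0 ->
  v t @[t --> \oo] --> 0.
Proof.
move=> B10 B20 L0 v0 u0 h1 uL vinc h0; apply: cvg0_along_cubes => // e e0.
pose M := (B1 + B2) * L + L + 1; have M0 : 0 < M.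
  by rewrite ltr_wpDl// addr_ge0// mulr_ge0// addr_ge0.
(* Small enough to give both [u t * h t <= 1], so that its square is no larger, and a total
   increment of at most [e / k%:R ^+ 2]. *)
pose del := Num.min e 1 / M; have del0 : 0 < del.
  by rewrite divr_gt0// lt_min e0 ltr01.
have Ldel : L * del <= 1.
  rewrite /del mulrA ler_pdivrMr// mul1r; apply: (@le_trans _ _ L).
    by rewrite -[leRHS]mulr1 ler_wpM2l// ge_min lexx orbT.
  by rewrite /M; have := mulr_ge0 (addr_ge0 B10 B20) L0; lra.
have BL : (B1 + B2) * (L * del) <= e.
  rewrite mulrA /del mulrA ler_pdivrMr//.
  apply: (@le_trans _ _ ((B1 + B2) * L * e)).
    by rewrite ler_wpM2l ?mulr_ge0 ?addr_ge0// ge_min lexx.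
  by rewrite mulrC ler_pM2l// /M; lra.
have del24 : 0 < del ^+ 24 by rewrite exprn_gt0.
near=> t => k k0 kt.
have t1 : (1 < t)%N by near: t; exact: nbhs_infty_gt.
have t0 : (0 < t)%N by exact: ltnW.
have [x1 x12 _ _] := @twelfth_root R t t0; have ut := uL t t0.
set x := t%:R `^ 12^-1 in x1 x12 ut *.
have x0 : 0 < x by lra.
have ht : h t <= del * x.
  have : h t ^+ 24 / t%:R ^+ 2 <= del ^+ 24.
    near: t; move/cvgrPdist_le : h0 => /(_ _ del24); apply: filterS => n.
    rewrite sub0r normrN ger0_norm// divr_ge0 ?sqr_ge0// exprn_ge0//.
    by rewrite (le_trans _ (h1 n)).
  (* As [t%:R ^+ 2 = x ^+ 24], a 24th root can be taken on both sides. *)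
  rewrite ler_pdivrMr ?exprn_gt0 ?ltr0n// -x12 -exprM -exprMn.
  by rewrite ler_pXn2r// nnegrE ?(le_trans _ (h1 t))// mulr_ge0// ltW.
have kR : 1 <= k%:R :> R by rewrite ler1n.
have k2 : 0 < k%:R ^+ 2 :> R by rewrite exprn_gt0//; lra.
have kx : k%:R <= x ^+ 4.
  have x4 : 0 <= x ^+ 4 by rewrite exprn_ge0// ltW.
  by rewrite -(@ler_pXn2r _ 3)// ?nnegrE// -exprM x12 -natrX ler_nat.
have y0 : 0 <= u t * h t by rewrite mulr_ge0// (le_trans _ (h1 t)).
have yL : u t * h t <= L * del / k%:R ^+ 2.
  apply: (@le_trans _ _ (L * x ^- 9 * (del * x))).
    by apply: ler_pM => //; rewrite (le_trans _ (h1 t)).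
  have -> : L * x ^- 9 * (del * x) = L * del * x ^- 8.
    by field; rewrite gt_eqF.
  have x8 : x ^+ 8 = (x ^+ 4) ^+ 2 by rewrite -exprM.
  apply: ler_wpM2l; first by rewrite mulr_ge0// ltW.
  rewrite lef_pV2 ?posrE ?(exprn_gt0 _ x0)// x8 lerXn2r// nnegrE//.
  by rewrite exprn_ge0// ltW.
have y1 : u t * h t <= 1.
  apply: (le_trans yL); rewrite ler_pdivrMr// mul1r (le_trans Ldel)//.
  by rewrite exprn_ege1.
have y2 : (u t * h t) ^+ 2 <= u t * h t by rewrite expr2 ler_piMl.
apply: (le_trans (vinc t t1)); rewrite lerD2l.
apply: (@le_trans _ _ ((B1 + B2) * (u t * h t))).
  by rewrite mulrDl lerD2l ler_wpM2l.
apply: (@le_trans _ _ ((B1 + B2) * (L * del / k%:R ^+ 2))).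
  by rewrite ler_wpM2l// addr_ge0.
by rewrite mulrA ler_pM2r// invr_gt0.
Unshelve. all: by end_near.
Qed.

(** The comparison of [n^(-3/2)] with the integral of [u^(-3/2)] from [n - 1] to [n], for
    [n = k + 2]; algebraically it rests on [x ^+ 2 - y ^+ 2 = 1]. *)
Lemma rate_cube_telescopes (k : nat) :
  (((k.+2 ^ 3)%:R : R) `^ 2^-1)^-1 <=
  2 * (k.+1%:R `^ 2^-1)^-1 - 2 * (k.+2%:R `^ 2^-1)^-1.
Proof.
set y := k.+1%:R `^ 2^-1; set x := k.+2%:R `^ 2^-1.
have x0 : 0 < x by apply: powR_gt0; rewrite ltr0n.
have y0 : 0 < y by apply: powR_gt0; rewrite ltr0n.
have x2 : x ^+ 2 = k.+2%:R by rewrite (@rootK _ _ 2)// ler0n.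
have y2 : y ^+ 2 = k.+1%:R by rewrite (@rootK _ _ 2)// ler0n.
have -> : (k.+2 ^ 3)%:R `^ 2^-1 = x ^+ 3.
  by rewrite natrX /x -(powR_mulrn 3 (ler0n R k.+2)) -powRrM mulrC powRrM powR_mulrn ?powR_ge0.
have xy : y <= x by rewrite ge0_ler_powR ?nnegrE ?invr_ge0 ?ler_nat.
have xy2 : (x - y) * (x + y) = 1.
  by rewrite -subr_sqr x2 y2 -[k.+2]addn1 natrD addrC addrA addNr add0r.
have d0 : 0 <= x - y by rewrite subr_ge0.
have -> : 2 * y^-1 - 2 * x^-1 = 2 * (x - y) / (x * y).
  by field; rewrite !gt_eqF.
rewrite ler_pdivlMr ?mulr_gt0//.
have -> : x ^- 3 * (x * y) = y / x ^+ 2 by field; rewrite gt_eqF.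
rewrite ler_pdivrMr ?exprn_gt0//.
have : 1 <= (x - y) * (2 * x) by rewrite -[leLHS]xy2 ler_wpM2l//; lra.
move=> /(ler_wpM2l (ltW x0)); nra.
Qed.

End small_increments.

Lemma cvg_from2 (R : realType) (f : nat -> R) (l : R) :
  f k.+2 @[k --> \oo] --> l -> f k @[k --> \oo] --> l.
Proof.
move=> fl; suff : f (k + 2)%N @[k --> \oo] --> l by rewrite cvg_shiftn.
by under eq_fun do rewrite addn2.
Qed.

Lemma edot_add_le (R : realType) (m n : nat) (x y : 'M[R]_(m, n)) :
  edot (x + y) (x + y) <= 2 * edot x x + 2 * edot y y.
Proof.
have : 0 <= edot (x - y) (x - y) by exact: edot_ge0.
rewrite -scaleN1r !edotDl !edotDr !edotZl !edotZr [edot y x]edotC; lra.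
Qed.

(** * Convergence of a run *)

Section run.
Context {R : realType} {N d : nat} {dT : measure_display} {T : measurableType dT}.
Variables (A : 'I_N -> set 'rV[R]_d) (J : 'I_N -> 'M[R]_(N, d) -> R).
Variables (nu rho a K c s : R) (astar : 'M[R]_(N, d)) (j : oracle).
Variables (P : probability T R) (mu xi : nat -> T -> 'M[R]_(N, d)).
Hypotheses (A_convex : forall i, convex_set (A i))
  (A_compact : forall i, compact (A i)) (Aastar : joint_action_set A astar)
  (nu_gt0 : 0 < nu) (stable : strongly_variationally_stable A J nu astar)
  (cJ : forall i, continuous (J i))
  (cM : forall p : 'I_N * 'I_d, continuous (fun x => pseudo_gradient J x p.1 p.2))
  (A_rho : forall x, joint_action_set A x -> `|x| <= rho) (K0 : 0 <= K)
  (a0 : 0 < a) (s1 : 1 <= s) (c_ge : nu^-1 <= c).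
Hypothesis hK : forall p mu s z, `|mu| <= rho -> 0 < s <= a ->
  [/\ `|grad_estimate j J s mu (mu + s *: z) p.1 p.2|
        <= K * estimate_scale j s * noise_weight z,
      `|grad_estimate j J s mu (mu + s *: z) p.1 p.2 -
         (frozen_cost j J s mu z p / s * z p.1 p.2 +
          pseudo_gradient J mu p.1 p.2 * z p.1 p.2 ^+ 2)| <= K * s * noise_weight z,
      `|frozen_cost j J s mu z p| <= K * noise_weight z &
      `|pseudo_gradient J mu p.1 p.2| <= K].
Let gamma t : R := c / t%:R.
Let sigma := query_stddev j a s.
Hypothesis mu_xi_run : zeroth_order_algorithm j A J gamma sigma P mu xi.

Let past_generators t : set_system T :=
  (\bigcup_(u in [set u | (0 < u <= t)%N]) coordinate_events (mu u)) `|`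
  (\bigcup_(u in [set u | (0 < u < t)%N]) coordinate_events (xi u)).

Let c_gt0 : 0 < c.
Proof. by apply: lt_le_trans c_ge; rewrite invr_gt0. Qed.

Let gamma_gt0 t : (0 < t)%N -> 0 < gamma t.
Proof. by move=> t0; rewrite divr_gt0// ltr0n. Qed.

Let sigma_bounds t : (0 < t)%N -> 0 < sigma t <= a.
Proof. exact: stddev_bounds. Qed.

Let sigma_gt0 t : (0 < t)%N -> 0 < sigma t.
Proof. by case/sigma_bounds/andP. Qed.

Let measurable_states t p : (0 < t)%N -> measurable_fun setT (fun w => mu t w p.1 p.2).
Proof. by case: mu_xi_run => h _ _ /h[]. Qed.

Let measurable_queries t p : (0 < t)%N -> measurable_fun setT (fun w => xi t w p.1 p.2).
Proof. by case: mu_xi_run => h _ _ /h[]. Qed.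

Let past_measurable t : <<s past_generators t >> `<=` measurable.
Proof.
apply: smallest_sub; first exact: sigma_algebra_measurable.
move=> _ [] [u] /= /andP[u0 _] [p _ [B mB <-]].
  exact: measurable_states.
exact: measurable_queries.
Qed.

Let measurable_state_past t p : (0 < t)%N -> measurable_fun setT
  ((fun w => mu t w p.1 p.2) : g_sigma_algebraType (past_generators t) -> R).
Proof.
move=> t0 _ B mB; apply: sub_gen_smallest; left.
by exists t; [rewrite /= t0 leqnn|exists p => //; exists B].
Qed.

Let law t (t0 : (0 < t)%N) E : <<s past_generators t >> E ->
  forall B : 'I_N * 'I_d -> set R, (forall p, measurable (B p)) ->
  P (E `&` [set w | forall p, B p (xi t w p.1 p.2)]) =
  (\int[P]_(w in E) (\prod_p fine (normal_prob (mu t w p.1 p.2) (sigma t) (B p)))%:E)%E.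
Proof.
move=> GE B mB; case: mu_xi_run => _ /(_ t t0 E GE (fun i k => B (i, k))) h _.
have {}h := h (fun i k => mB (i, k)).
transitivity (P (E `&` [set w | forall i k, B (i, k) (xi t w i k)])).
  congr (P (E `&` _)); apply/seteqP; split => w /= Bw; first by move=> i k; exact: (Bw (i, k)).
  by case=> i k; exact: Bw.
rewrite h; apply: eq_integral => w _; congr (_%:E).
rewrite /gaussian_rectangle pair_big; apply: eq_bigr => -[i k] _ /=.
by rewrite mxE.
Qed.

Let step t w i : (0 < t)%N -> row i (mu t.+1 w) = Defs.proj (A i) (row i (mu t w) -
  gamma t *: row i (grad_estimate j J (sigma t) (mu t w) (xi t w))).
Proof. by case: mu_xi_run => _ _ h t0; exact: h. Qed.

(** The initial state may lie outside the action sets; this is why the estimates below start at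
    index 2. *)
Lemma states_in_action_set t w : (1 < t)%N -> joint_action_set A (mu t w).
Proof.
case: t => [//|[//|t]] _ i; rewrite step//.
by apply: (projP _ _ _).1 => //; exists (row i astar); exact: Aastar.
Qed.

Let V t w := edot (mu t w - astar) (mu t w - astar).
Let z t := noise (mu t) (xi t) (sigma t).

Lemma measurable_V t : (0 < t)%N -> measurable_fun setT (V t).
Proof.
move=> t0; apply: measurable_sq_dist => i k.
exact: (measurable_states (i, k)).
Qed.

Lemma integrable_V t : (1 < t)%N -> P.-integrable setT (EFin \o V t).
Proof.
move=> t1; have t0 : (0 < t)%N by exact: ltnW.
have GP := @past_measurable t.
have mm := fun p => @measurable_state_past t p t0.
have mx := fun p => @measurable_queries t p t0.
apply: (integrable_sq_dist (sigma_gt0 t0) GP mm mx (law t0) Aastar A_rho).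
  by move=> i k; exact: (measurable_states (i, k)).
by move=> w; exact: states_in_action_set.
Qed.

Lemma mean_V_rate : exists2 C, 0 <= C & forall t, (1 < t)%N ->
  (\int[P]_w (V t w)%:E <= (C * rate j t)%:E)%E.
Proof.
pose v t : R := fine (\int[P]_w (V t w)%:E).
have vE t : (1 < t)%N -> (\int[P]_w (V t w)%:E)%E = (v t)%:E.
  by move=> t1; rewrite fineK//; exact: integrable_fin_num (integrable_V t1).
have v0 t : 0 <= v t.
  by apply: fine_ge0; apply: integral_ge0 => w _; rewrite lee_fin edot_ge0.
pose C0 := (N * d)%:R * (2 / nu * K ^+ 2 * (c * a ^+ 2) +
  K ^+ 2 * (c ^+ 2 * (1 + a ^- 2))) * @weight_moment R N d.
have W0 : 0 <= @weight_moment R N d by rewrite addr_ge0// mulr_ge0// sqrtr_ge0.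
have n0 : 0 <= 2 / nu by rewrite divr_ge0// ltW.
have a2 : 0 <= a ^- 2 by rewrite invr_ge0 sqr_ge0.
have C00 : 0 <= C0.
  rewrite mulr_ge0// mulr_ge0// addr_ge0// mulr_ge0 ?sqr_ge0//.
  - by rewrite mulr_ge0 ?sqr_ge0.
  - by rewrite mulr_ge0 ?sqr_ge0// ltW.
  - by rewrite mulr_ge0 ?sqr_ge0// addr_ge0.
have [C C_ge0 vC] : exists2 C, 0 <= C & forall t, (2 <= t)%N -> v t <= C * rate j t.
  apply: (@rate_recursion R v (rate j) C0 2) => // [t t1|t t1|t t1].
  - by apply: rate_gt0; exact: ltnW.
  - by apply: rate_succ; exact: ltnW.
  have t0 : (0 < t)%N by exact: ltnW.
  have GP := @past_measurable t.
  have mm := fun p => @measurable_state_past t p t0.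
  have mx := fun p => @measurable_queries t p t0.
  have /andP[_ sa] := sigma_bounds t0.
  have := one_step_mean (sigma_gt0 t0) GP mm mx (law t0) A_convex A_compact Aastar
    nu_gt0 stable A_rho K0 hK cJ cM (gamma_gt0 t0) sa
    (fun w => states_in_action_set w t1) (fun w i => @step t w i t0)
    (fun i k => @measurable_states t.+1 (i, k) isT) (vE _ t1).
  rewrite -/(V t.+1) vE ?ltnS// lee_fin => /le_trans; apply.
  have [h1 h2] := noise_budget j a0 s1 c_gt0 t0.
  apply: lerD.
    (* Here [nu * c >= 1] gives [nu * gamma t >= 1 / t]. *)
    rewrite ler_wpM2r// lerD2l lerN2 ler_pM2l// /gamma mulrA ler_peMl ?invr_ge0//.
    by rewrite -(divff (lt0r_neq0 nu_gt0)) ler_pM2l.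
  rewrite /C0 [leRHS]mulrAC ler_wpM2r// -[leRHS]mulrA ler_wpM2l// [leRHS]mulrDl.
  have nK : 0 <= 2 / nu * K ^+ 2 by apply: mulr_ge0 => //; exact: sqr_ge0.
  apply: lerD; rewrite -[leRHS]mulrA; first exact: ler_wpM2l nK _ _ h1.
  exact: ler_wpM2l (sqr_ge0 K) _ _ h2.
exists C => // t t1; rewrite vE// lee_fin.
exact: vC.
Qed.

Let mean_weight t : (0 < t)%N ->
  (\int[P]_w (big_weight (z t w))%:E <= (@weight_moment R N d)%:E)%E.
Proof.
move=> t0.
exact: (weight_moment_le (sigma_gt0 t0) (@past_measurable t)
  (fun p => @measurable_state_past t p t0) (fun p => @measurable_queries t p t0) (law t0)).
Qed.

Let measurable_weight t : (0 < t)%N -> measurable_fun setT (fun w => big_weight (z t w)).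
Proof.
move=> t0.
exact: (measurable_big_weight (sigma t) (@past_measurable t)
  (fun p => @measurable_state_past t p t0) (fun p => @measurable_queries t p t0)).
Qed.

(** The slower, one-point rate serves both oracles; along cubes it becomes [n^(-3/2)] with
    [n = k + 2]. *)
Let ae_V_along_cubes : {ae P, forall w, V (k.+2 ^ 3)%N w @[k --> \oo] --> 0}.
Proof.
have [C C0 VC] := mean_V_rate.
pose b k : R := C * (2 * (k.+1%:R `^ 2^-1)^-1).
apply: (@ae_cvg0_of_telescoping_means _ _ _ P (fun k => V (k.+2 ^ 3)%N) b) => k.
- by apply: measurable_V; rewrite expn_gt0.
- by move=> w; exact: edot_ge0.
- by rewrite /b mulr_ge0// mulr_ge0// invr_ge0 powR_ge0.
have k1 : (1 < k.+2 ^ 3)%N by rewrite -(exp1n 3) ltn_exp2r.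
apply: (le_trans (VC _ k1)); rewrite lee_fin /b -mulrBr ler_wpM2l//.
apply: le_trans (rate_cube_telescopes k).
by apply: rate_le_one_point; rewrite expn_gt0.
Qed.

(** The means of the weights are bounded and [1 / (k + 2)^2 <= 1 / (k + 1) - 1 / (k + 2)]. Through
    [noise_weightX24] the conclusion says that the noise weight is almost surely [o(t^(1/12))]. *)
Let ae_weight : {ae P, forall w, big_weight (z k.+2 w) / k.+2%:R ^+ 2 @[k --> \oo] --> 0}.
Proof.
pose W := @weight_moment R N d.
have W0 : 0 <= W by rewrite addr_ge0// mulr_ge0// sqrtr_ge0.
pose b k : R := W * k.+1%:R^-1.
apply: (@ae_cvg0_of_telescoping_means _ _ _ P
  (fun k w => big_weight (z k.+2 w) / k.+2%:R ^+ 2) b) => k.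
- by apply: measurable_funM => //; exact: measurable_weight.
- by move=> w; rewrite divr_ge0 ?expR_ge0// sqr_ge0.
- by rewrite /b mulr_ge0.
have i0 : 0 <= k.+2%:R ^- 2 :> R by rewrite invr_ge0 sqr_ge0.
under eq_integral do rewrite mulrC EFinM.
rewrite ge0_integralZl//; last 2 first.
- by apply/measurable_EFinP; exact: measurable_weight.
- by move=> w _; rewrite lee_fin expR_ge0.
apply: le_trans (lee_wpmul2l _ (mean_weight _)) _ => //.
rewrite -EFinM lee_fin /b -mulrBr mulrC ler_wpM2l//.
have -> : k.+2%:R = k.+1%:R + 1 :> R by rewrite -[k.+2]addn1 natrD.
have y1 : 0 < k.+1%:R :> R by rewrite ltr0n.
move: y1; set y := k.+1%:R => y1.
have -> : y^-1 - (y + 1)^-1 = (y * (y + 1))^-1.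
  by field; rewrite !gt_eqF//; lra.
rewrite lef_pV2 ?posrE ?exprn_gt0 ?mulr_gt0//; nra.
Qed.

Lemma ae_V_cvg0 : {ae P, forall w, V t w @[t --> \oo] --> 0}.
Proof.
apply: filterS2 ae_V_along_cubes ae_weight => w Vw zw.
pose u t := gamma t * estimate_scale j (sigma t).
pose B1 := (N * d)%:R * (4 * rho * K); pose B2 := (N * d)%:R * K ^+ 2.
have rho0 : 0 <= rho by exact: le_trans (A_rho Aastar).
have q0 t : 0 <= estimate_scale j (sigma t).
  rewrite /estimate_scale /sigma; case: (j) => //=.
  by rewrite invr_ge0 divr_ge0 ?powR_ge0// ltW.
apply: (@small_increments R (V ^~ w) u (fun t => noise_weight (z t w)) B1 B2
  (c * (1 + a^-1))).
- by rewrite /B1 mulr_ge0// mulr_ge0// mulr_ge0.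
- by rewrite /B2 mulr_ge0// sqr_ge0.
- by rewrite mulr_ge0 ?(ltW c_gt0)// addr_ge0// invr_ge0 ltW.
- by move=> t; exact: edot_ge0.
- by move=> t; rewrite /u mulr_ge0// divr_ge0// ltW.
- by move=> t; exact: noise_weight_ge1.
- by move=> t t0; exact: increment_budget.
- move=> t t1; have t0 : (0 < t)%N by exact: ltnW.
  have step' i : row i (mu t.+1 w) = Defs.proj (A i) (row i (mu t w) -
      gamma t *: row i (grad_estimate j J (sigma t) (mu t w) (mu t w + sigma t *: z t w))).
    rewrite /z -query_noise; first exact: step.
    exact: sigma_gt0.
  have := one_step_increment A_convex A_compact Aastar A_rho hK
    (gamma_gt0 t0) (sigma_bounds t0) (states_in_action_set w t1) step'.
  by rewrite /V /B1 /B2 /u; move/le_trans; apply; rewrite lerD2l mulrDr !mulrA.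
- under eq_fun do rewrite noise_weightX24.
  exact: cvg_from2 zw.
- exact: (cvg_from2 (f := fun k => V (k ^ 3)%N w)).
Qed.

Lemma states_cvg_ae : {ae P, forall w, mu t w @[t --> \oo] --> astar}.
Proof.
apply: filterS ae_V_cvg0 => w Vw.
apply/cvgrPdist_le => e e0.
have e2 : 0 < e ^+ 2 by rewrite exprn_gt0.
move/cvgrPdist_le : Vw => /(_ _ e2); apply: filterS => t.
rewrite sub0r normrN ger0_norm ?edot_ge0// => Ve.
rewrite distrC (le_trans (norm_le_enorm _))//.
rewrite -(@ler_pXn2r _ 2) ?nnegrE ?sqrtr_ge0 ?(ltW e0)//.
by rewrite sqr_enorm.
Qed.

Let query_dist_le t w : (0 < t)%N -> edot (xi t w - astar) (xi t w - astar) <=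
  2 * V t w + 8 * (N * d)%:R * sigma t ^+ 2 * big_weight (z t w).
Proof.
move=> t0; have -> : xi t w - astar = (mu t w - astar) + sigma t *: z t w.
  by rewrite {1}(query_noise (mu t) (xi t) (sigma_gt0 t0) w) addrAC.
set y := sigma t *: z t w; apply: (le_trans (edot_add_le _ _)).
have h2 : edot y y <= 4 * (N * d)%:R * sigma t ^+ 2 * big_weight (z t w).
  rewrite edotZl edotZr mulrA -expr2.
  have -> : 4 * (N * d)%:R * sigma t ^+ 2 * big_weight (z t w) =
    sigma t ^+ 2 * ((N * d)%:R * (4 * big_weight (z t w))) by ring.
  rewrite ler_wpM2l ?sqr_ge0//; apply: le_trans (edot_le_norm _) _.
  rewrite ler_wpM2l//; have := expR_ge1Dx (`|z t w| ^+ 2 / 4).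
  by rewrite -/(big_weight _); lra.
rewrite -/(V t w); lra.
Qed.

(** Markov's inequality for the squared distance, whose mean is bounded by that of [V t] and by
    [sigma t ^+ 2] times a bounded moment of the noise. *)
Lemma queries_cvg_in_probability : cvg_in_probability P xi astar.
Proof.
move=> e e0; have [C C0 VC] := mean_V_rate.
pose W := @weight_moment R N d.
have W0 : 0 <= W by rewrite addr_ge0// mulr_ge0// sqrtr_ge0.
pose M := (2 * C + 8 * (N * d)%:R * a ^+ 2 * W) / e ^+ 2.
have e2 : 0 < e ^+ 2 by rewrite exprn_gt0.
apply: (@squeeze_cvge _ _ _ _ (cst 0%E) _
    (fun t : nat => (M * (t%:R `^ 12^-1)^-1)%:E)); last 2 first.
- exact: cvg_cst.
- apply: cvg_EFin; first exact: nearW.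
  rewrite -(mulr0 M); apply: cvgM; [exact: cvg_cst|exact: cvg_inv_root].
near=> t.
have t1 : (1 < t)%N by near: t; exact: nbhs_infty_gt.
have t0 : (0 < t)%N by exact: ltnW.
rewrite measure_ge0/=.
pose D w := edot (xi t w - astar) (xi t w - astar).
have mD : measurable_fun setT (D : T -> R).
  by apply: measurable_sq_dist => i k; exact: (measurable_queries (i, k)).
have -> : [set w | e <= enorm (xi t w - astar)] =
    setT `&` [set w | (e ^+ 2)%:E <= `|(D w)%:E|]%E.
  rewrite setTI; apply/seteqP; split => w /=;
    rewrite lee_fin ger0_norm ?edot_ge0// /D -sqr_enorm ler_pXn2r// ?nnegrE;
    by rewrite ?sqrtr_ge0 ?ltW.
have [r_le s_le] := schedules_le_root j a0 s1 t0.
set y := (_ `^ _)^-1 in r_le s_le *.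
have [mDE mWE] : measurable_fun setT (EFin \o D) /\
    measurable_fun setT (fun w => (big_weight (z t w))%:E).
  by split; apply/measurable_EFinP => //; exact: measurable_weight.
have mVE : measurable_fun setT (fun w => (V t w)%:E).
  by apply/measurable_EFinP; exact: measurable_V.
have := le_integral_abse P measurableT mDE e2 => markov.
have k0 : 0 <= 8 * (N * d)%:R * sigma t ^+ 2 by rewrite mulr_ge0 ?sqr_ge0// mulr_ge0.
have meanD : (\int[P]_w `|(D w)%:E| <= ((2 * C + 8 * (N * d)%:R * a ^+ 2 * W) * y)%:E)%E.
  apply: (@le_trans _ _ (\int[P]_w (2%:E * (V t w)%:E +
      (8 * (N * d)%:R * sigma t ^+ 2)%:E * (big_weight (z t w))%:E))%E).
    apply: ge0_le_integral => //.
    - exact: measurableT_comp.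
    - by apply: emeasurable_funD; apply: emeasurable_funM.
    - move=> w _; rewrite -!EFinM -EFinD lee_fin ger0_norm ?edot_ge0//.
      exact: query_dist_le.
  rewrite ge0_integralD//=; last 4 first.
  - by move=> w _; rewrite -EFinM lee_fin mulr_ge0// edot_ge0.
  - exact: emeasurable_funM.
  - by move=> w _; rewrite -EFinM lee_fin mulr_ge0// expR_ge0.
  - exact: emeasurable_funM.
  rewrite !ge0_integralZl//; last 2 first.
  - by move=> w _; rewrite lee_fin expR_ge0.
  - by move=> w _; rewrite lee_fin edot_ge0.
  have h1 : (2%:E * \int[P]_w (V t w)%:E <= 2%:E * (C * rate j t)%:E)%E.
    by apply: lee_wpmul2l; [rewrite lee_fin|exact: VC].
  have h2 : ((8 * (N * d)%:R * sigma t ^+ 2)%:E * \int[P]_w (big_weight (z t w))%:E <=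
      (8 * (N * d)%:R * sigma t ^+ 2)%:E * W%:E)%E.
    by apply: lee_wpmul2l; [rewrite lee_fin|exact: mean_weight].
  apply: le_trans (leeD h1 h2) _.
  rewrite -!EFinM -EFinD lee_fin [leRHS]mulrDl; apply: lerD.
    by rewrite -mulrA ler_wpM2l// ler_wpM2l.
  have k1 : 0 <= 8 * (N * d)%:R * W :> R by rewrite mulr_ge0// mulr_ge0.
  have -> : 8 * (N * d)%:R * sigma t ^+ 2 * W = 8 * (N * d)%:R * W * sigma t ^+ 2 by ring.
  have -> : 8 * (N * d)%:R * a ^+ 2 * W * y = 8 * (N * d)%:R * W * (a ^+ 2 * y) by ring.
  exact: ler_wpM2l k1 _ _ s_le.
have := le_trans markov meanD.
rewrite [X in (_ * X)%E](_ : _ = P (setT `&` [set w | (e ^+ 2)%:E <= `|(D w)%:E|]%E))//.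
move=> h; rewrite -(@lee_pmul2l _ (e ^+ 2)%:E)//.
rewrite -EFinM /M; apply: (le_trans h); rewrite lee_fin.
by rewrite le_eqVlt; apply/orP; left; apply/eqP; field; rewrite gt_eqF.
Unshelve. all: by end_near.
Qed.

End run.

Theorem theorem1 (R : realType) (N d : nat)
    (A : 'I_N -> set 'rV[R]_d) (J : 'I_N -> 'M[R]_(N, d) -> R)
    (nu alpha : R) (astar : 'M[R]_(N, d))
    (A_convex : forall i, convex_set (A i))
    (A_closed : forall i, closed (A i))
    (J_C1 : forall i, continuously_differentiable (J i : _ -> R^o))
    (J_convex : forall i a, convex_function [set: 'rV[R]_d]
       (fun b => J i (deviate a i b)))
    (A_compact : forall i, compact (A i))
    (astar_nash : nash_equilibrium A J astar)
    (nu_gt0 : 0 < nu)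
    (astar_stable : strongly_variationally_stable A J nu astar)
    (alpha_lt2 : alpha < 2)
    (J_growth : forall i, exp_power_growth alpha (J i))
    (M_smooth : twice_differentiable (pseudo_gradient J))
    (j : oracle) (c a s : R)
    (c_ge : nu^-1 <= c) (a_gt0 : 0 < a) (s_ge1 : 1 <= s)
    (dT : measure_display) (T : measurableType dT) (P : probability T R)
    (mu xi : nat -> T -> 'M[R]_(N, d))
    (mu_xi_run : zeroth_order_algorithm j A J
       (fun t : nat => c / t%:R)
       (query_stddev j a s)
       P mu xi) :
  [/\ forall b, nash_equilibrium A J b -> b = astar,
      {ae P, forall w, mu t w @[t --> \oo] --> astar},
      cvg_in_probability P xi astar &
      exists C : R, \forall t \near \oo,
        ('E_P[fun w => (enorm (mu t w - astar) ^+ 2)%R] <=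
         (C * mse_rate R j N d t)%:E)%E].
Proof.
have dJ i x : differentiable (J i) x by exact: (J_C1 i).1.
have Aastar := astar_nash.1.
have cJ i : continuous (J i) by move=> x; exact: differentiable_continuous.
have cM := continuous_pseudo_gradient M_smooth.
have [rho _ A_rho] := joint_action_set_bounded A_compact.
have [K K0 hK] := estimate_bound rho j J_C1 J_growth M_smooth alpha_lt2 a_gt0.
split.
- by move=> b; exact: (nash_unique A_convex dJ nu_gt0 Aastar astar_stable).
- exact: (states_cvg_ae A_convex A_compact Aastar nu_gt0 astar_stable cJ cM A_rho K0
    a_gt0 s_ge1 c_ge hK mu_xi_run).
- exact: (queries_cvg_in_probability A_convex A_compact Aastar nu_gt0 astar_stable cJ cM
    A_rho K0 a_gt0 s_ge1 c_ge hK mu_xi_run).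
have [C C0 rateC] := mean_V_rate A_convex A_compact Aastar nu_gt0 astar_stable cJ cM
  A_rho K0 a_gt0 s_ge1 c_ge hK mu_xi_run.
exists C; near=> t.
have t1 : (1 < t)%N by near: t; exact: nbhs_infty_gt.
have t0 : (0 < t)%N by exact: ltnW.
rewrite unlock; have rt : 0 < rate j t :> R by exact: rate_gt0.
have mseE : mse_rate R j N d t = (if j is TwoPoint then (N * d) ^ 2 else N * d)%N%:R * rate j t.
  by rewrite /mse_rate /rate; case: (j); rewrite // expnMn.
(* If [N * d = 0] the claimed bound is 0, but there is only one joint action, so the error is 0 too.
   Otherwise the dimension factor is at least 1. *)
have [Nd0|Nd0] := posnP (N * d).
  rewrite mseE (_ : (if j is TwoPoint then _ else _) = 0%N) ?mul0r ?mulr0; last first.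
    by rewrite Nd0; case: (j).
  rewrite integral0_eq// => w _; rewrite sqr_enorm; congr (_%:E).
  apply/eqP; rewrite eq_le edot_ge0 andbT.
  by apply: le_trans (edot_le_norm _) _; rewrite Nd0 mul0r.
under eq_integral do rewrite sqr_enorm.
apply: (le_trans (rateC t t1)); rewrite lee_fin ler_wpM2l// mseE.
rewrite ler_peMl ?(ltW rt)// ler1n.
by case: (j) => //; rewrite expn_gt0 Nd0.
Unshelve. all: by end_near.
Qed.
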